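(* Let $l\in H^1(0,T;L^2(\Omega))$ and $d_0\in L^2(\Omega)$, and let $\tau$ be sufficiently small. Let $(\varphi,d)\in V\times X$ be the solution of the continuous state equation and $(\varphi_\tau,d_\tau)\in V_\tau^0\times X_\tau^0$ the solution of the dG(0) semidiscrete state equation, both with right-hand side $l$ and initial state $d_0$. Then $$\|\varphi-\varphi_\tau\|_{I\times\Omega}+\|d-d_\tau\|_{I\times\Omega}\le C\tau\{\|\partial_t\varphi\|_{I\times\Omega}+\|\partial_t d\|_{I\times\Omega}\}$$ with a constant $C>0$ independent of the temporal discretization parameter $\tau$.
   Context: Throughout, $\Omega\subset\mathbb{R}^N$, $N\in\{2,3\}$, is a convex polygonal (polyhedral if $N=3$) domain, $T>0$, $I=(0,T)$, and $\alpha,\beta,\delta,r>0$ are fixed. For a real-valued function $y$, $\max(y)$ denotes the pointwise function $\max\{y,0\}$. $(\cdot,\cdot)$, $\|\cdot\|$ are the inner product and norm of $L^2(\Omega)$; $(\cdot,\cdot)_{I\times\Omega}$, $\|\cdot\|_{I\times\Omega}$ those of $L^2(0,T;L^2(\Omega))$. $V:=L^2(0,T;H^1_0(\Omega))$, $X:=H^1(0,T;L^2(\Omega))$. Continuous state equation: find $(\varphi,d)\in V\times X$ with $d(0)=d_0$ and $$\alpha(\nabla\varphi,\nabla\psi)_{I\times\Omega}+\beta(\varphi-d,\psi)_{I\times\Omega}+(\partial_t d,\lambda)_{I\times\Omega}=(l,\psi)_{I\times\Omega}+\tfrac1\delta(\max(-\beta(d-\varphi)-r),\lambda)_{I\times\Omega}$$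 for all $(\psi,\lambda)\in V\times X$. It has a unique solution, and for $l\in H^1(0,T;L^2(\Omega))$ one has $\varphi\in H^1(0,T;L^2(\Omega))$. Time discretization: $0=t_0<t_1<\dots<t_M=T$, $I_m=(t_{m-1},t_m]$, $\tau_m=t_m-t_{m-1}$, $\tau=\max_m\tau_m$. $V_\tau^0=\{v\in V: v|_{I_m}\in\mathbb{P}_0(I_m;H_0^1(\Omega)),\,m=1,\dots,M\}$, $X_\tau^0=\{v\in L^2(0,T;L^2(\Omega)): v|_{I_m}\in\mathbb{P}_0(I_m;L^2(\Omega)),\,m=1,\dots,M\}$, where $\mathbb{P}_0(I_m;Y)$ are the constant functions on $I_m$ with values in $Y$. For such functions write $v_{m}$ for the value on $I_m$; then $v_{m-1}^+=v_m$, $v_m^-=v_m$, and $[v]_m=v_{m+1}-v_m$. Semidiscrete state equation: find $(\varphi_\tau,d_\tau)\in V^0_\tau\times X^0_\tau$ with $$\alpha(\nabla\varphi_\tau,\nabla\psi)_{I\times\Omega}+\beta(\varphi_\tau-d_\tau,\psi)_{I\times\Omega}+\sum_{m=2}^M([d_\tau]_{m-1},\lambda_{m-1}^+)+(d_{\tau,0}^+,\lambda_0^+)=(l,\psi)_{I\times\Omega}+\tfrac1\delta(\max(-\beta(d_\tau-\varphi_\tau)-r),\lambda)_{I\times\Omega}+(d_0,\lambda_0^+)$$ for all $(\psi,\lambda)\in V_\tau^0\times X_\tau^0$. It has a unique solution for $\tau$ sufficiently small. ''$\tau$ sufficiently small'' means: there is $\tau_0>0$ such that the assertion holds for all partitions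 with $\tau\le\tau_0$. $C$ is independent of the partition and of $l,d_0$. *)

(* Defs.v *)
From HB Require Import structures.
From mathcomp Require Import all_boot all_order all_algebra.
From mathcomp Require Import all_classical all_reals all_analysis.
From mathcomp Require Import measurable_realfun.

Set Implicit Arguments.
Unset Strict Implicit.
Unset Printing Implicit Defensive.

Import Order.TTheory GRing.Theory Num.Theory.
Import numFieldNormedType.Exports.

Local Open Scope classical_set_scope.
Local Open Scope ring_scope.

Definition measure_rV_display : measure_display -> measure_display.
Proof. exact. Qed.

Section measurable_rV.
Context {R : realType}.
Variable n : nat.

Let coord : 'I_n -> 'rV[R]_n -> R := fun i x => x 0 i.

Let rV_set0 : g_sigma_preimage coord set0.
Proof. exact: sigma_algebra0. Qed.

Let rV_setC A : g_sigma_preimage coord A -> g_sigma_preimage coord (~` A).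
Proof. exact: sigma_algebraC. Qed.

Let rV_bigcup (F : (set _)^nat) : (forall i, g_sigma_preimage coord (F i)) ->
  g_sigma_preimage coord (\bigcup_i (F i)).
Proof. exact: sigma_algebra_bigcup. Qed.

(* the sigma-algebra generated by the coordinates, i.e. the Borel sets *)
HB.instance Definition _ := @isMeasurable.Build
  (measure_rV_display default_measure_display)
  'rV[R]_n (g_sigma_preimage coord) rV_set0 rV_setC rV_bigcup.

End measurable_rV.

Section measurable_rV_lemmas.
Context {R : realType}.

Lemma measurable_coord n (i : 'I_n) :
  measurable_fun [set: 'rV[R]_n] (fun x : 'rV[R]_n => x 0 i).
Proof.
move=> _ Y mY; rewrite setTI; apply: sub_sigma_algebra => /=.
rewrite -bigcup_seq/=; exists i => /=; first by rewrite mem_index_enum.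
by exists Y => //; rewrite setTI.
Qed.

Lemma measurable_fun_coordP d (T : measurableType d) n (f : T -> 'rV[R]_n) :
  (forall i, measurable_fun [set: T] (fun t => f t 0 i)) ->
  measurable_fun [set: T] f.
Proof.
move=> mf _ A mA; rewrite setTI; move: A mA.
suff : @measurable _ 'rV[R]_n `<=` [set A | measurable (f @^-1` A)] by [].
apply: smallest_sub => /=.
  split => /=; first by rewrite preimage_set0.
  - by move=> A mA; rewrite setTD preimage_setC; exact: measurableC.
  - by move=> F mF; rewrite preimage_bigcup; exact: bigcup_measurable.
move=> A; rewrite -bigcup_seq => -[i _ /= [B mB <-]].
by rewrite setTI -comp_preimage -[X in measurable X]setTI; exact: mf.
Qed.

Definition consrV n (p : measurableTypeR R * 'rV[R]_n) : 'rV[R]_n.+1 := row_mx p.1%:M p.2.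

Lemma measurable_consrV n : measurable_fun [set: measurableTypeR R * 'rV[R]_n] (@consrV n).
Proof.
apply: measurable_fun_coordP => i.
have [j ->|j ->] := split_ordP (i : 'I_(1 + n)).
  rewrite [X in measurable_fun _ X](_ : _ = fst); first exact: measurable_fst.
  by apply/funext => p; rewrite [LHS]row_mxEl mxE (ord1 j) eqxx mulr1n.
rewrite [X in measurable_fun _ X](_ : _ = (fun x : 'rV[R]_n => x 0 j) \o snd).
  apply: measurableT_comp measurable_snd; exact: measurable_coord.
by apply/funext => p; rewrite [LHS]row_mxEr.
Qed.

Lemma measurable_tailrV n :
  measurable_fun [set: 'rV[R]_n.+1] (@rsubmx R 1 1 n).
Proof.
apply: measurable_fun_coordP => i.
rewrite [X in measurable_fun _ X](_ : _ = fun x : 'rV_n.+1 => x 0 (lift ord0 i)).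
  exact: measurable_coord.
by apply/funext => x; rewrite mxE; congr (x _ _); apply/val_inj.
Qed.

End measurable_rV_lemmas.

Section restriction_sigma_finite.
Context d (T : measurableType d) (R : realType).
Variables (mu : {sigma_finite_measure set T -> \bar R}) (D : set T).
Hypothesis mD : measurable D.

(* mrestr itself is only known to be sigma-finite when mu D is finite *)
Definition restr_measure : set T -> \bar R := mrestr mu mD.

HB.instance Definition _ := Measure.on restr_measure.

Let restr_sigma_finite : sigma_finite setT restr_measure.
Proof.
have [F TF Foo] := sigma_finiteT mu; exists F => // i.
have [mF Fi] := Foo i; split => //; apply: le_lt_trans Fi.
apply: le_measure; rewrite ?inE//; exact: measurableI.
Qed.

HB.instance Definition _ := Measure_isSigmaFinite.Build _ _ _ restr_measure
  restr_sigma_finite.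

End restriction_sigma_finite.

Section lebesgue_measure_rV_succ.
Context {R : realType} (n : nat).
Variable mu : {sigma_finite_measure set 'rV[R]_n -> \bar R}.

Definition cons_measure : set 'rV[R]_n.+1 -> \bar R :=
  pushforward (lebesgue_measure \x mu)%E (@consrV R n).

Let mcons A : measurable A -> measurable (@consrV R n @^-1` A).
Proof. by move=> mA; rewrite -[X in measurable X]setTI; exact: measurable_consrV. Qed.

Let cons_measure0 : cons_measure set0 = 0%E.
Proof. by rewrite /cons_measure /pushforward preimage_set0 measure0. Qed.

Let cons_measure_ge0 A : (0 <= cons_measure A)%E.
Proof. by rewrite /cons_measure /pushforward measure_ge0. Qed.

Let cons_measure_sigma_additive : semi_sigma_additive cons_measure.
Proof.
move=> F mF tF mUF; rewrite /cons_measure /pushforward preimage_bigcup.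
apply: measure_semi_sigma_additive.
- by move=> k; exact: mcons.
- apply/trivIsetP => /= i j _ _ ij; rewrite -preimage_setI.
  by move/trivIsetP : tF => /(_ _ _ _ _ ij) ->//; rewrite preimage_set0.
- by rewrite -preimage_bigcup; exact: mcons.
Qed.

HB.instance Definition _ := isMeasure.Build _ _ _ cons_measure
  cons_measure0 cons_measure_ge0 cons_measure_sigma_additive.

Let cons_measure_sigma_finite : sigma_finite setT cons_measure.
Proof.
have /sigma_finiteP[F [TF ndF Foo]] := sigma_finiteT (@lebesgue_measure R).
have /sigma_finiteP[G [TG ndG Goo]] := sigma_finiteT mu.
pose uncons (x : 'rV[R]_n.+1) : measurableTypeR R * 'rV[R]_n := (x 0 0, @rsubmx R 1 1 n x).
have consK : cancel (@consrV R n) uncons.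
  move=> [a v]; rewrite /uncons /consrV; congr pair; last exact: row_mxKr.
  rewrite (_ : 0 = @lshift 1 n 0 :> 'I_n.+1); last exact/val_inj.
  by rewrite [LHS]row_mxEl mxE eqxx mulr1n.
have munc : measurable_fun setT uncons.
  by apply: measurable_fun_pair; [exact: measurable_coord|exact: measurable_tailrV].
exists (fun k => uncons @^-1` (F k `*` G k)).
  rewrite -preimage_bigcup; apply/esym; rewrite -subTset => x _ /=.
  have [i _ Fi] : (\bigcup_i F i) (x 0 0) by rewrite -TF.
  have [j _ Gj] : (\bigcup_j G j) (@rsubmx R 1 1 n x) by rewrite -TG.
  exists (maxn i j) => //; split => /=.
  - by move: Fi; exact/subsetPset/ndF/leq_maxl.
  - by move: Gj; exact/subsetPset/ndG/leq_maxr.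
move=> k; have [mF Fk] := Foo k; have [mG Gk] := Goo k; split.
  by rewrite -[X in measurable X]setTI; apply: munc => //; exact: measurableX.
rewrite /cons_measure /pushforward -comp_preimage.
rewrite (_ : uncons \o _ = id); last exact/funext.
by rewrite preimage_id product_measure1E// lte_mul_pinfty// ge0_fin_numE.
Qed.

HB.instance Definition _ := Measure_isSigmaFinite.Build _ _ _ cons_measure
  cons_measure_sigma_finite.

End lebesgue_measure_rV_succ.

Fixpoint lebesgue_rV (R : realType) n :
    {sigma_finite_measure set 'rV[R]_n -> \bar R} :=
  match n with
  | 0 => (\d_ (0 : 'rV[R]_0) : {sigma_finite_measure set _ -> \bar R})
  | n.+1 => cons_measure (lebesgue_rV R n)
  end.

Definition is_convex_polyhedral (R : realType) N (Omega : set 'rV[R]_N) :=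
  [/\ Omega !=set0, bounded_set Omega &
    exists (k : nat) (a : 'I_k -> 'rV[R]_N) (b : 'I_k -> R),
      Omega = [set x | forall i, \sum_j a i 0 j * x 0 j < b i]].

Lemma measurable_convex_polyhedral (R : realType) N (Omega : set 'rV[R]_N) :
  is_convex_polyhedral Omega -> measurable Omega.
Proof.
move=> [_ _ [k [a [b ->]]]].
rewrite (_ : [set _ | _] =
  \bigcap_(i in [set: 'I_k]) [set x | \sum_j a i 0 j * x 0 j < b i]).
  apply: fin_bigcap_measurable => [|i _]; first exact: finite_finset.
  rewrite [X in measurable X](_ : _ =
    (fun x : 'rV[R]_N => \sum_j a i 0 j * x 0 j) @^-1` `]-oo, b i[).
    rewrite -[X in measurable X]setTI; apply: measurable_sum => //= j.
    by apply: measurable_funM => //; exact: measurable_coord.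
  by apply/seteqP; split => x /=; rewrite in_itv.
by apply/seteqP; split => [x /= H i _|x /= H i]; [exact: H|exact: (H i)].
Qed.

Record polyhedral_domain (R : realType) (N : nat) := PolyhedralDomain {
  domain_set :> set 'rV[R]_N ;
  domain_polyhedral : is_convex_polyhedral domain_set }.

Lemma measurable_domain (R : realType) N (Omega : polyhedral_domain R N) :
  measurable (Omega : set 'rV[R]_N).
Proof. by apply: measurable_convex_polyhedral; exact: domain_polyhedral. Qed.

(* An element of an L^2 space is given by one of its (Borel measurable)
   representatives, defined on the whole of R^N, resp. R x R^N: the measures
   below are Lebesgue measure restricted to Omega, resp. to (0,T) x Omega, so
   that the values outside of these sets are irrelevant. Elements of
   L^2(0,T;L^2(Omega)) are identified with elements of
   L^2((0,T) x Omega), and those of L^2(0,T;H^1_0(Omega)) with the v in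
   L^2((0,T) x Omega) such that v(t) is in H^1_0(Omega) for a.e. t and the
   spatial gradient is in L^2((0,T) x Omega)^N.
   Weak derivatives are unique up to null sets; they are handled through the
   relations "v has weak gradient g", "v has weak time derivative v'". *)

Section L2.
Context d (T : measurableType d) (R : realType).
Variable mu : {measure set T -> \bar R}.

Definition ip (f g : T -> R) : R := \int[mu]_x (f x * g x).

Definition L2norm (f : T -> R) : R := fine ('N[mu]_2%:E[EFin \o f])%E.

End L2.

Section spaces.
Context {R : realType} {N : nat}.
Variable Omega : polyhedral_domain R N.
Implicit Types (v w : 'rV[R]_N -> R) (g : 'I_N -> 'rV[R]_N -> R).

Definition muO : {sigma_finite_measure set 'rV[R]_N -> \bar R} :=
  restr_measure (lebesgue_rV R N) (measurable_domain Omega).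

Definition partial (i : 'I_N) w : 'rV[R]_N -> R := 'D_(delta_mx 0 i) w.

Fixpoint Ck (k : nat) w : Prop :=
  continuous w /\
  if k is k'.+1 then
    forall i, (forall x, derivable w x (delta_mx 0 i)) /\ Ck k' (partial i w)
  else True.

Definition Cc_infty w :=
  (forall k, Ck k w) /\
  let supp := closure [set x | w x != 0] in compact supp /\ supp `<=` Omega.

(* g is the weak gradient of v in L^2(Omega), i.e. v is in H^1(Omega) *)
Definition has_weak_grad v g :=
  [/\ v \in Lfun muO 2%:E, forall i, g i \in Lfun muO 2%:E &
    forall w, Cc_infty w -> forall i, ip muO v (partial i w) = - ip muO (g i) w].

(* v is in H^1_0(Omega), the closure of C_c^oo(Omega) in H^1(Omega), and
   grad v = g *)
Definition H10_grad v g :=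
  has_weak_grad v g /\
  exists w : nat -> 'rV[R]_N -> R,
    [/\ forall k, Cc_infty (w k),
        L2norm muO (w k \- v) @[k --> \oo] --> 0 &
        forall i, L2norm muO (partial i (w k) \- g i) @[k --> \oo] --> 0].

Definition H10 v := exists g, H10_grad v g.

End spaces.

Section bochner_spaces.
Context {R : realType} {N : nat}.
Variables (Omega : polyhedral_domain R N) (T : R).

Local Notation TX := (measurableTypeR R * 'rV[R]_N)%type.
Local Notation muO := (muO Omega).
Local Notation "f '=ae' g" := (f = g %[ae muO]) (at level 70).

Definition muI : {sigma_finite_measure set (measurableTypeR R) -> \bar R} :=
  restr_measure (@lebesgue_measure R) (measurable_itv `]0, T[).
Definition muQ : {measure set TX -> \bar R} := (muI \x muO)%E.

Implicit Types (u v d l psi lam : TX -> R) (G : 'I_N -> TX -> R).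

Definition at_time v (t : R) : 'rV[R]_N -> R := fun x => v (t, x).

(* v is in V = L^2(0,T;H^1_0(Omega)) and grad v = G *)
Definition V_grad v G :=
  [/\ v \in Lfun muQ 2%:E, forall i, G i \in Lfun muQ 2%:E &
    {ae muI, forall t, H10_grad Omega (at_time v t) (fun i => at_time (G i) t)}].

Definition Cc_infty_time (eta : R -> R) :=
  (forall n t, derivable (derive1n n eta) t 1) /\
  let supp := closure [set t | eta t != 0] in compact supp /\ supp `<=` `]0, T[.

(* v is in H^1(0,T;L^2(Omega)) and its weak time derivative is v': the
   identity int_I v eta' dt = - int_I v' eta dt between (Bochner) integrals
   holds in L^2(Omega) for every eta in C_c^oo(0,T) *)
Definition is_dt v v' :=
  [/\ v \in Lfun muQ 2%:E, v' \in Lfun muQ 2%:E &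
    forall eta, Cc_infty_time eta ->
      (fun x => \int[muI]_t (v (t, x) * derive1 eta t)) =ae
      (fun x => - \int[muI]_t (v' (t, x) * eta t))].

Definition in_X v := exists v', is_dt v v'.

(* d(0) = d0, where d(0) is the value at 0 of the representative of d in
   C([0,T];L^2(Omega)) *)
Definition initial_value d (d0 : 'rV[R]_N -> R) :=
  exists D : R -> 'rV[R]_N -> R,
    [/\ forall t, 0 <= t <= T -> D t \in Lfun muO 2%:E,
        forall t, 0 <= t <= T ->
          L2norm muO (D s \- D t) @[s --> within `[0, T] (nbhs t)] --> 0,
        {ae muI, forall t, D t =ae at_time d t} &
        D 0 =ae d0].

Section state_equations.
Variables (alpha beta delta r : R).
Variables (l : TX -> R) (d0 : 'rV[R]_N -> R).

Definition ip_grad (G G' : 'I_N -> TX -> R) : R := \sum_i ip muQ (G i) (G' i).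

Definition driving_force (phi d : TX -> R) : TX -> R :=
  fun z => Num.max (- beta * (d z - phi z) - r) 0.

Definition state_solution (phi d : TX -> R) :=
  exists Gphi dt_d,
    [/\ V_grad phi Gphi, is_dt d dt_d, initial_value d d0 &
      forall psi Gpsi lam, V_grad psi Gpsi -> in_X lam ->
        alpha * ip_grad Gphi Gpsi + beta * ip muQ (phi \- d) psi
          + ip muQ dt_d lam
        = ip muQ l psi + delta^-1 * ip muQ (driving_force phi d) lam].

Definition is_partition (M : nat) (t : nat -> R) :=
  [/\ t 0%N = 0, t M = T & forall m, (m < M)%N -> t m < t m.+1].

Definition mesh (M : nat) (t : nat -> R) : R :=
  \big[Num.max/0]_(m < M) (t m.+1 - t m).

Variables (M : nat) (t : nat -> R).

(* The value v_m on I_m = (t_{m-1}, t_m] of a piecewise constant v. *)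
Definition value v (m : nat) : 'rV[R]_N -> R := at_time v (t m).

(* v is constant, with values in Y, on each I_m; equality is that of
   L^2(Omega) *)
Definition piecewise_P0 (Y : set ('rV[R]_N -> R)) v :=
  forall m, (1 <= m <= M)%N ->
    Y (value v m) /\ forall s, t m.-1 < s <= t m -> at_time v s =ae value v m.

(* v is in V_tau^0 and grad v = G *)
Definition Vtau_grad v G :=
  V_grad v G /\ piecewise_P0 (H10 Omega) v.

Definition in_Xtau v :=
  v \in Lfun muQ 2%:E /\ piecewise_P0 [set` Lfun muO 2%:E] v.

Definition jump v (m : nat) : 'rV[R]_N -> R := value v m.+1 \- value v m.

(* Recall that v_{m-1}^+ = v_m. *)
Definition semidiscrete_solution (phi d : TX -> R) :=
  exists Gphi,
    [/\ Vtau_grad phi Gphi, in_Xtau d &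
      forall psi Gpsi lam, Vtau_grad psi Gpsi -> in_Xtau lam ->
        alpha * ip_grad Gphi Gpsi + beta * ip muQ (phi \- d) psi
          + \sum_(2 <= m < M.+1) ip muO (jump d m.-1) (value lam m)
          + ip muO (value d 1) (value lam 1)
        = ip muQ l psi + delta^-1 * ip muQ (driving_force phi d) lam
          + ip muO d0 (value lam 1)].

End state_equations.

End bochner_spaces.

(* Main.v *)
(* Elliptic regularity is avoided: the elliptic equation is inverted only
   approximately, by almost minimisers of its energy in H^1_0, which is enough
   for duality arguments and does not need completeness of H^1_0.

   Regularity of phi. With g = l + beta d in H^1(0,T;L^2), testing with eta' p,
   where p almost solves the stationary problem with right-hand side chi, gives
   (phi, eta' chi) ~ (g, eta' p) = -(g', eta p), which is bounded by the norm of
   eta chi; the Riesz representation of this functional is dt_phi.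

   Error estimate. On I_m let A, B, x, y be the L^2(I_m x Omega) norms of dt_d,
   dt_phi, d - d_tau, phi - phi_tau, and let e_m = |d(t_m) - d_tau,m|. Since d
   and phi are absolutely continuous in time at a.e. point of Omega,
     x <= tau_m A + sqrt(tau_m) e_m;
   integrating the evolution equation over I_m, with the Lipschitz driving force,
     e_m <= e_{m-1} + (beta / delta) sqrt(tau_m) (x + y);
   and since the mean of phi - phi_tau over I_m is controlled by duality,
     y <= tau_m B + x.
   A discrete Gronwall argument concludes, with tau_0 = delta / (4 beta). *)
Require Import Defs.
From HB Require Import structures.
From mathcomp Require Import all_boot all_order all_algebra.
From mathcomp Require Import all_classical all_reals all_analysis.
From mathcomp Require Import measurable_realfun ring lra.

Set Implicit Arguments.
Unset Strict Implicit.
Unset Printing Implicit Defensive.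

Import Order.TTheory GRing.Theory Num.Theory.
Import numFieldNormedType.Exports.

Local Open Scope classical_set_scope.
Local Open Scope ring_scope.

(** * The inner product of L^2 *)

Section L2_theory.
Context d (T : measurableType d) (R : realType).
Variable mu : {measure set T -> \bar R}.
Implicit Types f g h : T -> R.

Local Notation L2 := (Lfun mu 2%:E).
Local Notation ip := (ip mu).

(** Weak time derivatives are tested by one eta at a time, each with its own null set in Omega.
    Working pointwise in x needs one null set for all tests, hence a countable family of explicit
    bumps from which a scalar function of time is recovered as a constant plus a primitive. The node
    value d(t_m) is then the concrete function d0 + int_0^t_m dt_d, where d0 is identified through
    averages of d near t = 0. In the elliptic estimate the factor beta of the coupling term cancels
    the 1/beta in the bound |p| <= |chi| / beta, up to the tolerance, so x enters the bound of y
    with constant one. The threshold on tau comes from inserting the bounds of x and y in that of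
    e_m: e_m reappears with the factor 2 kappa tau_m, kappa = beta / delta, and is absorbed by 1 <=
    (1 - 2u) exp(4u), valid for 0 <= u <= 1/4, at u = kappa tau_m. The data then enter as
    sqrt(tau_j) (2 A_j + B_j), and Cauchy-Schwarz with sum tau_j <= T keeps the result of order tau
    for every such partition. *)

Lemma Lfun2P f : f \in L2 <->
  measurable_fun [set: T] f /\
  mu.-integrable [set: T] (EFin \o (fun x => f x ^+ 2)).
Proof.
split=> [fL|[mf /integrableP[_ fi]]].
  split; last exact: Lfun2_integrable_sqr.
  by move: fL; rewrite inE => /andP[]; rewrite inE.
rewrite inE; apply/andP; split; rewrite inE//= /finite_norm unlock.
apply: poweR_lty; apply: le_lt_trans fi; rewrite le_eqVlt; apply/orP; left.
apply/eqP/eq_integral => x _; rewrite !abse_EFin poweR_EFin.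
by rewrite powR_mulrn// normrX.
Qed.

Lemma Lfun2_measurable f : f \in L2 -> measurable_fun [set: T] f.
Proof. by move/Lfun2P => []. Qed.

Lemma Lfun2D f g : f \in L2 -> g \in L2 -> f \+ g \in L2.
Proof. exact: (Lfun_addr_closed mu (lee1n 2)).2. Qed.

Lemma Lfun2_dom f g : measurable_fun [set: T] f -> g \in L2 ->
  (forall x, `|f x| <= `|g x|) -> f \in L2.
Proof.
move=> mf /Lfun2P[mg ig] fg; apply/Lfun2P; split => //.
apply: le_integrable ig => //.
  by apply/measurable_EFinP; exact: measurable_funX.
by move=> x _; rewrite /= lee_fin !normrX lerXn2r ?nnegrE.
Qed.

Lemma Lfun2_mulbounded (M : R) f g : measurable_fun [set: T] f ->
  (forall x, `|f x| <= M) -> g \in L2 -> f \* g \in L2.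
Proof.
move=> mf fM gL.
have M0 : 0 <= M by apply: le_trans (fM point).
have : M \o* g \in L2 by apply: Lfun_scale => //; rewrite ler1n.
move=> /Lfun2_dom; apply.
  by apply: measurable_funM => //; exact: Lfun2_measurable gL.
by move=> x /=; rewrite !normrM (ger0_norm M0) mulrC ler_wpM2l.
Qed.

Lemma Lfun2Z a f : f \in L2 -> (fun x => a * f x) \in L2.
Proof.
by move=> fL; apply: (@Lfun2_mulbounded `|a| (cst a)) fL => // x; exact: lexx.
Qed.

Lemma Lfun2B f g : f \in L2 -> g \in L2 -> f \- g \in L2.
Proof.
move=> fL gL.
rewrite (_ : _ \- _ = f \+ (fun x => -1 * g x)); last first.
  by apply/funext => x /=; rewrite mulN1r.
by apply: Lfun2D => //; exact: Lfun2Z.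
Qed.

Lemma Lfun2_cst0 : cst 0 \in L2.
Proof. exact: (Lfun_addr_closed mu (lee1n 2)).1. Qed.

Lemma integrable_ip f g : f \in L2 -> g \in L2 ->
  mu.-integrable [set: T] (EFin \o (fun x => f x * g x)).
Proof. by move=> fL gL; apply/Lfun1_integrable; exact: Lfun2_mul_Lfun1. Qed.

Lemma ipC f g : ip f g = ip g f.
Proof. by apply: eq_Rintegral => x _; rewrite mulrC. Qed.

Lemma ipDl f g h : f \in L2 -> g \in L2 -> h \in L2 ->
  ip (f \+ g) h = ip f h + ip g h.
Proof.
move=> fL gL hL; rewrite /Defs.ip -RintegralD//; try exact: integrable_ip.
by apply: eq_Rintegral => x _ /=; rewrite mulrDl.
Qed.

Lemma ipZl a f g : f \in L2 -> g \in L2 ->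
  ip (fun x => a * f x) g = a * ip f g.
Proof.
move=> fL gL; rewrite /Defs.ip -RintegralZl//; last exact: integrable_ip.
by apply: eq_Rintegral => x _ /=; rewrite mulrA.
Qed.

Lemma ipBl f g h : f \in L2 -> g \in L2 -> h \in L2 ->
  ip (f \- g) h = ip f h - ip g h.
Proof.
move=> fL gL hL; rewrite /Defs.ip -RintegralB//; try exact: integrable_ip.
by apply: eq_Rintegral => x _ /=; rewrite mulrBl.
Qed.

Lemma ipDr f g h : f \in L2 -> g \in L2 -> h \in L2 ->
  ip h (f \+ g) = ip h f + ip h g.
Proof. by move=> *; rewrite ipC ipDl// ![ip h _]ipC. Qed.

Lemma ipZr a f g : f \in L2 -> g \in L2 ->
  ip g (fun x => a * f x) = a * ip g f.
Proof. by move=> *; rewrite ipC ipZl// ![ip g _]ipC. Qed.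

Lemma ip0l f : ip (cst 0) f = 0.
Proof.
rewrite /Defs.ip (_ : (fun x => _) = cst 0).
  by rewrite Rintegral_cst// mul0r.
by apply/funext => x; rewrite mul0r.
Qed.

Lemma ip0r f : ip f (cst 0) = 0.
Proof. by rewrite ipC ip0l. Qed.

Lemma ip_ge0 f : 0 <= ip f f.
Proof. by apply: Rintegral_ge0 => x _; rewrite -expr2 sqr_ge0. Qed.

Lemma L2normE f : f \in L2 -> L2norm mu f = Num.sqrt (ip f f).
Proof.
move=> fL; have /Lfun2P[mf fi] := fL.
rewrite /L2norm unlock (_ : (\int[mu]_x _)%E = (ip f f)%:E).
  by rewrite poweR_EFin powR12_sqrt// ip_ge0.
rewrite /Defs.ip /Rintegral fineK.
  apply: eq_integral => x _; rewrite abse_EFin poweR_EFin powR_mulrn//.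
  by rewrite -expr2 real_normK// num_real.
by apply: integrable_fin_num => //; exact: integrable_ip.
Qed.

Lemma ip_sqDl f g : f \in L2 -> g \in L2 ->
  ip (f \+ g) (f \+ g) = ip f f + 2 * ip f g + ip g g.
Proof.
move=> fL gL; have fgL := Lfun2D fL gL.
rewrite ipDl// !ipDr// (ipC g f); lra.
Qed.

End L2_theory.

(** Nonpositive discriminant. It yields both Cauchy-Schwarz and, in [approximate_riesz], the bound
    on the residual of an almost minimiser. *)
Lemma quadratic_ge0_CS (R : realType) (a b c : R) : 0 <= a -> 0 <= c ->
  (forall s, 0 <= a + 2 * s * b + s ^+ 2 * c) -> `|b| <= Num.sqrt a * Num.sqrt c.
Proof.
move=> a0 c0 H; rewrite -sqrtrM// -sqrtr_sqr ler_wsqrtr//.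
have [c0'|cp] := eqVneq c 0.
  have [->|b0] := eqVneq b 0; first by rewrite expr0n/= mulr_ge0.
  (* With c = 0 the polynomial is affine in s; this s gives it the value -1. *)
  have := H (- (a + 1) / (2 * b)).
  rewrite (_ : _ + _ = -1); last by rewrite c0'; field.
  by move=> h; have := ltr01 (R := R); lra.
have {cp} cp : 0 < c by rewrite lt_neqAle eq_sym cp.
have := H (- b / c).
rewrite (_ : _ + _ = a - b ^+ 2 / c); last by field; rewrite gt_eqF.
by rewrite subr_ge0 ler_pdivrMr.
Qed.

Section L2_CS.
Context d (T : measurableType d) (R : realType).
Variable mu : {measure set T -> \bar R}.
Implicit Types f g h : T -> R.

Local Notation L2 := (Lfun mu 2%:E).
Local Notation ip := (ip mu).

Lemma ip_CS f g : f \in L2 -> g \in L2 ->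
  `|ip f g| <= Num.sqrt (ip f f) * Num.sqrt (ip g g).
Proof.
move=> fL gL; apply: quadratic_ge0_CS; rewrite ?ip_ge0// => s.
have sgL := Lfun2Z s gL.
have := ip_ge0 mu (f \+ (fun x => s * g x)).
by rewrite ip_sqDl// ipZr// ipZl// ipZr//; lra.
Qed.

Lemma ip_triangle f g : f \in L2 -> g \in L2 ->
  Num.sqrt (ip (f \+ g) (f \+ g)) <= Num.sqrt (ip f f) + Num.sqrt (ip g g).
Proof.
move=> fL gL; rewrite -[leRHS]ger0_norm ?addr_ge0 ?sqrtr_ge0//.
rewrite -sqrtr_sqr ler_wsqrtr// ip_sqDl// sqrrD !sqr_sqrtr ?ip_ge0//.
rewrite lerD2r lerD2l mulr2n.
by have := le_trans (ler_norm _) (ip_CS fL gL); lra.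
Qed.

Lemma ip_eq0_ae f : f \in L2 -> ip f f = 0 -> {ae mu, forall x, f x = 0}.
Proof.
move=> fL f0; have fi := integrable_ip fL fL.
have mf : measurable_fun [set: T] (EFin \o (fun x => f x * f x)).
  exact: measurable_int fi.
have : (\int[mu]_x `|(f x * f x)%:E| = 0)%E.
  under eq_integral do rewrite abse_EFin ger0_norm -?expr2 ?sqr_ge0// expr2.
  rewrite -[LHS]fineK ?[fine _]f0//.
  by apply: integrable_fin_num.
move=> /(ae_eq_integral_abs _ measurableT mf).1.
apply: filterS => x /(_ I)/= [] /eqP; rewrite mulf_eq0 orbb => /eqP.
exact.
Qed.

Lemma ae_eq_ip f g : f \in L2 -> g \in L2 -> {ae mu, forall x, f x = g x} ->
  forall h, h \in L2 -> ip f h = ip g h.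
Proof.
move=> fL gL fg h hL; congr fine; apply: ae_eq_integral => //.
- exact: measurable_int (integrable_ip fL hL).
- exact: measurable_int (integrable_ip gL hL).
- by apply: filterS fg => x -> _.
Qed.

End L2_CS.

(** * Completeness of L^2 *)

Section L2_complete.
Context d (T : measurableType d) (R : realType).
Variable mu : {measure set T -> \bar R}.

Local Notation L2 := (Lfun mu 2%:E).
Local Notation ip := (ip mu).

Lemma limn_einf_le (u : (\bar R)^nat) (c : \bar R) (n0 : nat) :
  (forall m, (n0 <= m)%N -> (u m <= c)%E) -> (limn_einf u <= c)%E.
Proof.
move=> uc; rewrite limn_einf_lim; apply: lime_le; first exact: is_cvg_einfs.
apply: nearW => n; apply: (@le_trans _ _ (u (maxn n n0))).
  by apply: ereal_inf_lbound; exists (maxn n n0) => //=; rewrite leq_maxl.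
by apply: uc; rewrite leq_maxr.
Qed.

Lemma EFin_ip (f g : T -> R) : f \in L2 -> g \in L2 ->
  (\int[mu]_x (f x * g x)%:E)%E = (ip f g)%:E.
Proof.
move=> fL gL; rewrite /Defs.ip /Rintegral fineK//.
by apply: integrable_fin_num => //; exact: integrable_ip.
Qed.

(* The weights [4 ^ n] turn the summability of [4 ^ n * |g (n+1) - g n|^2]
   into geometric decay of the increments at almost every point. *)
Lemma L2_fast_cauchy_cvg (g : (T -> R)^nat) : (forall n, g n \in L2) ->
  (forall n, ip (g n.+1 \- g n) (g n.+1 \- g n) <= 8^-1 ^+ n) ->
  {ae mu, forall x, cvgn (g ^~ x)}.
Proof.
move=> gL gfast.
have dL n : g n.+1 \- g n \in L2 by exact: Lfun2B.
pose h n x := (4 ^+ n * ((g n.+1 x - g n x) * (g n.+1 x - g n x)))%:E.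
have mh n : measurable_fun [set: T] (h n).
  apply/measurable_EFinP; apply: measurable_funM => //.
  by apply: measurable_funM; exact: Lfun2_measurable (dL n).
have h0 n x : (0 <= h n x)%E by rewrite lee_fin mulr_ge0// -expr2 sqr_ge0.
have int_h n : (\int[mu]_x h n x <= (2^-1 ^+ n)%:E)%E.
  rewrite /h; under eq_integral do rewrite EFinM.
  rewrite ge0_integralZl//; last 2 first.
    - by apply/measurable_EFinP; apply: measurable_funM;
        exact: Lfun2_measurable (dL n).
    - by move=> x _; rewrite lee_fin -expr2 sqr_ge0.
  rewrite (EFin_ip (dL n) (dL n)) -EFinM lee_fin.
  apply: le_trans (ler_wpM2l _ (gfast n)) _ => //.
  by rewrite -exprMn lerXn2r// ?nnegrE; lra.
have : (\int[mu]_x (\sum_(n <oo) h n x) < +oo)%E.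
  rewrite integral_nneseries//.
  apply: le_lt_trans (lee_nneseries _ (fun n _ => int_h n)) _ => //.
    by move=> n _ _; exact: integral_ge0.
  apply: (@le_lt_trans _ _ 2%:E); last exact: ltry.
  apply: lime_le; first by apply: is_cvg_nneseries => n _ _; rewrite lee_fin.
  apply: nearW => n; rewrite sumEFin lee_fin.
  suff -> : \sum_(0 <= i < n) 2^-1 ^+ i = 2 - 2 * 2^-1 ^+ n :> R.
    by rewrite gerBl mulr_ge0.
  elim: n => [|n IH]; first by rewrite big_nil expr0; lra.
  by rewrite big_nat_recr//= IH exprS; lra.
move=> intoo.
have sum_int : mu.-integrable setT (fun x => \sum_(n <oo) h n x)%E.
  apply/integrableP; split; first exact: ge0_emeasurable_sum.
  by under eq_integral do rewrite gee0_abs ?nneseries_ge0//.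
have := integrable_ae measurableT sum_int.
apply: filterS => x /(_ I) xfin.
set C := fine (\sum_(n <oo) h n x)%E.
have C0 : 0 <= C by rewrite fine_ge0// nneseries_ge0.
have hC n : 4 ^+ n * (g n.+1 x - g n x) ^+ 2 <= C.
  rewrite expr2 -lee_fin /C fineK//.
  apply: (@le_trans _ _ (\sum_(0 <= i < n.+1) h i x)%E).
    by rewrite big_nat_recr//= leeDr// sume_ge0.
  by apply: nneseries_lim_ge => k _ _; exact: h0.
have incr n : `|g n.+1 x - g n x| <= geometric (Num.sqrt C) 2^-1 n.
  rewrite /geometric/= -[leRHS]ger0_norm ?mulr_ge0 ?sqrtr_ge0 ?exprn_ge0//.
  rewrite -ler_sqr ?nnegrE// !real_normK ?num_real// exprMn sqr_sqrtr//.
  rewrite -exprM mulnC exprM (_ : 2^-1 ^+ 2 = 4^-1); last by field.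
  by rewrite exprVn ler_pdivlMr ?exprn_gt0// mulrC.
have : cvgn (series (telescope (g ^~ x))).
  apply: normed_cvg; apply: (@series_le_cvg _ _ (geometric (Num.sqrt C) 2^-1)).
  - by move=> n /=.
  - by move=> n; rewrite /geometric/= mulr_ge0 ?sqrtr_ge0 ?exprn_ge0.
  - by move=> n; exact: incr.
  - apply: is_cvg_geometric_series.
    by rewrite ger0_norm ?invr_ge0// invf_lt1// ltr1n.
rewrite telescopeK => cv.
have -> : g ^~ x = (fun n => (g n x - g 0%N x) + g 0%N x).
  by apply/funext => n; rewrite subrK.
by apply: is_cvgD => //; exact: is_cvg_cst.
Qed.

(** Riesz-Fischer: a fast subsequence converges almost everywhere, and Fatou's lemma turns this into
    L^2 convergence of the whole sequence. *)
Lemma L2_complete (f : (T -> R)^nat) : (forall n, f n \in L2) ->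
  (forall e, 0 < e -> exists n0, forall i j, (n0 <= i)%N -> (n0 <= j)%N ->
     ip (f i \- f j) (f i \- f j) <= e) ->
  exists2 g, g \in L2 & forall e, 0 < e -> exists n0, forall i, (n0 <= i)%N ->
     ip (f i \- g) (f i \- g) <= e.
Proof.
move=> fL fC.
have e8 n : 0 < 8^-1 ^+ n :> R by rewrite exprn_gt0.
pose k0 n := projT1 (cid (fC _ (e8 n))).
have k0P n i j : (k0 n <= i)%N -> (k0 n <= j)%N ->
    ip (f i \- f j) (f i \- f j) <= 8^-1 ^+ n.
  by rewrite /k0; case: cid => /= m; exact.
(* The running maximum makes the subsequence of indices monotone. *)
pose k n := (\max_(i < n.+1) k0 i)%N.
have k0k n : (k0 n <= k n)%N by rewrite /k (leq_bigmax (@ord_max n)).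
have kS n : (k n <= k n.+1)%N by rewrite /k [leqRHS]big_ord_recr/= leq_maxl.
have kmono n m : (n <= m)%N -> (k n <= k m)%N.
  by move=> /subnK <-; elim: (m - n)%N => // i IH; apply: leq_trans IH (kS _).
pose g n := f (k n).
have gcvg : {ae mu, forall x, cvgn (g ^~ x)}.
  apply: L2_fast_cauchy_cvg => [n|n]; first exact: fL.
  by apply: k0P => //; apply: leq_trans (k0k n) (kS n).
(* A limsup is measurable without reference to the set where the sequence converges; [fine] gives
   the value 0 where it is infinite. *)
pose G x := fine (limn_esup (fun n => (g n x)%:E)).
have mG : measurable_fun [set: T] G.
  apply: measurableT_comp => //; apply: measurable_fun_limn_esup => n.
  by apply/measurable_EFinP; exact: Lfun2_measurable (fL _).
have gG : {ae mu, forall x, (g n x) @[n --> \oo] --> G x}.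
  apply: filterS gcvg => x cx; rewrite /G.
  have /(@EFin_lim _ _)/esym := cx.
  have cE : (g n x)%:E @[n --> \oo] --> (limn (g ^~ x))%:E.
    by apply: cvg_EFin; [exact: nearW|].
  by rewrite (cvg_limn_einf_sup cE).2/=.
(* Fatou in m for fixed i: f_i - g_m tends to f_i - G, and its square integral is at most 8^-n for m
   >= n. *)
have bnd n i : (k n <= i)%N ->
    (\int[mu]_x ((f i x - G x) ^+ 2)%:E <= (8^-1 ^+ n)%:E)%E.
  move=> kni.
  have mF m : measurable_fun setT (fun x => ((f i x - g m x) ^+ 2)%:E).
    apply/measurable_EFinP; apply: measurable_funX.
    by apply: measurable_funB; exact: Lfun2_measurable (fL _).
  apply: (@le_trans _ _ (\int[mu]_x limn_einf
      (fun m => ((f i x - g m x) ^+ 2)%:E))%E); last first.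
    apply: le_trans (fatou mu measurableT mF _) _.
      by move=> m x _; rewrite lee_fin sqr_ge0.
    apply: (@limn_einf_le _ _ n) => m nm.
    rewrite (eq_integral (fun x => ((f i \- g m) x * (f i \- g m) x)%:E)).
      rewrite EFin_ip ?lee_fin; try by apply: Lfun2B; exact: fL.
      by apply: k0P; apply: leq_trans (k0k n) _ => //; exact: kmono.
    by move=> x _; rewrite expr2.
  apply: ae_ge0_le_integral => //.
  - by move=> x _; rewrite lee_fin sqr_ge0.
  - apply/measurable_EFinP; apply: measurable_funX; apply: measurable_funB => //.
    exact: Lfun2_measurable (fL _).
  - move=> x _; rewrite limn_einf_lim; apply: lime_ge; first exact: is_cvg_einfs.
    apply: nearW => m; apply: le_ereal_inf_tmp => _ [j _ <-].
    by rewrite lee_fin sqr_ge0.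
  - under eq_fun do rewrite -[limn_einf _]oppeK -limn_esupN.
    apply: measurableT_comp => //; apply: measurable_fun_limn_esup => m.
    by apply: measurableT_comp.
  - apply: filterS gG => x gGx _.
    suff /cvg_limn_einf_sup[-> _] :
      ((f i x - g m x) ^+ 2)%:E @[m --> \oo] --> ((f i x - G x) ^+ 2)%:E by [].
    apply: cvg_EFin; first exact: nearW.
    under eq_fun do rewrite /= expr2; rewrite expr2.
    by apply: cvgM; apply: cvgB => //; exact: cvg_cst.
have dL n i : (k n <= i)%N -> f i \- G \in L2.
  move=> kni; apply/Lfun2P; split.
    by apply: measurable_funB => //; exact: Lfun2_measurable (fL _).
  apply/integrableP; split.
    apply/measurable_EFinP; apply: measurable_funX; apply: measurable_funB => //.
    exact: Lfun2_measurable (fL _).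
  under eq_integral do rewrite /= ger0_norm ?sqr_ge0//.
  by apply: le_lt_trans (bnd _ _ kni) _; rewrite ltry.
have GL : G \in L2.
  rewrite (_ : G = f (k 0%N) \- (f (k 0%N) \- G)).
    by apply: Lfun2B (fL _) (dL _ _ (leqnn _)).
  by apply/funext => x /=; rewrite subKr.
exists G => // e e0.
have [n ne] : exists n, 8^-1 ^+ n <= e.
  have := @cvg_geometric R 1 8^-1.
  rewrite ger0_norm ?invr_ge0// invf_lt1// ltr1n => /(_ erefl).
  move=> /cvgr0_norm_le/(_ _ e0)[n _ /(_ n (leqnn _)) b]; exists n.
  apply: le_trans b; rewrite /geometric/= mul1r; exact: ler_norm.
exists (k n) => i kni; apply: le_trans ne.
rewrite -lee_fin -EFin_ip//; try exact: dL kni.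
by apply: le_trans (bnd _ _ kni); under eq_integral do rewrite -expr2.
Qed.

End L2_complete.

(** * Approximate Riesz representation *)

Lemma sqrtr_le (R : rcfType) (a b : R) : 0 <= b -> a <= b ^+ 2 -> Num.sqrt a <= b.
Proof. by move=> b0 ab; rewrite -(ger0_norm b0) -sqrtr_sqr ler_wsqrtr. Qed.

Lemma sqr_le_mul (R : realFieldType) (x c : R) : 0 <= x -> 0 <= c ->
  x ^+ 2 <= c * x -> x <= c.
Proof.
move=> x0 c0 h; have [->//|xn0] := eqVneq x 0.
have xp : 0 < x by rewrite lt_neqAle eq_sym xn0.
by rewrite -(ler_pM2r xp) -expr2.
Qed.

Section approximate_riesz.
Context (R : realType) (E : Type) (lin : R -> E -> E -> E).
Variables (S : set E) (B : E -> E -> R) (F : E -> R) (C : R) (x0 : E).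
(* [lin a x y] stands for [x + a y] *)
Hypothesis S0 : S x0.
Hypothesis Slin : forall a x y, S x -> S y -> S (lin a x y).
Hypothesis BC : forall x y, S x -> S y -> B x y = B y x.
Hypothesis Blin : forall a x y z, S x -> S y -> S z ->
  B (lin a x y) z = B x z + a * B y z.
Hypothesis B0 : forall x, S x -> 0 <= B x x.
Hypothesis Flin : forall a x y, S x -> S y -> F (lin a x y) = F x + a * F y.
Hypothesis FB : forall x, S x -> `|F x| <= C * Num.sqrt (B x x).

Let J x := B x x - 2 * F x.

(** With s the square root of [B x x], the energy is at least s^2 - 2 C s = (s - C)^2 - C^2. *)
Lemma riesz_energy_lbound x : S x -> - C ^+ 2 <= J x.
Proof.
move=> Sx; rewrite /J.
have h := le_trans (ler_norm _) (FB Sx).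
rewrite -[X in X - _](sqr_sqrtr (B0 Sx)).
have := sqr_ge0 (Num.sqrt (B x x) - C); nra.
Qed.

(* An almost minimiser of the energy [J] almost solves the variational
   equation; neither completeness nor closedness is needed. *)
Lemma approximate_riesz e : 0 < e ->
  exists2 p, S p & forall q, S q -> `|B p q - F q| <= e * Num.sqrt (B q q).
Proof.
move=> e0.
pose A := [set J x | x in S].
have Ainf : has_inf A.
  split; first by exists (J x0); exists x0.
  by exists (- C ^+ 2) => _ [x Sx <-]; exact: riesz_energy_lbound.
(* An excess of e^2 over the infimum becomes the constant term of a nonnegative quadratic in s,
   hence a residual of size e. *)
have e20 : 0 < e ^+ 2 by rewrite exprn_gt0.
have [_ [p Sp <-] pe] := inf_adherent e20 Ainf.
exists p => // q Sq.
rewrite (_ : e = Num.sqrt (e ^+ 2)); last by rewrite sqrtr_sqr gtr0_norm.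
apply: quadratic_ge0_CS; rewrite ?B0 ?ltW// => s.
have Spq := Slin s Sp Sq.
have : inf A <= J (lin s p q).
  by apply: ge_inf; [exact: Ainf.2|exists (lin s p q)].
have -> : J (lin s p q) = J p + 2 * s * (B p q - F q) + s ^+ 2 * B q q.
  rewrite /J Blin// (BC Sp Spq) (BC Sq Spq) !Blin// Flin// (BC Sq Sp); ring.
lra.
Qed.

End approximate_riesz.

Section riesz_L2.
Context d (T : measurableType d) (R : realType).
Variable mu : {measure set T -> \bar R}.
Context (E : Type) (lin : R -> E -> E -> E).
Variables (S : set E) (th : E -> T -> R) (F : E -> R) (C : R) (x0 : E).
Local Notation L2 := (Lfun mu 2%:E).
Local Notation ip := (ip mu).
Hypothesis S0 : S x0.
Hypothesis Slin : forall a x y, S x -> S y -> S (lin a x y).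
Hypothesis thL : forall x, S x -> th x \in L2.
Hypothesis thlin : forall a x y, th (lin a x y) = (fun t => th x t + a * th y t).
Hypothesis Flin : forall a x y, S x -> S y -> F (lin a x y) = F x + a * F y.
Hypothesis FB : forall x, S x -> `|F x| <= C * Num.sqrt (ip (th x) (th x)).

(** The functional lives on a parameter space and is bounded by the L^2 norm of [th x]. Representers
    with tolerance 1/(n+1) form a Cauchy sequence in L^2, and completeness is used only for their
    limit, which may leave the image of [S]. *)
Lemma riesz_L2 : exists2 w, w \in L2 & forall x, S x -> F x = ip w (th x).
Proof.
pose B x y := ip (th x) (th y).
have e_ n : 0 < n.+1%:R^-1 :> R by rewrite invr_gt0.
have P n : exists p, S p /\
    forall q, S q -> `|B p q - F q| <= n.+1%:R^-1 * Num.sqrt (B q q).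
  have [|||p Sp pP] := @approximate_riesz R E lin S B F C x0 S0 Slin _ _ _ Flin FB _ (e_ n).
  - by move=> x y Sx Sy; rewrite /B ipC.
  - move=> a x y z Sx Sy Sz; rewrite /B thlin -ipZl ?thL// -ipDl//; try exact: thL.
    by apply: Lfun2Z; exact: thL.
  - by move=> x _; exact: ip_ge0.
  - by exists p.
have [p pP] := choice P.
have pL n : th (p n) \in L2 by apply: thL; have [] := pP n.
have [|w wL wP] := L2_complete pL.
  move=> e e0.
  have [n0 n0P] : exists n0 : nat, (2 * n0.+1%:R^-1) ^+ 2 <= e :> R.
    have [k kP] : exists k : nat, 4 / e <= k%:R.
      by exists (Num.trunc (4 / e)).+1; apply: ltW; rewrite truncnS_gt.
    exists k; rewrite exprMn exprVn.
    rewrite ler_pdivrMr ?exprn_gt0//.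
    move: kP; rewrite ler_pdivrMr// => kP.
    apply: (@le_trans _ _ (k%:R * e)); first by lra.
    rewrite mulrC ler_wpM2l ?ltW// -natr1.
    by have : 0 <= k%:R :> R by []; nra.
  exists n0 => i j n0i n0j; apply: le_trans n0P.
  have [Si Pi] := pP i; have [Sj Pj] := pP j.
  have Sq : S (lin (-1) (p i) (p j)) by exact: Slin.
  set D := ip _ _.
  have thq : th (lin (-1) (p i) (p j)) = th (p i) \- th (p j).
    by rewrite thlin; apply/funext => x /=; rewrite mulN1r.
  have D0 : 0 <= D by exact: ip_ge0.
  have le_n k : (n0 <= k)%N -> k.+1%:R^-1 <= n0.+1%:R^-1 :> R.
    by move=> ?; rewrite lef_pV2 ?posrE// ler_nat.
  have h1 := Pi _ Sq; have h2 := Pj _ Sq.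
  (* Both almost-equations are tested with p_i - p_j; the values of F cancel, which leaves D <= 2 /
     (n0 + 1) * sqrt D. *)
  have dE : D = B (p i) (lin (-1) (p i) (p j)) - B (p j) (lin (-1) (p i) (p j)).
    by rewrite /B thq -ipBl// ?Lfun2B.
  have : D <= 2 * n0.+1%:R^-1 * Num.sqrt D.
    have h : B (lin (-1) (p i) (p j)) (lin (-1) (p i) (p j)) = D by rewrite /B thq.
    move: h1 h2; rewrite h => h1 h2.
    have s0 := sqrtr_ge0 D.
    have k1 := ler_wpM2r s0 (le_n _ n0i).
    have k2 := ler_wpM2r s0 (le_n _ n0j).
    move: h1 h2; rewrite !ler_norml => /andP[_ h1] /andP[h2 _].
    rewrite -mulrA; move: k1 k2 h1 h2 dE; rewrite -/D.
    move: (B _ _) (B _ _) (F _) (Num.sqrt D) => b1 b2 f r.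
    move: (i.+1%:R^-1 * r) (j.+1%:R^-1 * r) (n0.+1%:R^-1 * r) => x y z.
    by move=> ? ? ? ? ->; lra.
  move=> h.
  have s : Num.sqrt D <= 2 * n0.+1%:R^-1.
    have [/eqP D00|Dn0] := eqVneq D 0.
      by rewrite (eqP D00) sqrtr0 mulr_ge0.
    have sp : 0 < Num.sqrt D by rewrite sqrtr_gt0 lt_neqAle eq_sym Dn0.
    by rewrite -(ler_pM2r sp) -expr2 sqr_sqrtr.
  by rewrite -(sqr_sqrtr D0) lerXn2r// nnegrE ?sqrtr_ge0// mulr_ge0.
exists w => // x Sx; apply/eqP; rewrite eq_sym -subr_eq0 -normr_eq0 eq_le normr_ge0 andbT.
apply/ler_addgt0Pl => e e0; rewrite addr0.
set s := Num.sqrt (ip (th x) (th x)).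
have s0 : 0 <= s by exact: sqrtr_ge0.
have s1 : 0 < s + 1 by lra.
(* Two errors of size e' * s have to fit into e; adding 1 to s covers s = 0. *)
pose e' := e / (2 * (s + 1)).
have e'0 : 0 < e' by rewrite divr_gt0// mulr_gt0.
have [n1 n1P] := wP (e' ^+ 2) (exprn_gt0 _ e'0).
have [k kP] : exists k : nat, e'^-1 <= k%:R.
  by exists (Num.trunc e'^-1).+1; apply: ltW; rewrite truncnS_gt.
pose m := maxn n1 k; have [Sm Pm] := pP m.
have h1 := Pm _ Sx.
have h2 : `|ip w (th x) - ip (th (p m)) (th x)| <= e' * s.
  have xL := thL Sx.
  rewrite -normrN opprB -ipBl//; apply: le_trans (ip_CS _ _) _ => //.
    exact: Lfun2B.
  rewrite ler_wpM2r//; apply: sqrtr_le; first exact: ltW.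
  by apply: n1P; rewrite leq_maxl.
have h3 : m.+1%:R^-1 * s <= e' * s.
  rewrite ler_wpM2r// invf_ple ?posrE//; apply: le_trans kP _.
  by rewrite ler_nat ltnW// ltnS leq_maxr.
have h4 : e' * s + e' * s <= e.
  have -> : e = 2 * (e' * s) + 2 * e' by rewrite /e'; field; lra.
  by lra.
have := ler_normD (ip w (th x) - ip (th (p m)) (th x)) (B (p m) x - F x).
rewrite /B addrA subrK => h5; apply: le_trans h5 _.
exact: le_trans (lerD h2 (le_trans h1 h3)) h4.
Qed.

End riesz_L2.

(** * Smooth bump functions *)

Section smooth.
Context (R : realType).
Implicit Types f g : R -> R.

Definition smooth f := forall n t, derivable (derive1n n f) t 1.

Lemma smoothS f : (forall t, derivable f t 1) -> smooth (derive1 f) -> smooth f.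
Proof. by move=> df sf [|n] t; [exact: df|rewrite derive1Sn; exact: sf]. Qed.

Lemma smooth_derive1 f : smooth f -> smooth (derive1 f).
Proof. by move=> sf n t; rewrite -derive1Sn. Qed.

Lemma smooth_lin (a : R) f g : smooth f -> smooth g ->
  smooth (f \+ (fun x => a * g x)).
Proof.
move=> sf sg n; elim: n f g sf sg => [|n IH] f g sf sg t.
  by apply: derivableD (sf 0%N t) _; apply: derivableZ (sg 0%N t).
rewrite derive1Sn (_ : derive1 _ = derive1 f \+ (fun x => a * derive1 g x)).
  by apply: IH; exact: smooth_derive1.
apply/funext => x; rewrite derive1E.
have dZ : derivable (fun y => a * g y) x 1 by apply: derivableZ (sg 0%N x).
rewrite (deriveD (sf 0%N x) dZ) /= !derive1E; congr (_ + _).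
exact: deriveZ (sg 0%N x).
Qed.

Lemma smooth_continuous f : smooth f -> continuous f.
Proof.
move=> sf x.
exact/differentiable_continuous/derivable1_diffP/(sf 0%N).
Qed.

(** The difference quotient at a is at most |p(x)| |x - a|, and continuity of the polynomial makes
    this vanish. It serves at the endpoints of the bumps. *)
Lemma is_derive_flat f (p : {poly R}) (a : R) :
  (forall x, `|f x| <= `|p.[x]| * (x - a) ^+ 2) -> is_derive a 1 f 0.
Proof.
move=> fp.
have fa : f a = 0.
  apply/eqP; rewrite -normr_eq0 eq_le normr_ge0 andbT.
  by rewrite (le_trans (fp a))// subrr expr0n/= mulr0.
have cv : h^-1 *: (f (h *: 1 + a) - f a) @[h --> 0^'] --> 0.
  apply: norm_cvg0.
  apply: (@squeeze_cvgr _ _ _ _ (cst 0) (fun h => `|p.[h + a]| * `|h|)).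
  - near=> h.
    have h0 : h != 0 by near: h; exact: nbhs_dnbhs_neq.
    rewrite normr_ge0/= fa subr0 normrZ [h *: 1]mulr1 normfV.
    rewrite ler_pdivrMl ?normr_gt0//; apply: le_trans (fp _) _.
    have -> : (h + a - a) ^+ 2 = `|h| * `|h|.
      by rewrite addrK -normrM -expr2 ger0_norm ?sqr_ge0.
    by rewrite mulrCA.
  - exact: cvg_cst.
  - have c : {for 0, continuous (fun h : R => `|p.[h + a]| * `|h|)}.
      apply: continuousM; last exact: norm_continuous.
      apply: continuous_comp; last exact: norm_continuous.
      apply: (@continuous_comp _ _ _ (fun h => h + a) (horner p)).
        by apply: continuousD; [exact: cvg_id|exact: cvg_cst].
      exact: continuous_horner.
    have c0 : `|p.[h + a]| * `|h| @[h --> 0] --> `|p.[0 + a]| * `|0 : R| := c.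
    rewrite normr0 mulr0 in c0.
    by apply: cvg_trans c0; apply: cvg_fmap2; exact: cvg_within.
apply: DeriveDef; first by apply/cvg_ex; exists 0.
exact/cvg_lim.
Unshelve. all: by end_near. Qed.

End smooth.

Section bump.
Context (R : realType) (s t c : R).
Hypothesis c0 : 0 < c.

Let W : {poly R} := c *: (('X - s%:P) * (t%:P - 'X)).

Let WE x : W.[x] = c * ((x - s) * (t - x)).
Proof. by rewrite /W !hornerE. Qed.

Let W_gt0 x : s < x < t -> 0 < W.[x].
Proof. by move=> /andP[sx xt]; rewrite WE !mulr_gt0// subr_gt0. Qed.

(** The functions q W^-k exp(-1/W), with q a polynomial, form a class closed under differentiation,
    so smoothness follows by induction on the order. The plain bump is q = 1, k = 0. *)
Definition bumpk (q : {poly R}) (k : nat) (x : R) :=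
  if s < x < t then q.[x] * W.[x]^-1 ^+ k * expR (- W.[x]^-1) else 0.

(** The exponential series gives exp(y) >= y^(k+2) / (k+2)! at y = 1/W; the two powers beyond k
    leave W^2, hence quadratic flatness at the endpoints. *)
Let expVW_le k x : s < x < t ->
  W.[x]^-1 ^+ k * expR (- W.[x]^-1) <= (k.+2)`!%:R * W.[x] ^+ 2.
Proof.
move=> sxt; have W0 := W_gt0 sxt; set y := W.[x]^-1.
have y0 : 0 < y by rewrite invr_gt0.
have := @expR_ge1Dxn R y k.+1 (ltW y0).
rewrite expRN => h.
have fact0 : 0 < (k.+2)`!%:R :> R by rewrite ltr0n fact_gt0.
have {}h : y ^+ k.+2 / (k.+2)`!%:R <= expR y by apply: le_trans h; rewrite lerDr.
rewrite ler_pdivrMr ?expR_gt0//.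
have -> : W.[x] = y^-1 by rewrite invrK.
rewrite ler_pdivrMr// in h.
rewrite mulrAC [y^-1 ^+ 2]exprVn ler_pdivlMr ?exprn_gt0//.
by rewrite -exprD addn2 [leRHS]mulrC.
Qed.

Let bump_flat q k a : (a == s) || (a == t) ->
  exists p : {poly R}, forall x, `|bumpk q k x| <= `|p.[x]| * (x - a) ^+ 2.
Proof.
move=> ast.
have [W1 W1E] : exists W1 : {poly R}, forall x, W.[x] = W1.[x] * (x - a).
  case/orP: ast => /eqP ->.
    exists (c *: (t%:P - 'X)) => x.
    by rewrite WE hornerZ hornerD hornerN hornerX hornerC; ring.
  by exists (c *: (s%:P - 'X)) => x; rewrite WE hornerZ hornerD hornerN hornerX hornerC; ring.
exists ((k.+2)`!%:R *: (q * W1 ^+ 2)) => x; rewrite /bumpk.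
case: ifPn => sxt; last by rewrite normr0 mulr_ge0// sqr_ge0.
rewrite -mulrA normrM hornerZ hornerM horner_exp.
rewrite [X in _ * X]ger0_norm; last first.
  by rewrite mulr_ge0 ?expR_ge0// exprn_ge0// invr_ge0 ltW// W_gt0.
apply: le_trans (ler_wpM2l _ (expVW_le k sxt)) _ => //.
rewrite W1E exprMn !normrM (ger0_norm (ler0n _ _)).
rewrite -(real_normK (num_real W1.[x])) le_eqVlt; apply/orP; left; apply/eqP; ring.
Qed.

(** Numerator after one differentiation: (q W^-k exp(-1/W))' equals this polynomial times W^-(k+2)
    exp(-1/W). *)
Let next (q : {poly R}) (k : nat) : {poly R} :=
  q^`() * W ^+ 2 - k%:R *: (q * W^`() * W) + q * W^`().

Lemma is_derive_bumpk (q : {poly R}) (k : nat) (x : R) :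
  is_derive x 1 (bumpk q k) (bumpk (next q k) k.+2 x).
Proof.
have [/andP[sx xt]|] := boolP (s < x < t).
  have sxt : s < x < t by rewrite sx.
  have W0 := W_gt0 sxt.
  pose g x := q.[x] * W.[x]^-1 ^+ k * expR (- W.[x]^-1).
  apply: (@near_eq_is_derive _ _ _ g).
    near=> y; rewrite /bumpk ifT//; apply/andP; split; near: y.
      exact: lt_nbhsr.
      exact: lt_nbhsl.
  have dV : is_derive x 1 (fun y => W.[y]^-1) (- W.[x] ^- 2 *: W^`().[x]).
    by apply: is_deriveV; rewrite gt_eqF.
  have dE : is_derive x 1 (fun y => expR (- W.[y]^-1))
      (expR (- W.[x]^-1) * (W.[x] ^- 2 * W^`().[x])).
    apply: (@is_derive1_comp _ expR (fun y => - W.[y]^-1)).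
    by have := is_deriveN dV; rewrite scaleNr opprK; exact.
  have dX : is_derive x 1 (fun y => W.[y]^-1 ^+ k)
      ((k%:R * W.[x]^-1 ^+ k.-1) *: (- W.[x] ^- 2 *: W^`().[x])).
    have := is_deriveX k dV.
    by rewrite (_ : _ ^+ k = (fun y => W.[y]^-1 ^+ k))// exprfctE.
  have dq := is_derive_poly q x.
  have dqX := is_deriveM dq dX.
  have := is_deriveM dqX dE.
  set rhs := (X in is_derive _ _ _ X -> _) => D.
  suff -> : bumpk (next q k) k.+2 x = rhs by exact: D.
  have nextE : (next q k).[x] = q^`().[x] * W.[x] ^+ 2
      - k%:R * (q.[x] * W^`().[x] * W.[x]) + q.[x] * W^`().[x].
    rewrite /next; move: (W) => V.
    by rewrite hornerD hornerD hornerN hornerZ !hornerM [in RHS]expr2.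
  rewrite /rhs /bumpk sxt nextE mulrfctE /GRing.scale/=.
  have : W.[x] != 0 by rewrite gt_eqF.
  move: (expR (- W.[x]^-1)) (W.[x]) (W^`().[x]) (q.[x]) (q^`().[x]) => E w w' a a' w0.
  case: (k) => [|n] /=; first by field.
  by rewrite !exprS; move: (w^-1 ^+ n) (n.+1%:R) => z y; field.
rewrite negb_and -!leNgt => xst.
have b0 : bumpk (next q k) k.+2 x = 0.
  by rewrite /bumpk ifF//; apply/negbTE; rewrite negb_and -!leNgt.
rewrite b0.
(* At s and t neither branch of the definition holds in a neighbourhood, so flatness is used;
   elsewhere outside ]s, t[ the function is locally zero. *)
have [xe|xne] := boolP ((x == s) || (x == t)).
  by have [p] := bump_flat q k xe; exact: is_derive_flat.
apply: (@near_eq_is_derive _ _ _ (cst 0)).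
move: xne; rewrite negb_or => /andP[xs xt].
case/orP: xst => [xs'|tx].
  have xs'' : x < s by rewrite lt_neqAle xs.
  near=> y; rewrite /bumpk ifF//; apply/negbTE; rewrite negb_and -!leNgt.
  by apply/orP; left; near: y; apply: filterS (lt_nbhsl xs'') => z; exact: ltW.
have tx' : t < x by rewrite lt_neqAle eq_sym xt.
near=> y; rewrite /bumpk ifF//; apply/negbTE; rewrite negb_and -!leNgt.
by apply/orP; right; near: y; apply: filterS (lt_nbhsr tx') => z; exact: ltW.
Unshelve. all: by end_near. Qed.

Lemma smooth_bumpk q k : smooth (bumpk q k).
Proof.
have dE q' k' : derive1 (bumpk q' k') = bumpk (next q' k') k'.+2.
  by apply/funext => x; rewrite derive1E; have [] := is_derive_bumpk q' k' x.
have der q' k' x : derivable (bumpk q' k') x 1.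
  by have [] := is_derive_bumpk q' k' x.
move=> n; elim: n q k => [|n IH] q k x; first exact: der.
by rewrite derive1Sn dE; exact: IH.
Qed.

Definition bump := bumpk 1 0.

Lemma smooth_bump : smooth bump.
Proof. exact: smooth_bumpk. Qed.

Lemma bumpE x : bump x =
  if s < x < t then expR (- (c * ((x - s) * (t - x)))^-1) else 0.
Proof. by rewrite /bump /bumpk -/W WE hornerC expr0 !mul1r. Qed.

Lemma bump_bound x : 0 <= bump x <= 1.
Proof.
rewrite bumpE; case: ifPn => [/andP[sx xt]|]; last by rewrite lexx ler01.
by rewrite expR_ge0/= expR_le1 oppr_le0 invr_ge0 !mulr_ge0 ?subr_ge0 ?ltW.
Qed.

Lemma bump_out x : ~~ (s < x < t) -> bump x = 0.
Proof. by rewrite bumpE => /negbTE ->. Qed.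

End bump.

(** * Integration against a restricted measure *)

Section integral_restr.
Context d (T : measurableType d) (R : realType).
Variables (mu : {sigma_finite_measure set T -> \bar R}) (D : set T).
Hypothesis mD : measurable D.
Local Notation muD := (restr_measure mu mD).
Local Open Scope ereal_scope.
Import HBNNSimple.

Let integral_restr_nnsfun (h : {nnsfun T >-> R}) :
  \int[muD]_x (h x)%:E = \int[mu]_(x in D) (h x)%:E.
Proof.
under [LHS]eq_integral do rewrite fimfunE -fsumEFin//.
rewrite [LHS]ge0_integral_fsum//; last 2 first.
  - by move=> r; exact/measurable_EFinP/measurableT_comp.
  - by move=> n x _; rewrite EFinM nnfun_muleindic_ge0.
under [RHS]eq_integral do rewrite fimfunE -fsumEFin//.
rewrite [RHS]ge0_integral_fsum//; last 2 first.
  - by move=> r; apply/measurable_EFinP/measurable_funTS/measurableT_comp.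
  - by move=> n x _; rewrite EFinM nnfun_muleindic_ge0.
apply: eq_fsbigr => r _.
rewrite !integralZl_indic_nnsfun//= !integral_indic// setIT.
by rewrite /restr_measure /mrestr.
Qed.

Lemma ge0_integral_restr (f : T -> \bar R) : measurable_fun setT f ->
  (forall x, 0 <= f x) -> \int[muD]_x f x = \int[mu]_(x in D) f x.
Proof.
move=> mf f0; pose f_ := nnsfun_approx measurableT mf.
transitivity (limn (fun n => \int[muD]_x (f_ n x)%:E)).
  rewrite -monotone_convergence//=.
  - apply: eq_integral => x /[!inE] xD; apply/esym/cvg_lim => //=.
    exact: cvg_nnsfun_approx.
  - by move=> n; apply: measurableT_comp => //; exact: measurable_funTS.
  - by move=> n x _; rewrite lee_fin.
  - by move=> x _ a b ab; rewrite lee_fin//; exact/lefP/nd_nnsfun_approx.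
under eq_fun do rewrite integral_restr_nnsfun.
rewrite -monotone_convergence//=.
- apply: eq_integral => x /[!inE] xD; apply/cvg_lim => //=.
  exact: cvg_nnsfun_approx.
- by move=> n; apply: measurableT_comp => //; exact: measurable_funTS.
- by move=> n x _; rewrite lee_fin.
- by move=> x _ a b ab; rewrite lee_fin//; exact/lefP/nd_nnsfun_approx.
Qed.

Lemma integral_restr (f : T -> \bar R) : measurable_fun setT f ->
  \int[muD]_x f x = \int[mu]_(x in D) f x.
Proof.
move=> mf; rewrite integralE [RHS]integralE !ge0_integral_restr//.
  exact: measurable_funeneg.
exact: measurable_funepos.
Qed.

Lemma integrable_restr (f : T -> \bar R) : measurable_fun setT f ->
  muD.-integrable setT f <-> mu.-integrable D f.
Proof.
move=> mf; split=> /integrableP[_ fi]; apply/integrableP; split => //.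
- exact: measurable_funTS.
- by rewrite -ge0_integral_restr//; exact: measurableT_comp.
- by rewrite ge0_integral_restr//; exact: measurableT_comp.
Qed.

Lemma Rintegral_restr (f : T -> R) : measurable_fun setT f ->
  (\int[muD]_x f x = \int[mu]_(x in D) f x)%R.
Proof. by move=> mf; rewrite /Rintegral integral_restr//; exact/measurable_EFinP. Qed.

Lemma ae_restr (P : T -> Prop) :
  {ae mu, forall x, D x -> P x} -> {ae muD, forall x, P x}.
Proof.
move=> [A [mA A0 PA]]; exists (A `|` ~` D); split.
- by apply: measurableU => //; exact: measurableC.
- apply/eqP; rewrite eq_le measure_ge0 andbT /restr_measure /mrestr.
  rewrite setIUl setICl setU0 -[leRHS]A0 le_measure ?inE//.
  exact: measurableI.
- move=> x /= nPx; have [Dx|] := pselect (D x); [left|by right].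
  by apply: PA => /= /(_ Dx).
Qed.

End integral_restr.

(** * Smooth primitives *)

Section Rintegral_helpers.
Context d (T : measurableType d) (R : realType).
Variable mu : {measure set T -> \bar R}.
Implicit Types f g h : T -> R.

Lemma integrable_mulb (M : R) g h : measurable_fun setT h ->
  (forall x, `|h x| <= M) -> mu.-integrable setT (EFin \o g) ->
  mu.-integrable setT (EFin \o (fun x => g x * h x)).
Proof.
move=> mh hM gi; apply: (le_integrable measurableT _ _ (integrableZr measurableT M gi)).
  apply/measurable_EFinP; apply: measurable_funM => //.
  exact/measurable_EFinP/(measurable_int mu).
move=> x _; rewrite /= lee_fin !normrM ler_wpM2l//.
by apply: le_trans (hM x) _; exact: ler_norm.
Qed.

Lemma ae_eq_Rintegral f g : measurable_fun setT f -> measurable_fun setT g ->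
  {ae mu, forall x, f x = g x} -> \int[mu]_x f x = \int[mu]_x g x.
Proof.
move=> mf mg fg; congr fine; apply: ae_eq_integral => //.
- exact/measurable_EFinP.
- exact/measurable_EFinP.
- by apply: filterS fg => x -> _.
Qed.

Lemma cvg_Rintegral_dominated (f : (T -> R)^nat) g h :
  (forall n, measurable_fun setT (f n)) -> measurable_fun setT g ->
  (forall x, f n x @[n --> \oo] --> g x) ->
  mu.-integrable setT (EFin \o h) -> (forall n x, `|f n x| <= h x) ->
  \int[mu]_x f n x @[n --> \oo] --> \int[mu]_x g x.
Proof.
move=> mf mg fg ih fh; apply: fine_cvg.
have [||||ig _ c] := @dominated_convergence _ _ _ mu setT measurableT
  (fun n x => (f n x)%:E) (EFin \o g) (EFin \o h) _ _ _ ih _.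
- by move=> n; exact/measurable_EFinP.
- exact/measurable_EFinP.
- by apply: nearW => x _; apply: cvg_EFin; [exact: nearW|exact: fg].
- by apply: nearW => x n _; rewrite lee_fin.
- by rewrite fineK//; exact: (integrable_fin_num measurableT ig).
Qed.

End Rintegral_helpers.

Section primitive.
Context (R : realType).
Local Notation leb := (@lebesgue_measure R).
Variables (b : R -> R) (m M T : R).
Hypotheses (sb : smooth b) (m0 : 0 < m) (mM : m <= M) (MT : M < T).
Hypothesis b_out : forall x, ~~ (m <= x <= M) -> b x = 0.
Hypothesis b_int0 : \int[leb]_x b x = 0.

Definition primNy (b : R -> R) (x : R) : R := \int[leb]_(y in `]-oo, x]) b y.

Lemma integrable_supp : leb.-integrable setT (EFin \o b).
Proof.
have -> : b = b \_ `[m, M].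
  apply/funext => x; rewrite patchE; case: ifPn => //.
  by rewrite notin_setE/= in_itv/= => /negP; exact: b_out.
rewrite -restrict_EFin; apply/(integrable_mkcond _ _).1 => //.
apply: continuous_compact_integrable; first exact: segment_compact.
by apply: continuous_subspaceT; exact: smooth_continuous.
Qed.

Let primNy_FTC x : derivable (primNy b) x 1 /\ derive1 (primNy b) x = b x.
Proof.
apply: (@continuous_FTC1 R b -oo%O x (x + 1)).
- by rewrite ltrDl.
- by apply: integrableS integrable_supp.
- by rewrite ltNyr.
- exact: smooth_continuous.
Qed.

Lemma derive1_primNy : derive1 (primNy b) = b.
Proof. by apply/funext => x; exact: (primNy_FTC x).2. Qed.

Lemma derivable_primNy x : derivable (primNy b) x 1.
Proof. exact: (primNy_FTC x).1. Qed.

(** To the right of [m, M] the primitive is the full integral of [b]; this is where the mean value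
    zero of [b] makes the primitive compactly supported. *)
Lemma primNy_out x : ~~ (m <= x <= M) -> primNy b x = 0.
Proof.
rewrite negb_and -!ltNge => /orP[xm|Mx]; rewrite /primNy.
  rewrite (@eq_Rintegral _ _ _ _ _ (cst 0)) ?Rintegral_cst ?mul0r// => y.
  rewrite inE/= in_itv/= => yx; apply: b_out.
  by rewrite negb_and -ltNge (le_lt_trans yx xm).
rewrite Rintegral_mkcond -[RHS]b_int0; apply: eq_Rintegral => y _.
rewrite patchE; case: ifPn => //; rewrite notin_setE/= in_itv/= => /negP.
rewrite -ltNge => xy; apply/esym/b_out.
by rewrite negb_and -!ltNge (lt_trans Mx xy) orbT.
Qed.

Lemma Cc_infty_time_primNy : Cc_infty_time T (primNy b).
Proof.
have sp : smooth (primNy b).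
  by apply: smoothS; [exact: derivable_primNy|rewrite derive1_primNy].
split; first exact: sp.
have suppE : closure [set t | primNy b t != 0] `<=` `[m, M].
  rewrite [X in _ `<=` X](closure_id _).1; last exact: itv_closed.
  apply: closure_subset => x /=; rewrite in_itv/=; apply: contraNT => h.
  by apply/eqP; exact: primNy_out.
split.
  exact: (subclosed_compact (@closed_closure _ _) (@segment_compact R m M) suppE).
move=> x /suppE/=; rewrite !in_itv/= => /andP[mx xM].
by rewrite (lt_le_trans m0 mx) (le_lt_trans xM MT).
Qed.

End primitive.

(** On the null set of non-integrable slices a real integral takes the default value of [fine];
    domination by the extended integral still holds there. *)
Lemma abse_fine_le (R : realType) (x : \bar R) : (`|(fine x)%:E| <= `|x|)%E.
Proof. by case: x => [r| |] //=; rewrite normr0 leey. Qed.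

(** * Fubini's theorem for real-valued integrals *)

Section fubini_real.
Context d1 d2 (T1 : measurableType d1) (T2 : measurableType d2) (R : realType).
Variable m1 : {sigma_finite_measure set T1 -> \bar R}.
Variable m2 : {sigma_finite_measure set T2 -> \bar R}.
Variable f : T1 * T2 -> R.
Hypothesis fi : (m1 \x m2)%E.-integrable setT (EFin \o f).

Let ae1 : {ae m1, forall x,
  (\int[m2]_y f (x, y))%:E = (\int[m2]_y (f (x, y))%:E)%E}.
Proof.
apply: filterS (ae_integrable1 fi) => x ix.
by rewrite /Rintegral fineK//; exact: integrable_fin_num ix.
Qed.

Let ae2 : {ae m2, forall y,
  (\int[m1]_x f (x, y))%:E = (\int[m1]_x (f (x, y))%:E)%E}.
Proof.
apply: filterS (ae_integrable2 fi) => x ix.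
by rewrite /Rintegral fineK//; exact: integrable_fin_num ix.
Qed.

Lemma measurable_Rintegral1 : measurable_fun setT (fun x => \int[m2]_y f (x, y)).
Proof. by apply: measurableT_comp => //; exact: measurable_fubini_F fi. Qed.

Lemma measurable_Rintegral2 : measurable_fun setT (fun y => \int[m1]_x f (x, y)).
Proof. by apply: measurableT_comp => //; exact: measurable_fubini_G fi. Qed.

Lemma integrable_Rintegral1 :
  m1.-integrable setT (EFin \o (fun x => \int[m2]_y f (x, y))).
Proof.
apply: (le_integrable measurableT _ _ (integrable_fubini_F fi)).
  exact/measurable_EFinP/measurable_Rintegral1.
by move=> x _; exact: abse_fine_le.
Qed.

Lemma integrable_Rintegral2 :
  m2.-integrable setT (EFin \o (fun y => \int[m1]_x f (x, y))).
Proof.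
have mf := measurable_int _ fi.
suff iG : m2.-integrable setT (fubini_G m1 (EFin \o f)).
  apply: (le_integrable measurableT _ _ iG).
    exact/measurable_EFinP/measurable_Rintegral2.
  by move=> x _; exact: abse_fine_le.
apply/integrableP; split; first exact: measurable_fubini_G fi.
apply: le_lt_trans ((integrable21ltyP m1 m2 mf).1 fi).
apply: ge0_le_integral => //.
- by apply: measurableT_comp => //; exact: measurable_fubini_G fi.
- apply: (@measurable_fun_fubini_tonelli_G _ _ _ _ _ m1 (fun z => `|(f z)%:E|%E)) => //.
  exact: measurableT_comp.
- move=> y _; apply: le_abse_integral => //.
  exact: (measurableT_comp mf).
Qed.

Lemma Rfubini1 :
  \int[(m1 \x m2)%E]_z f z = \int[m1]_x \int[m2]_y f (x, y).
Proof.
rewrite /Rintegral -integral12_prod_meas1//; congr fine.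
apply: ae_eq_integral => //.
- exact: measurable_fubini_F fi.
- exact/measurable_EFinP/measurable_Rintegral1.
- by apply: filterS ae1 => x /= -> _.
Qed.

Lemma Rfubini2 :
  \int[(m1 \x m2)%E]_z f z = \int[m2]_y \int[m1]_x f (x, y).
Proof.
rewrite /Rintegral -integral21_prod_meas1//; congr fine.
apply: ae_eq_integral => //.
- exact: measurable_fubini_G fi.
- exact/measurable_EFinP/measurable_Rintegral2.
- by apply: filterS ae2 => x /= -> _.
Qed.

End fubini_real.

(** * A countable family of test functions in time *)

Section testfun.
Context (R : realType).
Local Notation leb := (@lebesgue_measure R).

Lemma smooth_cst0 : smooth (cst 0 : R -> R).
Proof.
move=> n t; rewrite (_ : derive1n n _ = cst 0); first exact: derivable_cst.
by elim: n => // n IH; rewrite derive1nS IH; apply/funext => x; rewrite derive1_cst.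
Qed.

(** The exponent is divided by n + 1, so the bumps tend to the indicator of ]s, t[ as n grows. *)
Definition bumpn (s t : R) (n : nat) : R -> R := bump s t n.+1%:R.

Lemma smooth_bumpn s t n : smooth (bumpn s t n).
Proof. exact: smooth_bump. Qed.

Definition bumpI s t n : R := \int[leb]_x bumpn s t n x.

(** Derivatives of test functions are exactly the mean-free smooth functions with compact support;
    weighting each bump by the integral of the other cancels the mean. *)
Definition bump0 s t p q n (x : R) : R :=
  bumpI p q n * bumpn s t n x - bumpI s t n * bumpn p q n x.

Definition test_fun s t p q n : R -> R := primNy (bump0 s t p q n).

Variables (s t p q T : R) (n : nat).
Hypotheses (s0 : 0 < s) (st : s < t) (tT : t < T).
Hypotheses (p0 : 0 < p) (pq : p < q) (qT : q < T).

Lemma smooth_bump0 : smooth (bump0 s t p q n).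
Proof.
have h1 := smooth_lin (a := bumpI p q n) smooth_cst0 (@smooth_bumpn s t n).
have h2 := smooth_lin (a := - bumpI s t n) h1 (@smooth_bumpn p q n).
rewrite [X in smooth X](_ : _ = (cst 0 \+ (fun x => bumpI p q n * bumpn s t n x))
    \+ (fun x => - bumpI s t n * bumpn p q n x)); first exact: h2.
by apply/funext => x; rewrite /bump0/= add0r mulNr.
Qed.

Lemma integrable_bumpn s' t' : s' < t' ->
  leb.-integrable setT (EFin \o bumpn s' t' n).
Proof.
move=> st'; have sb := @smooth_bumpn s' t' n.
have -> : bumpn s' t' n = bumpn s' t' n \_ `[s', t'].
  apply/funext => x; rewrite patchE; case: ifPn => //.
  rewrite notin_setE/= in_itv/= => /negP h; apply: bump_out.
  by apply: contra h => /andP[/ltW -> /ltW ->].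
rewrite -restrict_EFin; apply/(integrable_mkcond _ _).1 => //.
apply: continuous_compact_integrable; first exact: segment_compact.
by apply: continuous_subspaceT; exact: smooth_continuous sb.
Qed.

Lemma bump0_int0 : \int[leb]_x bump0 s t p q n x = 0.
Proof.
have i1 := integrable_bumpn st; have i2 := integrable_bumpn pq.
rewrite RintegralB//; last 2 first.
  - exact: (integrableZl measurableT _ i1).
  - exact: (integrableZl measurableT _ i2).
rewrite (RintegralZl _ measurableT i1) (RintegralZl _ measurableT i2).
rewrite -/(bumpI s t n) -/(bumpI p q n) [X in X - _]mulrC.
exact: subrr.
Qed.

Let m := Num.min s p.
Let M := Num.max t q.

Lemma bump0_out x : ~~ (m <= x <= M) -> bump0 s t p q n x = 0.
Proof.
move=> xmM; have [h1 h2] : bumpn s t n x = 0 /\ bumpn p q n x = 0.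
  by split; apply: bump_out; apply: contra xmM => /andP[sx xt];
    rewrite /m /M ge_min le_max (ltW sx) (ltW xt) ?orbT.
rewrite /bump0 h1 h2; move: (bumpI p q n) (bumpI s t n) => a b.
by rewrite !mulr0 subr0.
Qed.
End testfun.

Section testfun_limits.
Context (R : realType).
Local Notation leb := (@lebesgue_measure R).

Lemma cvg_bumpn (s t x : R) :
  bumpn s t n x @[n --> \oo] --> (\1_(`]s, t[%classic : set R) x : R).
Proof.
rewrite indicE; case: (boolP (x \in _)); rewrite ?inE ?notin_setE/= in_itv/=.
  move=> sxt; pose c := ((x - s) * (t - x))^-1.
  have E n : bumpn s t n x = expR (- (c * n.+1%:R^-1)).
    by rewrite /bumpn bumpE sxt /c invfM mulrC.
  rewrite (eq_cvg _ _ E).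
  have c0 : - (c * n.+1%:R^-1) @[n --> \oo] --> (0 : R).
    rewrite -oppr0 -(mulr0 c); apply: cvgN; apply: cvgM; first exact: cvg_cst.
    exact: cvg_harmonic.
  have := cvg_comp _ _ c0 (@continuous_expR R 0).
  by rewrite expR0; exact.
move=> /negP sxt; rewrite (_ : (fun n => bumpn s t n x) = cst 0).
  exact: cvg_cst.
by apply/funext => n; rewrite /bumpn bump_out.
Qed.

Lemma measurable_bumpn (s t : R) n : measurable_fun setT (bumpn s t n).
Proof.
apply: continuous_measurable_fun; apply: smooth_continuous; exact: smooth_bumpn.
Qed.

Lemma bumpn_norm (s t : R) n x : `|bumpn s t n x| <= 1.
Proof.
have c0 : 0 < n.+1%:R :> R by [].
by have /andP[b0 b1] := bump_bound s t c0 x; rewrite ger0_norm.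
Qed.

Lemma cvg_bumpI (s t : R) : s < t -> bumpI s t n @[n --> \oo] --> t - s.
Proof.
move=> st.
have <- : \int[leb]_x (\1_(`]s, t[%classic : set R) x : R) = t - s.
  by rewrite /Rintegral integral_indic//= setIT lebesgue_measure_itv/= lte_fin st.
apply: (@cvg_Rintegral_dominated _ _ _ leb (bumpn s t) _ (\1_(`]s, t[%classic : set R))).
- by move=> n; exact: measurable_bumpn.
- by [].
- by move=> x; exact: cvg_bumpn.
- exact: integrable_indic_itv.
- move=> n x; rewrite indicE; case: (boolP (x \in _)) => [_|].
    exact: bumpn_norm.
  by rewrite notin_setE/= in_itv/= => /negP sxt; rewrite /bumpn bump_out// normr0.
Qed.

Lemma testfun_Cc (s t p q T : R) n : 0 < s -> s < t -> t < T ->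
  0 < p -> p < q -> q < T -> Cc_infty_time T (test_fun s t p q n).
Proof.
move=> s0 st tT p0 pq qT.
apply: (@Cc_infty_time_primNy _ _ (Num.min s p) (Num.max t q)).
- exact: smooth_bump0.
- by rewrite lt_min s0.
- by rewrite gt_max tT.
- by move=> x; exact: bump0_out.
- exact: bump0_int0.
Qed.

Lemma derive1_testfun (s t p q : R) n : s < t -> p < q ->
  derive1 (test_fun s t p q n) = bump0 s t p q n.
Proof.
move=> st pq; apply: (@derive1_primNy _ _ (Num.min s p) (Num.max t q)).
- exact: smooth_bump0.
- by move=> x; exact: bump0_out.
Qed.

Lemma integrable_bump0 (s t p q : R) n : s < t -> p < q ->
  leb.-integrable setT (EFin \o bump0 s t p q n).
Proof.
move=> st pq; apply: (@integrable_supp _ _ (Num.min s p) (Num.max t q)).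
- exact: smooth_bump0.
- by move=> x; exact: bump0_out.
Qed.

End testfun_limits.

Section finite_product.
Context d1 d2 (T1 : measurableType d1) (T2 : measurableType d2) (R : realType).
Variable m1 : {sigma_finite_measure set T1 -> \bar R}.
Variable m2 : {sigma_finite_measure set T2 -> \bar R}.

Lemma integrable_snd (g : T2 -> R) : (m1 setT < +oo)%E ->
  m2.-integrable setT (EFin \o g) ->
  (m1 \x m2)%E.-integrable setT (EFin \o (fun z => g z.2)).
Proof.
move=> fin gi; have mg := measurable_int _ gi.
have mgz : measurable_fun setT (EFin \o (fun z : T1 * T2 => g z.2)).
  exact: (measurableT_comp mg measurable_snd).
apply/(integrable21ltyP m1 m2 mgz).
rewrite (eq_integral (fun y => (`|(EFin \o g) y| * m1 setT)%E)); last first.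
  by move=> y _; rewrite -integral_cst.
rewrite ge0_integralZr//; last exact: measurableT_comp.
by rewrite lte_mul_pinfty ?integral_ge0 ?ge0_fin_numE ?integral_ge0//;
  case/integrableP : gi.
Qed.

Lemma integrable_bounded (M : R) (h : T1 -> R) : (m1 setT < +oo)%E ->
  measurable_fun setT h -> (forall x, `|h x| <= M) ->
  m1.-integrable setT (EFin \o h).
Proof.
move=> fin mh hM; apply: measurable_bounded_integrable => //.
exists M; split; first exact: num_real.
by move=> y My x _; apply: le_trans (hM x) (ltW My).
Qed.

End finite_product.

(** * Primitives of integrable functions of time *)

Section scalar_muI.
Context (R : realType) (T : R).
Hypothesis T0 : 0 < T.
Local Notation leb := (@lebesgue_measure R).
Local Notation muI := (@muI R T).
Implicit Types w g : measurableTypeR R -> R.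

Lemma muI_setT : muI setT = T%:E.
Proof.
by rewrite /Defs.muI/= /restr_measure /mrestr setTI lebesgue_measure_itv/= lte_fin T0 sube0.
Qed.

Lemma muI_fin : (muI setT < +oo)%E.
Proof. by rewrite muI_setT ltry. Qed.

Lemma Rintegral_muI_supp g : measurable_fun setT g ->
  (forall x, ~~ (0 < x < T) -> g x = 0) -> \int[muI]_x g x = \int[leb]_x g x.
Proof.
move=> mg g0; rewrite Rintegral_restr// Rintegral_mkcond.
apply: eq_Rintegral => x _; rewrite patchE; case: ifPn => //.
by rewrite notin_setE/= in_itv/= => /negP /g0.
Qed.

(** The primitive vanishing at 0. Integrating over all of ]0, T[ against an indicator makes it a
    slice integral of a function of (t, s), ready for Fubini. *)
Definition prim w (t : R) : R :=
  \int[muI]_s ((\1_(`]-oo, t[%classic : set R) s : R) * w s).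

Variables (w' : measurableTypeR R -> R).
Hypothesis wi' : muI.-integrable setT (EFin \o w').

Let A : set (measurableTypeR R * measurableTypeR R) := [set z | z.2 < z.1].

Let mA : measurable A.
Proof.
rewrite (_ : A = (fun z => z.2 < z.1) @^-1` [set true]); last first.
  by apply/seteqP; split => z /=.
rewrite -[X in measurable X]setTI.
exact: (measurable_fun_ltr measurable_snd measurable_fst measurableT).
Qed.

Let F (b : measurableTypeR R -> R) : measurableTypeR R * measurableTypeR R -> R :=
  fun z => w' z.2 * (\1_A z : R) * b z.1.

Let integrable_F (b : measurableTypeR R -> R) (M : R) :
  measurable_fun setT b -> (forall x, `|b x| <= M) ->
  (muI \x muI)%E.-integrable setT (EFin \o F b).
Proof.
move=> mb bM; apply: (@integrable_mulb _ _ _ _ M) => //.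
  exact: (measurableT_comp mb measurable_fst).
apply: (@integrable_mulb _ _ _ _ 1).
- exact: measurable_indic.
- by move=> z; rewrite indicE; case: (_ \in _); rewrite ?normr1 ?normr0.
- exact: integrable_snd muI_fin wi'.
Qed.

Let indA t s : (\1_A (t, s) : R) = \1_(`]-oo, t[%classic : set R) s.
Proof. by rewrite !indicE; congr (_%:R); apply/idP/idP; rewrite !inE/= in_itv. Qed.

Let F1 b t : \int[muI]_s F b (t, s) = prim w' t * b t.
Proof.
rewrite /prim -RintegralZr//.
  by apply: eq_Rintegral => s _; rewrite /F indA/= [w' s * _]mulrC.
under eq_fun do rewrite /= mulrC.
apply: (@integrable_mulb _ _ _ _ 1) => //.
by move=> z; rewrite indicE; case: (_ \in _); rewrite ?normr1 ?normr0.
Qed.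

Lemma integrable_prim : muI.-integrable setT (EFin \o prim w').
Proof.
have i1 : (muI \x muI)%E.-integrable setT (EFin \o F (cst 1)).
  by apply: (@integrable_F _ 1) => // x; rewrite normr1.
have := integrable_Rintegral1 i1.
by under eq_fun do rewrite /= F1 mulr1.
Qed.

(* Fubini: integrating [prim w'] by parts against [b]. *)
Lemma prim_parts (b : R -> R) (M : R) : continuous b ->
  (forall x, `|b x| <= M) -> (forall x, ~~ (0 < x < T) -> b x = 0) ->
  leb.-integrable setT (EFin \o b) -> \int[leb]_x b x = 0 ->
  \int[muI]_t (prim w' t * b t) = - \int[muI]_t (w' t * primNy b t).
Proof.
move=> cb bM b0 bi b_int0.
have mb : measurable_fun setT b by exact: continuous_measurable_fun.
have i1 := integrable_F mb bM.
have i2 s : muI.-integrable setT (EFin \o (fun t => (\1_A (t, s) : R) * b t)).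
  apply: (@integrable_bounded _ _ _ _ M _ muI_fin).
    apply: measurable_funM => //; apply: (measurableT_comp (measurable_indic mA)).
    exact: measurable_pair2.
  move=> t; rewrite indicE; case: (_ \in _); rewrite ?mul1r// mul0r normr0.
  by apply: le_trans (bM t).
have E s : \int[muI]_t F b (t, s) = - (w' s * primNy b s).
  rewrite /F/=; under eq_Rintegral do rewrite -mulrA.
  rewrite RintegralZl// -mulrN; congr (_ * _).
  rewrite Rintegral_muI_supp; last 2 first.
  - by have /measurable_EFinP := measurable_int _ (i2 s).
  - by move=> x /b0 ->; rewrite mulr0.
  (* As [b] has mean zero, its integral over times after s is minus its integral up to s. *)
  apply/eqP; rewrite -addr_eq0 -b_int0 /primNy [X in _ + X]Rintegral_mkcond.
  rewrite -RintegralD//; last 2 first.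
  - apply: (le_integrable _ _ _ bi) => //.
      apply/measurable_EFinP; apply: measurable_funM => //.
      apply: (measurableT_comp (measurable_indic mA)); exact: measurable_pair2.
    move=> t _; rewrite /= lee_fin indicE; case: (_ \in _); rewrite ?mul1r//.
    by rewrite mul0r normr0.
  - rewrite -restrict_EFin; apply/(integrable_mkcond _ _).1 => //.
    by apply: integrableS bi.
  apply/eqP/eq_Rintegral => x _; rewrite indicE patchE; have [sx|xs] := ltP s x.
    have -> : (x, s) \in A by apply/mem_set.
    rewrite mul1r memNset ?addr0//= in_itv/=; apply/negP.
    by rewrite -ltNge.
  have -> : (x, s) \in A = false.
    by apply/negbTE; rewrite notin_setE /A/=; apply/negP; rewrite -leNgt.
  by rewrite mul0r add0r mem_set//= in_itv.
have -> : \int[muI]_t (prim w' t * b t) = \int[muI]_t \int[muI]_s F b (t, s).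
  by apply: eq_Rintegral => t _; rewrite F1.
rewrite -Rfubini1// Rfubini2//.
have i3 := integrable_Rintegral2 i1.
pose G s := \int[muI]_t F b (t, s).
have -> : \int[muI]_t (w' t * primNy b t) = \int[muI]_s (-1 * G s).
  by apply: eq_Rintegral => s _; rewrite /G E mulN1r opprK.
by rewrite (RintegralZl (-1) measurableT i3) mulN1r opprK.
Qed.

End scalar_muI.

(** * The fundamental lemma of du Bois-Reymond *)

(** Differentiability at x extends the value K from the rationals to x by continuity, so the
    difference quotients at rational points near x vanish, which excludes a nonzero derivative. *)
Lemma derive1_rat_locally_cst (R : realType) (F : R -> R) (a b K x : R) :
  a < x < b -> (forall q : rat, a < ratr q < b -> F (ratr q) = K) ->
  derivable F x 1 -> derive1 F x = 0.
Proof.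
move=> /andP[ax xb] FK dF.
have cF : {for x, continuous F}.
  exact/differentiable_continuous/derivable1_diffP.
have rat_near (P : R -> Prop) : (\forall y \near x, P y) ->
    exists q : rat, [/\ x < ratr q, a < ratr q < b & P (ratr q)].
  move=> /nbhs_ballP[e/= e0 eP].
  have : x < Num.min b (x + e) by rewrite lt_min xb ltrDl.
  move=> /rat_in_itvoo[q]; rewrite in_itv/= lt_min => /andP[xq /andP[qb qe]].
  exists q; split => //; first by rewrite (lt_trans ax xq).
  apply: eP; rewrite -ball_normE/= distrC gtr0_norm ?subr_gt0//.
  by rewrite ltrBlDl.
have Fx : F x = K.
  apply: contrapT => /eqP FxK.
  have : \forall y \near x, F y - K != 0.
    have : F y - K @[y --> x] --> F x - K by apply: cvgB => //; exact: cvg_cst.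
    by move/cvgr_neq0; apply; rewrite subr_eq0.
  move=> /rat_near[q [_ qab]]; by rewrite FK// subrr eqxx.
have dx := derivableP dF; rewrite derive1E.
apply: contrapT => /eqP L0.
have : h^-1 *: (F (h *: 1 + x) - F x) @[h --> 0^'] --> 'D_1 F x by exact: dF.
move=> c.
have : \forall h \near 0^', h^-1 *: (F (h *: 1 + x) - F x) != 0.
  exact: cvgr_neq0 c L0.
rewrite near_withinE => n0.
have : \forall y \near x, y - x != 0 -> (y - x)^-1 *: (F ((y - x) *: 1 + x) - F x) != 0.
  have sh : (y - x) @[y --> x] --> (0 : R).
    by rewrite -(subrr x); apply: cvgB; [exact: cvg_id|exact: cvg_cst].
  exact: sh n0.
move=> /rat_near[q [xq qab]].
rewrite [_ *: 1]mulr1 subrK FK// Fx subrr scaler0 eqxx.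
by rewrite subr_eq0 gt_eqF// => /(_ isT).
Qed.

Section scalar_dbr.
Context (R : realType) (T : R).
Hypothesis T0 : 0 < T.
Local Notation leb := (@lebesgue_measure R).
Local Notation muI := (@muI R T).
Variables w w' : measurableTypeR R -> R.
Hypothesis wi : muI.-integrable setT (EFin \o w).
Hypothesis wi' : muI.-integrable setT (EFin \o w').
(* Countably many test functions suffice, so that the exceptional null set of
   points of Omega can be chosen independently of the test function. *)
Hypothesis H : forall (s t p q : rat) (n : nat),
  0 < ratr s :> R -> ratr s < ratr t :> R -> ratr t < T ->
  0 < ratr p :> R -> ratr p < ratr q :> R -> ratr q < T ->
  \int[muI]_x (w x * bump0 (ratr s) (ratr t) (ratr p) (ratr q) n x) =
  - \int[muI]_x (w' x * test_fun (ratr s) (ratr t) (ratr p) (ratr q) n x).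

Let e (x : measurableTypeR R) := w x - prim T w' x.

Let ei : muI.-integrable setT (EFin \o e).
Proof. exact: (integrableB measurableT wi (integrable_prim T0 wi')). Qed.

Let me_ : measurable_fun setT e.
Proof. by have /measurable_EFinP := measurable_int _ ei. Qed.

Let ebump (s t : R) n : muI.-integrable setT (EFin \o (fun x => e x * bumpn s t n x)).
Proof.
apply: (@integrable_mulb _ _ _ _ 1) => //; first exact: measurable_bumpn.
by move=> x; exact: bumpn_norm.
Qed.

Lemma bump0_norm (s t p q : R) n x :
  `|bump0 s t p q n x| <= `|bumpI p q n| + `|bumpI s t n|.
Proof.
apply: le_trans (ler_normB _ _) _; rewrite !normrM; apply: lerD.
  by rewrite ler_piMr// bumpn_norm.
by rewrite ler_piMr// bumpn_norm.
Qed.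

Let int_e_bump0 (s t p q : rat) n :
  0 < ratr s :> R -> ratr s < ratr t :> R -> ratr t < T ->
  0 < ratr p :> R -> ratr p < ratr q :> R -> ratr q < T ->
  \int[muI]_x (e x * bump0 (ratr s) (ratr t) (ratr p) (ratr q) n x) = 0.
Proof.
move=> s0 st tT p0 pq qT.
set b := bump0 _ _ _ _ _.
have cb : continuous b by apply: smooth_continuous; exact: smooth_bump0.
have mb : measurable_fun setT b by exact: continuous_measurable_fun.
have bM := bump0_norm (ratr s) (ratr t) (ratr p) (ratr q) n.
have b0 x : ~~ (0 < x < T) -> b x = 0.
  move=> xT; rewrite /b bump0_out//; apply: contra xT => /andP[mx xM].
  by rewrite (lt_le_trans _ mx) ?lt_min ?s0//= (le_lt_trans xM)// gt_max tT.
under eq_Rintegral do rewrite mulrBl.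
rewrite (RintegralB measurableT).
- rewrite (prim_parts T0 wi' cb bM b0).
  + by rewrite /b H// subrr.
  + exact: integrable_bump0.
  + exact: bump0_int0.
- by apply: integrable_mulb wi; [exact: mb|exact: bM].
- by apply: integrable_mulb (integrable_prim T0 wi'); [exact: mb|exact: bM].
Qed.

Let I (s t : R) : R := \int[muI]_x (e x * (\1_(`]s, t[%classic : set R) x : R)).

Let cvg_ebump (s t : R) : \int[muI]_x (e x * bumpn s t n x) @[n --> \oo] --> I s t.
Proof.
apply: (@cvg_Rintegral_dominated _ _ _ muI (fun n x => e x * bumpn s t n x) _
  (fun x => `|e x|)).
- by move=> n; apply: measurable_funM => //; exact: measurable_bumpn.
- by apply: measurable_funM.
- by move=> x; apply: cvgM; [exact: cvg_cst|exact: cvg_bumpn].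
- exact: (integrable_abse ei).
- by move=> n x; rewrite normrM ler_piMr// bumpn_norm.
Qed.

(** The limit n to infinity in [int_e_bump0]; it says that [e] has the same mean over any two
    admissible rational intervals. *)
Let I_prop (s t p q : rat) :
  0 < ratr s :> R -> ratr s < ratr t :> R -> ratr t < T ->
  0 < ratr p :> R -> ratr p < ratr q :> R -> ratr q < T ->
  (ratr q - ratr p) * I (ratr s) (ratr t) = (ratr t - ratr s) * I (ratr p) (ratr q).
Proof.
move=> s0 st tT p0 pq qT.
pose a1 n := bumpI (ratr p) (ratr q) n *
  \int[muI]_x (e x * bumpn (ratr s) (ratr t) n x).
pose a2 n := bumpI (ratr s) (ratr t) n *
  \int[muI]_x (e x * bumpn (ratr p) (ratr q) n x).
have c1 : a1 n @[n --> \oo] --> (ratr q - ratr p) * I (ratr s) (ratr t).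
  by apply: cvgM; [exact: cvg_bumpI|exact: cvg_ebump].
have c2 : a2 n @[n --> \oo] --> (ratr t - ratr s) * I (ratr p) (ratr q).
  by apply: cvgM; [exact: cvg_bumpI|exact: cvg_ebump].
suff E : a1 = a2.
  by rewrite -(cvg_lim (@Rhausdorff R) c1) -(cvg_lim (@Rhausdorff R) c2) E.
apply/funext => n; rewrite /a1 /a2.
have := int_e_bump0 n s0 st tT p0 pq qT.
rewrite /bump0; under eq_Rintegral do rewrite mulrBr.
rewrite (RintegralB measurableT); last 2 first.
- under eq_fun do rewrite /= mulrCA; exact: (integrableZl measurableT _ (ebump _ _ _)).
- under eq_fun do rewrite /= mulrCA; exact: (integrableZl measurableT _ (ebump _ _ _)).
under eq_Rintegral do rewrite mulrCA.
rewrite (RintegralZl _ measurableT (ebump _ _ _)).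
under [X in _ - X = _ -> _]eq_Rintegral do rewrite mulrCA.
rewrite (RintegralZl _ measurableT (ebump _ _ _)).
by move=> /eqP; rewrite subr_eq0 => /eqP.
Qed.

(** All rational interval means of e = w - [prim T w'] equal one constant c. The primitive of e - c
    therefore takes a single value at the rationals in ]0, T[, and since it is differentiable almost
    everywhere with derivative e - c, that derivative vanishes. *)
Theorem scalar_dbr : exists c, {ae muI, forall t, w t = c + prim T w' t}.
Proof.
have [q0] := rat_in_itvoo T0; rewrite in_itv/= => /andP[q00 q0T].
have [p0] := rat_in_itvoo q00; rewrite in_itv/= => /andP[p00 p0q0].
pose c := I (ratr p0) (ratr q0) / (ratr q0 - ratr p0).
exists c.
(* Extension of e - c by zero, so that the differentiation theorem applies to its primitive on the
   whole line. *)
pose f (x : R) := (\1_(`]0, T[%classic : set R) x : R) * (e x - c).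
have ci : muI.-integrable setT (EFin \o (fun x => e x - c)).
  have cci : muI.-integrable setT (EFin \o (fun=> c)).
    by apply: (@integrable_bounded _ _ _ _ `|c| _ (muI_fin T0)).
  exact: (integrableB measurableT ei cci).
have fE : f = (fun x => e x - c) \_ `]0, T[.
  apply/funext => x; rewrite /f patchE indicE.
  by case: (x \in _); rewrite ?mul1r ?mul0r.
have fi : leb.-integrable setT (EFin \o f).
  rewrite fE -restrict_EFin; apply/(integrable_mkcond _ _).1 => //.
  exact: (integrable_restr _ _ (measurable_int _ ci)).1 ci.
pose F x := \int[leb]_(y in `]-oo, x]) f y.
have FK (q : rat) : (0 : R) < ratr q < T -> F (ratr q) = F (ratr p0).
  suff W (s t : rat) : 0 < ratr s :> R -> ratr s < ratr t :> R -> ratr t < T ->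
      F (ratr t) = F (ratr s).
    move=> /andP[q1 q2]; have [?|?|->//] := ltgtP (ratr q : R) (ratr p0).
      by apply/esym/W => //; apply: lt_trans q0T.
    exact: W.
  move=> s0 st tT; apply/eqP; rewrite -subr_eq0; apply/eqP.
  rewrite /F Rintegral_itvB//; last 2 first.
  - by apply: integrableS fi.
  - by rewrite bnd_simp ltW.
  have := I_prop s0 st tT p00 p0q0 q0T.
  have d0 : ratr q0 - ratr p0 != 0 :> R by rewrite subr_eq0 gt_eqF.
  move=> h; have {}h : I (ratr s) (ratr t) = (ratr t - ratr s) * c.
    by rewrite /c mulrA -h mulrAC divff// mul1r.
  rewrite -Rintegral_itv_bndo_bndc; last by apply: integrableS fi.
  rewrite Rintegral_mkcond.
  rewrite (_ : \int[leb]_x _ =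
      \int[muI]_x ((e x - c) * (\1_(`]ratr s, ratr t[%classic : set R) x : R))).
    under eq_Rintegral do rewrite mulrBl.
    rewrite (RintegralB measurableT); last 2 first.
    - apply: (@integrable_mulb _ _ _ _ 1) => // x.
      by rewrite indicE; case: (_ \in _); rewrite ?normr1 ?normr0.
    - apply: (@integrable_bounded _ _ _ _ `|c| _ (muI_fin T0)) => // x.
        exact: measurable_funM.
      rewrite indicE; case: (_ \in _); rewrite ?mulr1// mulr0 normr0//.
    rewrite -/(I _ _) h.
    rewrite (RintegralZl c measurableT); last first.
      by apply: (@integrable_bounded _ _ _ _ 1 _ (muI_fin T0)) => // x;
        rewrite indicE; case: (_ \in _); rewrite ?normr1 ?normr0.
    rewrite Rintegral_muI_supp//; last first.
      move=> x xT; rewrite indicE memNset//= in_itv/= => /andP[sx xt].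
      by move: xT; rewrite (lt_trans s0 sx) (lt_trans xt tT).
    rewrite /Rintegral integral_indic//= setIT lebesgue_measure_itv/= lte_fin st/=.
    by rewrite mulrC subrr.
  rewrite Rintegral_muI_supp; last 2 first.
  - apply: measurable_funM => //; exact: measurable_funB.
  - move=> x xT; rewrite indicE memNset//= ?mulr0// in_itv/= => /andP[sx xt].
    by move: xT; rewrite (lt_trans s0 sx) (lt_trans xt tT).
  apply: eq_Rintegral => x _; rewrite patchE indicE; case: ifPn => //= xst.
    rewrite /f indicE mem_set ?mul1r ?mulr1//=.
    move: xst; rewrite inE/= !in_itv/= => /andP[sx xt].
    by rewrite (lt_trans s0 sx) (lt_trans xt tT).
  by rewrite mulr0.
have Fder : {ae leb, forall x, derivable F x 1 /\ derive1 F x = f x}.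
  apply: FTC1Ny.
  - by move=> y; apply: integrableS fi.
  - by apply: open_integrable_locally => //; exact: openT.
apply: ae_restr; move: Fder; apply: filterS.
  exact: (ae_filter_ringOfSetsType leb).
move=> x [dF Fx].
rewrite /= in_itv/= => xT.
have := derive1_rat_locally_cst xT FK dF.
rewrite Fx /f indicE mem_set/= ?in_itv// mul1r /e => /eqP.
by rewrite subr_eq0 subr_eq => /eqP ->.
Qed.

End scalar_dbr.

(** * Estimates for primitives *)

Section prim_estimates.
Context (R : realType) (T : R).
Hypothesis T0 : 0 < T.
Local Notation leb := (@lebesgue_measure R).
Local Notation muI := (@muI R T).
Local Notation TI := (measurableTypeR R).
Implicit Types w : TI -> R.

Definition ind (A : set TI) (t : TI) : R := \1_A t.

Lemma ind_ge0 A t : 0 <= ind A t.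
Proof. by rewrite /ind indicE ler0n. Qed.

Lemma ind_norm A t : `|ind A t| <= 1.
Proof. by rewrite /ind indicE; case: (_ \in _); rewrite ?normr1 ?normr0. Qed.

Lemma indM A t : ind A t * ind A t = ind A t.
Proof. by rewrite /ind indicE; case: (_ \in _); rewrite ?mulr1 ?mulr0. Qed.

Lemma indT (A : set TI) t : A t -> ind A t = 1.
Proof. by move=> At; rewrite /ind indicE mem_set. Qed.

Lemma indF (A : set TI) t : ~ A t -> ind A t = 0.
Proof. by move=> At; rewrite /ind indicE memNset. Qed.

Lemma measurable_ind (A : set TI) : measurable A -> measurable_fun setT (ind A).
Proof. by move=> mA; exact: measurable_indic. Qed.

Lemma Rintegral_ind_le (a b : R) (b0 b1 : bool) : a <= b ->
  \int[muI]_t ind [set` Interval (BSide b0 a) (BSide b1 b)] t <= b - a.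
Proof.
move=> ab; rewrite /ind /Rintegral integral_indic//= setIT.
set m := (X in fine X).
have mle : (m <= (b - a)%:E)%E.
  have : (leb [set` Interval (BSide b0 a) (BSide b1 b)] <= (b - a)%:E)%E.
    rewrite lebesgue_measure_itv/= lte_fin; case: ltP => //= ba.
    by rewrite lee_fin subr_ge0.
  apply: le_trans; apply: le_measure; rewrite ?inE//; exact: measurableI.
rewrite -lee_fin fineK// ge0_fin_numE ?measure_ge0//.
by apply: le_lt_trans mle _; rewrite ltry.
Qed.

Lemma prim_diff w (a b : R) : a <= b -> muI.-integrable setT (EFin \o w) ->
  prim T w b - prim T w a = \int[muI]_s (ind `[a, b[%classic s * w s).
Proof.
move=> ab wi; have indi (A : set TI) : measurable A ->
    muI.-integrable setT (EFin \o (fun s => ind A s * w s)).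
  move=> mA; under eq_fun do rewrite /= mulrC.
  by apply: (@integrable_mulb _ _ _ _ 1) wi; [exact: measurable_ind|exact: ind_norm].
rewrite /prim -(RintegralB measurableT); [|exact: indi|exact: indi].
apply: eq_Rintegral => s _; rewrite -mulrBl -/(ind _ _) -/(ind `]-oo, a[%classic _).
congr (_ * _); have [sa|as_] := ltP s a.
  rewrite (@indT `]-oo, b[%classic) ?(@indT `]-oo, a[%classic) ?subrr ?indF//=.
  - by rewrite in_itv/= leNgt sa.
  - by rewrite in_itv/= (lt_le_trans sa ab).
rewrite [X in _ - X]indF ?subr0; last by rewrite /= in_itv/= ltNge as_.
rewrite /ind !indicE.
suff -> : (s \in `]-oo, b[%classic) = (s \in `[a, b[%classic) by [].
by apply/idP/idP; rewrite !inE/= !in_itv/= as_.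
Qed.

Lemma Lfun2_ind w (A : set TI) : measurable A -> w \in Lfun muI 2%:E ->
  (fun t => ind A t * w t) \in Lfun muI 2%:E.
Proof.
move=> mA; apply: (@Lfun2_mulbounded _ _ _ _ 1); first exact: measurable_ind.
exact: ind_norm.
Qed.

Lemma ind_Lfun2 (A : set TI) : measurable A -> ind A \in Lfun muI 2%:E.
Proof.
move=> mA; apply/Lfun2P; split; first exact: measurable_ind.
apply: (@integrable_bounded _ _ _ _ 1 _ (muI_fin T0)).
  by apply: measurable_funX; exact: measurable_ind.
by move=> x; rewrite expr2 indM; exact: ind_norm.
Qed.

Lemma Lfun2_integrable w : w \in Lfun muI 2%:E -> muI.-integrable setT (EFin \o w).
Proof.
move=> wL; apply/Lfun1_integrable; apply: Lfun_subset12 wL.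
by rewrite ge0_fin_numE// muI_fin.
Qed.

Lemma Rintegral_ind_sqr_le w (a b : R) (b0 b1 : bool) : a <= b ->
  w \in Lfun muI 2%:E ->
  (\int[muI]_s (ind [set` Interval (BSide b0 a) (BSide b1 b)] s * w s)) ^+ 2 <=
  (b - a) * \int[muI]_s (ind [set` Interval (BSide b0 a) (BSide b1 b)] s * w s ^+ 2).
Proof.
move=> ab wL; have : measurable ([set` Interval (BSide b0 a) (BSide b1 b)] : set TI).
  exact: measurable_itv.
set A := [set` _] => mA.
have AL := ind_Lfun2 mA; have AwL := Lfun2_ind mA wL.
have h := ip_CS AL AwL.
have E1 : ip muI (ind A) (fun t => ind A t * w t) = \int[muI]_s (ind A s * w s).
  by apply: eq_Rintegral => s _; rewrite mulrA indM.
have E2 : ip muI (fun t => ind A t * w t) (fun t => ind A t * w t) =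
    \int[muI]_s (ind A s * w s ^+ 2).
  by apply: eq_Rintegral => s _; rewrite mulrACA indM expr2.
rewrite E1 E2 in h; rewrite -real_normK ?num_real//.
apply: (@le_trans _ _ ((Num.sqrt (ip muI (ind A) (ind A)) *
    Num.sqrt (\int[muI]_s (ind A s * w s ^+ 2))) ^+ 2)).
  by rewrite lerXn2r ?nnegrE// mulr_ge0 ?sqrtr_ge0.
rewrite exprMn !sqr_sqrtr ?ip_ge0//; last first.
  by apply: Rintegral_ge0 => x _; rewrite mulr_ge0 ?ind_ge0 ?sqr_ge0.
apply: ler_wpM2r.
  by apply: Rintegral_ge0 => x _; rewrite mulr_ge0 ?ind_ge0 ?sqr_ge0.
rewrite /ip; under eq_Rintegral do rewrite indM.
exact: Rintegral_ind_le.
Qed.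

Lemma integrable_ind_sqr w (A : set TI) : measurable A -> w \in Lfun muI 2%:E ->
  muI.-integrable setT (EFin \o (fun s => ind A s * w s ^+ 2)).
Proof.
move=> mA wL; have := integrable_ip (Lfun2_ind mA wL) (Lfun2_ind mA wL).
by under eq_fun do rewrite /= mulrACA indM -expr2.
Qed.

(** Cauchy-Schwarz over [a, b[, then enlargement of the interval down to c, so that the bound no
    longer depends on a. The flag [b0] says whether c itself belongs to the larger interval. *)
Lemma prim_sqr_le w (a b c : R) (b0 : bool) : c <= a -> (b0 || (c < a)) -> a <= b ->
  w \in Lfun muI 2%:E ->
  (prim T w b - prim T w a) ^+ 2 <=
  (b - c) * \int[muI]_s (ind [set` Interval (BSide b0 c) (BRight b)] s * w s ^+ 2).
Proof.
move=> ca cab ab wL; rewrite prim_diff//; last exact: Lfun2_integrable.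
apply: le_trans (Rintegral_ind_sqr_le _ _ ab wL) _.
have I0 (A : set TI) : 0 <= \int[muI]_s (ind A s * w s ^+ 2).
  by apply: Rintegral_ge0 => x _; rewrite mulr_ge0 ?ind_ge0 ?sqr_ge0.
apply: (@le_trans _ _ ((b - c) * \int[muI]_s (ind `[a, b[%classic s * w s ^+ 2))).
  by apply: ler_wpM2r => //; rewrite lerB.
apply: ler_wpM2l; first by rewrite subr_ge0 (le_trans ca).
apply: le_Rintegral => //; try exact: integrable_ind_sqr.
move=> s _; apply: ler_wpM2r; first exact: sqr_ge0.
rewrite /ind !indicE ler_nat; case: (boolP (s \in `[a, b[%classic)) => //.
rewrite inE/= in_itv/= => /andP[as_ sb]; rewrite mem_set//= in_itv/=.
rewrite (ltW sb) andbT; case: b0 cab => /=; first by rewrite (le_trans ca as_).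
by move=> /lt_le_trans -> //.
Qed.

Lemma ae_muI_dense (P : TI -> Prop) (s t : R) : 0 <= s -> s < t -> t <= T ->
  {ae muI, forall x, P x} -> exists2 x : R, s < x < t & P x.
Proof.
move=> s0 st tT [A [mA A0 PA]]; apply: contrapT => H.
have sub : `]s, t[%classic `<=` A.
  move=> x /=; rewrite in_itv/= => sxt; apply: PA => /= Px.
  by apply: H; exists x.
have : (muI `]s, t[%classic <= muI A)%E by apply: le_measure; rewrite ?inE.
rewrite A0 /Defs.muI/= /restr_measure /mrestr setIidl; last first.
  move=> x /=; rewrite !in_itv/= => /andP[sx xt].
  by rewrite (le_lt_trans s0 sx) (lt_le_trans xt tT).
by rewrite lebesgue_measure_itv/= lte_fin st lee_fin leNgt subr_gt0 st.
Qed.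

Lemma prim_le0 w : muI.-integrable setT (EFin \o w) -> prim T w 0 = 0.
Proof.
move=> wi; have mw : measurable_fun setT w.
  by have /measurable_EFinP := measurable_int _ wi.
rewrite /prim Rintegral_restr; last by apply: measurable_funM => //.
rewrite Rintegral_mkcond (_ : (fun _ => _) \_ _ = cst 0) ?Rintegral_cst ?mul0r//.
apply/funext => x; rewrite patchE; case: ifPn => //.
rewrite inE/= in_itv/= => /andP[x0 _]; rewrite indicE memNset ?mul0r//=.
by rewrite in_itv/= ltNge (ltW x0).
Qed.

Lemma prim_continuous w (t e : R) : 0 < e -> w \in Lfun muI 2%:E ->
  exists2 h, 0 < h & forall s, `|s - t| <= h -> `|prim T w s - prim T w t| <= e.
Proof.
move=> e0 wL; set K := ip muI w w.
have K0 : 0 <= K by exact: ip_ge0.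
(* A primitive of an L^2 function is Hoelder continuous of order 1/2 with constant sqrt K; the 1
   covers K = 0. *)
exists (e ^+ 2 / (K + 1)); first by rewrite divr_gt0 ?exprn_gt0// ltr_wpDl.
have main (a b : R) : a <= b -> b - a <= e ^+ 2 / (K + 1) ->
    `|prim T w b - prim T w a| <= e.
  move=> ab abh; have e0' := ltW e0.
  rewrite -ler_sqr ?nnegrE// real_normK ?num_real//.
  apply: le_trans (@prim_sqr_le w a b a true (lexx a) isT ab wL) _.
  apply: (@le_trans _ _ (e ^+ 2 / (K + 1) * K)); last first.
    rewrite mulrAC ler_pdivrMr ?ltr_wpDl// ler_wpM2l ?sqr_ge0//.
    by rewrite lerDl.
  apply: ler_pM => //.
  - by rewrite subr_ge0.
  - by apply: Rintegral_ge0 => x _; rewrite mulr_ge0 ?ind_ge0 ?sqr_ge0.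
  - apply: le_Rintegral => //; first exact: integrable_ind_sqr.
      exact: integrable_ip.
    move=> s _; rewrite -expr2 ler_piMl ?sqr_ge0//.
    exact: le_trans (ler_norm _) (ind_norm _ _).
move=> s sh; have [st|ts] := leP s t.
  by rewrite distrC; apply: main => //; move: sh; rewrite ler0_norm ?subr_le0// opprB.
by apply: main; [exact: ltW|move: sh; rewrite gtr0_norm ?subr_gt0].
Qed.

(** Both sides are continuous in t and agree at almost every, hence densely many, times. This gives
    equality at the nodes, which are single points, when one function is represented through two
    weak derivatives. *)
Lemma prim_rep_unique w1 w2 (c1 c2 : R) :
  w1 \in Lfun muI 2%:E -> w2 \in Lfun muI 2%:E ->
  {ae muI, forall t, c1 + prim T w1 t = c2 + prim T w2 t} ->
  forall t, 0 <= t <= T -> c1 + prim T w1 t = c2 + prim T w2 t.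
Proof.
move=> w1L w2L H t /andP[t0 tT].
apply/eqP; rewrite -subr_eq0 -normr_le0; apply/ler_addgt0Pl => e e0; rewrite addr0.
have e20 : 0 < e / 2 by rewrite divr_gt0.
have [h1 h10 H1] := prim_continuous t e20 w1L.
have [h2 h20 H2] := prim_continuous t e20 w2L.
pose h := Num.min h1 h2.
have h0 : 0 < h by rewrite lt_min h10.
(* A good time near t is taken to the right of t, except at t = T, where it is taken to the left. *)
have [s [sh sE]] : exists s, `|s - t| <= h /\ c1 + prim T w1 s = c2 + prim T w2 s.
  have [tT'|Tt] := ltP t T.
    have := @ae_muI_dense _ t (Num.min T (t + h)) t0 _ _ H.
    rewrite lt_min tT' ltrDl h0 ge_min lexx => /(_ isT isT)[s /andP[ts]].
    rewrite lt_min => /andP[sT sth] Es; exists s; split => //.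
    by rewrite gtr0_norm ?subr_gt0// lerBlDl ltW.
  have tE : t = T by apply/eqP; rewrite eq_le tT.
  have := @ae_muI_dense _ (Num.max 0 (t - h)) t _ _ _ H.
  rewrite le_max lexx gt_max gtrBl h0 tT tE T0 => /(_ isT isT isT)[s /andP[]].
  rewrite gt_max => /andP[_ ths] st Es; exists s; split => //.
  by rewrite ltr0_norm ?subr_lt0// opprB lerBlDl -lerBlDr ltW.
have {}H1 := H1 s (le_trans sh _); have {}H2 := H2 s (le_trans sh _).
have {}H1 : `|prim T w1 s - prim T w1 t| <= e / 2 by apply: H1; rewrite ge_min lexx.
have {}H2 : `|prim T w2 s - prim T w2 t| <= e / 2.
  by apply: H2; rewrite ge_min lexx orbT.
have -> : c1 + prim T w1 t - (c2 + prim T w2 t) =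
    (prim T w2 s - prim T w2 t) - (prim T w1 s - prim T w1 t) by lra.
by apply: le_trans (ler_normB _ _) _; lra.
Qed.

(** For t in ]a, b] the deviation from the value at b is an integral of w' over [t, b[, so its
    square is at most (b - a) K; integrating over t gives the second factor b - a. The anchor is the
    right end because that is the node compared with the discrete value. *)
Lemma prim_anchored w w' (c a b : R) : 0 <= a -> a <= b -> b <= T ->
  w \in Lfun muI 2%:E -> w' \in Lfun muI 2%:E ->
  {ae muI, forall t, w t = c + prim T w' t} ->
  \int[muI]_t (ind `]a, b]%classic t * (w t - (c + prim T w' b)) ^+ 2) <=
  (b - a) ^+ 2 * \int[muI]_t (ind `]a, b]%classic t * w' t ^+ 2).
Proof.
move=> a0 ab bT wL wL' H.
set K := \int[muI]_t (ind _ t * w' t ^+ 2).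
have K0 : 0 <= K by apply: Rintegral_ge0 => x _; rewrite mulr_ge0 ?ind_ge0 ?sqr_ge0.
have mAb : measurable (`]a, b]%classic : set TI) by [].
set A := `]a, b]%classic.
have mw := Lfun2_measurable wL.
apply: (@le_trans _ _ (\int[muI]_t (ind A t * ((b - a) * K)))); last first.
  rewrite RintegralZr//; last first.
    apply: (@integrable_bounded _ _ _ _ 1 _ (muI_fin T0)) (ind_norm A).
    exact: measurable_ind.
  rewrite expr2 -mulrA ler_wpM2r ?mulr_ge0 ?subr_ge0//.
  exact: Rintegral_ind_le.
rewrite /Rintegral fine_le//.
- apply: integrable_fin_num => //; apply: (integrable_ind_sqr mAb).
  apply: Lfun2B => //; rewrite (_ : (fun _ => _) = (fun t => (c + prim T w' b) * ind setT t)).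
    by apply: Lfun2Z; exact: ind_Lfun2.
  by apply/funext => t; rewrite indT// mulr1.
- apply: integrable_fin_num => //.
  apply: (@integrable_bounded _ _ _ _ ((b - a) * K) _ (muI_fin T0)).
    by apply: measurable_funM => //; exact: measurable_ind.
  move=> t; rewrite normrM [X in _ * X]ger0_norm ?mulr_ge0 ?subr_ge0//.
  by rewrite ler_piMl ?mulr_ge0 ?subr_ge0// ind_norm.
- apply: ae_ge0_le_integral => //.
  + by move=> t _; rewrite lee_fin mulr_ge0 ?ind_ge0 ?sqr_ge0.
  + apply/measurable_EFinP; apply: measurable_funM; first exact: measurable_ind.
    by apply: measurable_funX; exact: measurable_funB.
  + by move=> t _; rewrite lee_fin !mulr_ge0 ?ind_ge0 ?subr_ge0.
  + apply/measurable_EFinP; apply: measurable_funM => //; exact: measurable_ind.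
  + apply: filterS H => t wt _; rewrite lee_fin.
    have [At|At] := pselect (A t); last by rewrite indF// !mul0r.
    apply: ler_wpM2l; first exact: ind_ge0.
    move: At; rewrite /A/= in_itv/= => /andP[at_ tb].
    rewrite wt (_ : c + _ - _ = - (prim T w' b - prim T w' t)); last by ring.
    rewrite sqrrN.
    exact: (@prim_sqr_le w' t b a false (ltW at_) at_ tb wL').
Qed.

End prim_estimates.

(** * Borel sets of R^N *)

Section rV_measurability.
Context (R : realType).

Definition rV_grid N (k : nat) (z : 'rV[int]_N) : 'rV[R]_N :=
  \row_j ((z 0 j)%:~R / k.+1%:R).

Definition rV_cell N (k : nat) (x : 'rV[R]_N) : 'rV[int]_N :=
  \row_j Num.floor (x 0 j * k.+1%:R).

Lemma measurable_rV_cell N k (A : set 'rV[int]_N) :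
  measurable (@rV_cell N k @^-1` A).
Proof.
rewrite (_ : _ @^-1` A = \bigcup_(z in A) (@rV_cell N k @^-1` [set z])); last first.
  apply/seteqP; split => [x Ax|x [z Az /= xz]]; first by exists (rV_cell k x).
  by rewrite /preimage/= xz.
rewrite bigcup_mkcond; apply: countable_bigcupT_measurable => // z.
case: ifPn => // _.
rewrite (_ : _ @^-1` _ = \bigcap_(j in [set: 'I_N])
    ((fun x : 'rV[R]_N => x 0 j) @^-1`
      `[(z 0 j)%:~R / k.+1%:R, (z 0 j + 1)%:~R / k.+1%:R[)).
  apply: fin_bigcap_measurable => [|j _]; first exact: finite_finset.
  rewrite -[X in measurable X]setTI; exact: measurable_coord.
have k0 : 0 < k.+1%:R :> R by [].
apply/seteqP; split => [x /= <- j _|x /= H].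
  rewrite /= in_itv/= /rV_cell mxE ler_pdivrMr// ltr_pdivlMr//.
  exact: floor_itv.
apply/rowP => j; rewrite /rV_cell mxE; apply: floor_def.
have := H j I; rewrite /= in_itv/=.
by rewrite ler_pdivrMr// ltr_pdivlMr.
Qed.

Lemma cvg_rV_grid N (x : 'rV[R]_N) :
  rV_grid k (rV_cell k x) @[k --> \oo] --> x.
Proof.
apply/cvgrPdist_lt => e e0.
have /cvgr0_norm_lt/(_ _ e0)[n0 _ n0P] := @cvg_harmonic R.
exists n0 => // k nk; have := n0P _ nk; rewrite /harmonic/= ger0_norm ?invr_ge0// => ke.
rewrite /Num.norm/= mx_normrE; apply/bigmax_ltP; split => //= -[i j] _ /=.
rewrite !mxE ord1.
have k0 : 0 < k.+1%:R :> R by [].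
have /andP[f1 f2] := floor_itv (x 0 j * k.+1%:R).
rewrite ger0_norm; last by rewrite subr_ge0 ler_pdivrMr.
apply: lt_trans ke.
rewrite ltrBlDr -[X in _ < X + _]mul1r -mulrDl ltr_pdivlMr//.
by rewrite addrC; rewrite intrD in f2.
Qed.

(** The sigma-algebra is generated by the coordinates. A continuous function is the pointwise limit
    of its samples at the corners of cubes of side 1/(k+1); each sample factors through the
    countable set Z^N, so measurability of the cubes is enough. *)
Lemma continuous_measurable_rV N (f : 'rV[R]_N -> R) :
  continuous f -> measurable_fun setT f.
Proof.
move=> cf.
apply: (@measurable_fun_cvg _ _ _ _ (fun k x => f (rV_grid k (rV_cell k x)))).
  move=> k _ Y mY; rewrite setTI.
  rewrite [X in measurable X](_ : _ =
    @rV_cell N k @^-1` ((fun z => f (rV_grid k z)) @^-1` Y)) //.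
  exact: measurable_rV_cell.
move=> x _; have := @cvg_comp _ _ _ (fun k => rV_grid k (rV_cell k x)) f _ _ _
  (@cvg_rV_grid N x) (cf x).
by [].
Qed.

Definition rV_box N (M : R) : set 'rV[R]_N := [set x | forall j, `|x 0 j| <= M].

Lemma measurable_rV_box N M : measurable (@rV_box N M).
Proof.
rewrite (_ : @rV_box N M = \bigcap_(j in [set: 'I_N])
    ((fun x : 'rV[R]_N => x 0 j) @^-1` `[- M, M])).
  apply: fin_bigcap_measurable => [|j _]; first exact: finite_finset.
  rewrite -[X in measurable X]setTI; exact: measurable_coord.
apply/seteqP; split => [x H j _|x H j] /=.
  by rewrite in_itv/= -ler_norml; exact: H.
by have := H j I; rewrite /= in_itv/= -ler_norml.
Qed.

Let consrV_l N (p : measurableTypeR R * 'rV[R]_N) (i : 'I_1) :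
  consrV p 0 (lshift N i : 'I_N.+1) = p.1.
Proof. by rewrite [LHS]row_mxEl mxE (ord1 i) eqxx mulr1n. Qed.

Let consrV_r N (p : measurableTypeR R * 'rV[R]_N) (j : 'I_N) :
  consrV p 0 (rshift 1 j : 'I_N.+1) = p.2 0 j.
Proof. by rewrite [LHS]row_mxEr. Qed.

Lemma lebesgue_rV_box N M : (lebesgue_rV R N (@rV_box N M) < +oo)%E.
Proof.
elim: N => [|N IH].
  by rewrite /= diracE; case: (_ \in _); rewrite ltry.
rewrite /= /cons_measure /pushforward.
rewrite (_ : @consrV R N @^-1` _ = `[- M, M]%classic `*` @rV_box N M).
  rewrite product_measure1E//; last exact: measurable_rV_box.
  rewrite lte_mul_pinfty ?measure_ge0//.
    rewrite ge0_fin_numE ?measure_ge0//.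
    change (lebesgue_measure ([set` `[(- M)%R, M]] : set R) < +oo)%E.
    rewrite lebesgue_measure_itv/=.
    by case: ifP => _; rewrite ?ltry// -EFinD ltry.
apply/seteqP; split => [[a v] /= H|[a v] /= [aM vM] j].
  split; last by move=> j; have := H (rshift 1 j : 'I_N.+1); rewrite consrV_r.
  rewrite /= in_itv/= -ler_norml.
  by have := H (lshift N (0 : 'I_1) : 'I_N.+1); rewrite consrV_l.
have [i ->|i ->] := split_ordP (j : 'I_(1 + N)).
  by rewrite consrV_l; move: aM; rewrite in_itv/= -ler_norml.
by rewrite consrV_r; exact: vM.
Qed.

End rV_measurability.

(** A bounded Omega lies in a box, and boxes have finite measure by induction on the dimension. *)
Lemma muO_fin (R : realType) N (Omega : polyhedral_domain R N) :
  (muO Omega setT < +oo)%E.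
Proof.
have [_ bO _] := domain_polyhedral Omega.
have [M [_ /(_ (M + 1))]] := bO; rewrite ltrDl => /(_ ltr01) H.
apply: le_lt_trans (lebesgue_rV_box N (M + 1)).
rewrite /muO/= /restr_measure /mrestr setTI.
apply: le_measure; rewrite ?inE; [exact: measurable_domain|exact: measurable_rV_box|].
move=> x Ox j; apply: le_trans (H x Ox); rewrite [leRHS]/Num.Def.normr/= mx_normrE.
exact: (le_bigmax _ (fun i => `|x i.1 i.2|) (0, j)).
Qed.

(** * The space H^1_0 *)

Section L2norm_lin.
Context d (T : measurableType d) (R : realType).
Variable mu : {measure set T -> \bar R}.
Implicit Types f g : T -> R.

Lemma Lfun2_lin (a : R) f g : f \in Lfun mu 2%:E -> g \in Lfun mu 2%:E ->
  (fun x => f x + a * g x) \in Lfun mu 2%:E.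
Proof. by move=> fL gL; exact: Lfun2D fL (Lfun2Z a gL). Qed.

Lemma L2norm_lin (a : R) f g : f \in Lfun mu 2%:E -> g \in Lfun mu 2%:E ->
  L2norm mu (fun x => f x + a * g x) <= L2norm mu f + `|a| * L2norm mu g.
Proof.
move=> fL gL; have agL := Lfun2Z a gL.
rewrite !L2normE//; last exact: Lfun2_lin.
apply: le_trans (ip_triangle fL agL) _; rewrite lerD2l.
rewrite ipZl// ipZr// mulrA -expr2 sqrtrM ?sqr_ge0// sqrtr_sqr//.
Qed.

Lemma ip_lin (a : R) f g h : f \in Lfun mu 2%:E -> g \in Lfun mu 2%:E ->
  h \in Lfun mu 2%:E -> ip mu (fun x => f x + a * g x) h = ip mu f h + a * ip mu g h.
Proof.
move=> fL gL hL; rewrite -ipZl// -ipDl//; exact: Lfun2Z.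
Qed.

End L2norm_lin.

Lemma supported_bounded (U : topologicalType) (R : realType) (f : U -> R)
    (K : set U) : continuous f -> compact K -> (forall x, ~ K x -> f x = 0) ->
  exists M, forall x, `|f x| <= M.
Proof.
move=> cf cK f0.
have : compact (f @` K).
  by apply: continuous_compact => //; exact: continuous_subspaceT.
move=> /compact_bounded[M [_ /(_ (M + 1))]]; rewrite ltrDl => /(_ ltr01) fM.
exists `|M + 1| => x.
have [Kx|/f0 ->] := pselect (K x); last by rewrite normr0.
by apply: le_trans (fM _ _) (ler_norm _); exists x.
Qed.

Lemma bounded_Lfun2 d (X : measurableType d) (R : realType)
    (mu : {sigma_finite_measure set X -> \bar R}) (f : X -> R) M :
  (mu setT < +oo)%E -> measurable_fun setT f -> (forall x, `|f x| <= M) ->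
  f \in Lfun mu 2%:E.
Proof.
move=> mufin mf fM; apply/Lfun2P; split => //.
apply: (@integrable_bounded _ _ _ _ (M ^+ 2) _ mufin).
  exact: measurable_funX.
by move=> x; rewrite normrX lerXn2r// nnegrE (le_trans _ (fM x)).
Qed.

Section Cc_infty_lin.
Context (R : realType) (N : nat).
Implicit Types w : 'rV[R]_N -> R.

Lemma partial_lin (a : R) w1 w2 i :
  (forall x, derivable w1 x (delta_mx 0 i)) ->
  (forall x, derivable w2 x (delta_mx 0 i)) ->
  (forall x, derivable (fun x => w1 x + a * w2 x) x (delta_mx 0 i)) /\
  partial i (fun x => w1 x + a * w2 x) = (fun x => partial i w1 x + a * partial i w2 x).
Proof.
move=> d1 d2.
have dZ x : derivable (fun y => a * w2 y) x (delta_mx 0 i) by apply: derivableZ (d2 x).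
split=> [x|]; first exact: derivableD (d1 x) (dZ x).
apply/funext => x; rewrite /partial (deriveD (d1 x) (dZ x)); congr (_ + _).
exact: deriveZ (d2 x).
Qed.

Lemma continuous_lin (a : R) w1 w2 : continuous w1 -> continuous w2 ->
  continuous (fun x => w1 x + a * w2 x).
Proof.
move=> c1 c2 x.
have h : a * w2 y @[y --> x] --> a * w2 x by exact: cvgM (cvg_cst a) (c2 x).
exact: cvgD (c1 x) h.
Qed.

Lemma Ck_lin k (a : R) w1 w2 : Ck k w1 -> Ck k w2 -> Ck k (fun x => w1 x + a * w2 x).
Proof.
elim: k w1 w2 => [|k IH] w1 w2 [c1 h1] [c2 h2].
  by split => //; exact: continuous_lin.
split=> [|i]; first exact: continuous_lin.
have [d1 C1] := h1 i; have [d2 C2] := h2 i.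
have [d12 ->] := partial_lin a d1 d2; split => //; exact: IH.
Qed.

Lemma Cc_infty_lin (a : R) (Omega : polyhedral_domain R N) w1 w2 :
  Cc_infty Omega w1 -> Cc_infty Omega w2 -> Cc_infty Omega (fun x => w1 x + a * w2 x).
Proof.
move=> [C1 [K1 S1]] [C2 [K2 S2]]; split=> [k|]; first exact: Ck_lin.
set S := closure _.
have sub : S `<=` closure [set x | w1 x != 0] `|` closure [set x | w2 x != 0].
  rewrite -closureU; apply: closure_subset => x /=.
  have [->|?] := eqVneq (w1 x) 0; last by left.
  by rewrite add0r mulf_eq0 negb_or => /andP[_ ?]; right.
split; last by move=> x /sub[]; [exact: S1|exact: S2].
by apply: subclosed_compact sub; [exact: closed_closure|exact: compactU].
Qed.

Lemma Cc_infty0 (Omega : polyhedral_domain R N) : Cc_infty Omega (cst 0).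
Proof.
split=> [k|].
  elim: k => [|k IH]; first by split => //; exact: cst_continuous.
  split=> [|i]; first exact: cst_continuous.
  split=> [x|]; first exact: derivable_cst.
  rewrite (_ : partial i _ = cst 0)//.
  by apply/funext => x; rewrite /partial derive_cst.
rewrite (_ : [set x | _] = set0); last by apply/seteqP; split => x //=; rewrite eqxx.
by rewrite closure0; split => //; exact: compact0.
Qed.

Lemma supported_Lfun2 (Omega : polyhedral_domain R N) w (K : set 'rV[R]_N) :
  continuous w -> compact K -> (forall x, ~ K x -> w x = 0) ->
  w \in Lfun (muO Omega) 2%:E.
Proof.
move=> cw cK w0; have [M wM] := supported_bounded cw cK w0.
exact: bounded_Lfun2 (muO_fin Omega) (continuous_measurable_rV cw) wM.
Qed.

Lemma Cc_infty_Lfun2 (Omega : polyhedral_domain R N) w :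
  Cc_infty Omega w -> w \in Lfun (muO Omega) 2%:E.
Proof.
move=> [Cw [cK _]]; apply: (supported_Lfun2 _ _ cK); first by have [] := Cw 0%N.
move=> x nx; apply: contrapT => /eqP wx; apply: nx; exact: subset_closure.
Qed.

Lemma partial_Lfun2 (Omega : polyhedral_domain R N) w i :
  Cc_infty Omega w -> partial i w \in Lfun (muO Omega) 2%:E.
Proof.
move=> [Cw [cK _]]; apply: (supported_Lfun2 _ _ cK).
  by have [_ /(_ i)[_ []]] := Cw 1%N.
move=> x nx; rewrite /partial -(derive_cst (0 : R) x (delta_mx 0 i)).
apply: near_eq_derive.
have : nbhs x (~` closure [set x | w x != 0]).
  by apply: open_nbhs_nbhs; split => //; apply: closed_openC; exact: closed_closure.
apply: filterS => y ny /=; apply: contrapT => /eqP wy; apply: ny.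
exact: subset_closure.
Qed.

End Cc_infty_lin.

Section H10_lin.
Context (R : realType) (N : nat) (Omega : polyhedral_domain R N).
Local Notation muO := (muO Omega).
Implicit Types (v : 'rV[R]_N -> R) (g : 'I_N -> 'rV[R]_N -> R).

Lemma cvg_L2norm_lin d (T : measurableType d) (mu : {measure set T -> \bar R})
    (a : R) (f h : (T -> R)^nat) (f0 h0 : T -> R) :
  (forall k, f k \in Lfun mu 2%:E) -> (forall k, h k \in Lfun mu 2%:E) ->
  f0 \in Lfun mu 2%:E -> h0 \in Lfun mu 2%:E ->
  L2norm mu (f k \- f0) @[k --> \oo] --> 0 ->
  L2norm mu (h k \- h0) @[k --> \oo] --> 0 ->
  L2norm mu ((fun x => f k x + a * h k x) \- (fun x => f0 x + a * h0 x))
    @[k --> \oo] --> 0.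
Proof.
move=> fL hL f0L h0L cf ch.
apply: (@squeeze_cvgr _ _ _ _ (cst 0)
    (fun k => L2norm mu (f k \- f0) + `|a| * L2norm mu (h k \- h0))).
- apply: nearW => k; apply/andP; split.
    by rewrite /L2norm fine_ge0// Lnorm_ge0.
  rewrite (_ : _ \- _ = (fun x => (f k \- f0) x + a * (h k \- h0) x)).
    by apply: L2norm_lin; exact: Lfun2B.
  by apply/funext => x /=; ring.
- exact: cvg_cst.
- have c : `|a| * L2norm mu (h k \- h0) @[k --> \oo] --> `|a| * 0.
    by apply: cvgM => //; exact: cvg_cst.
  by have := cvgD cf c; rewrite mulr0 addr0; exact.
Qed.

Lemma has_weak_grad_lin (a : R) v1 g1 v2 g2 :
  has_weak_grad Omega v1 g1 -> has_weak_grad Omega v2 g2 ->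
  has_weak_grad Omega (fun x => v1 x + a * v2 x) (fun i x => g1 i x + a * g2 i x).
Proof.
move=> [v1L g1L H1] [v2L g2L H2]; split.
- exact: Lfun2_lin.
- by move=> i; exact: Lfun2_lin.
- move=> w Cw i; have wL := Cc_infty_Lfun2 Cw; have pL := partial_Lfun2 i Cw.
  by rewrite !ip_lin// H1// H2// mulrN opprD.
Qed.

Lemma H10_grad_lin (a : R) v1 g1 v2 g2 :
  H10_grad Omega v1 g1 -> H10_grad Omega v2 g2 ->
  H10_grad Omega (fun x => v1 x + a * v2 x) (fun i x => g1 i x + a * g2 i x).
Proof.
move=> [W1 [w1 [C1 c1 p1]]] [W2 [w2 [C2 c2 p2]]]; split.
  exact: has_weak_grad_lin.
have [v1L g1L _] := W1; have [v2L g2L _] := W2.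
exists (fun k x => w1 k x + a * w2 k x); split.
- by move=> k; exact: Cc_infty_lin.
- by apply: cvg_L2norm_lin => // k; exact: Cc_infty_Lfun2.
- move=> i.
  have E k : partial i (fun x => w1 k x + a * w2 k x) =
      (fun x => partial i (w1 k) x + a * partial i (w2 k) x).
    have [/(_ 1%N)[_ /(_ i)[d1 _]] _] := C1 k.
    have [/(_ 1%N)[_ /(_ i)[d2 _]] _] := C2 k.
    by have [_] := partial_lin a d1 d2.
  under eq_fun do rewrite E.
  by apply: cvg_L2norm_lin => // k; exact: partial_Lfun2.
Qed.

Lemma H10_grad0 : H10_grad Omega (cst 0) (fun=> cst 0).
Proof.
split.
  split=> [|i|w Cw i]; [exact: Lfun2_cst0|exact: Lfun2_cst0|].
  by rewrite !ip0l oppr0.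
have E : cst 0 \- cst 0 = cst 0 :> ('rV[R]_N -> R).
  by apply/funext => x /=; rewrite subrr.
have N0 : L2norm muO (cst 0) = 0.
  by rewrite L2normE ?Lfun2_cst0// ip0l sqrtr0.
exists (fun=> cst 0); split.
- by move=> k; exact: Cc_infty0.
- by rewrite E N0; exact: cvg_cst.
- move=> i; rewrite (_ : partial i (cst 0) = cst 0).
    by rewrite E N0; exact: cvg_cst.
  by apply/funext => x; rewrite /partial derive_cst.
Qed.

Lemma H10_gradZ (a : R) v g : H10_grad Omega v g ->
  H10_grad Omega (fun x => a * v x) (fun i x => a * g i x).
Proof.
move=> H; have := H10_grad_lin a H10_grad0 H.
rewrite (_ : (fun x => cst 0 x + a * v x) = (fun x => a * v x)); last first.
  by apply/funext => x; rewrite add0r.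
rewrite (_ : (fun (i : 'I_N) x => (cst 0) x + a * g i x) = (fun i x => a * g i x))//.
by apply/funext => i; apply/funext => x; rewrite add0r.
Qed.

End H10_lin.

(** * Products of L^2 spaces *)

Section product_L2.
Context d1 d2 (T1 : measurableType d1) (T2 : measurableType d2) (R : realType).
Variable m1 : {sigma_finite_measure set T1 -> \bar R}.
Variable m2 : {sigma_finite_measure set T2 -> \bar R}.
Local Notation m12 := (m1 \x m2)%E.
Implicit Types (u v : T1 * T2 -> R) (a : T1 -> R) (b : T2 -> R).

Lemma measurable_slice1 u x : measurable_fun setT u ->
  measurable_fun setT (fun y => u (x, y)).
Proof. by move=> mu; exact: (measurableT_comp mu (measurable_pair1 x)). Qed.

Lemma measurable_slice2 u y : measurable_fun setT u ->
  measurable_fun setT (fun x => u (x, y)).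
Proof. by move=> mu; exact: (measurableT_comp mu (measurable_pair2 y)). Qed.

Lemma ae_slice1_Lfun2 u : u \in Lfun m12 2%:E ->
  {ae m1, forall x, (fun y => u (x, y)) \in Lfun m2 2%:E}.
Proof.
move=> /Lfun2P[mu iu]; apply: filterS (ae_integrable1 iu) => x ix.
by apply/Lfun2P; split => //; exact: measurable_slice1.
Qed.

Lemma ae_slice2_Lfun2 u : u \in Lfun m12 2%:E ->
  {ae m2, forall y, (fun x => u (x, y)) \in Lfun m1 2%:E}.
Proof.
move=> /Lfun2P[mu iu]; apply: filterS (ae_integrable2 iu) => y iy.
by apply/Lfun2P; split => //; exact: measurable_slice2.
Qed.

Lemma ip_fubini1 u v : u \in Lfun m12 2%:E -> v \in Lfun m12 2%:E ->
  ip m12 u v = \int[m1]_x ip m2 (fun y => u (x, y)) (fun y => v (x, y)).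
Proof. by move=> uL vL; rewrite /ip (Rfubini1 (integrable_ip uL vL)). Qed.

Lemma ip_fubini2 u v : u \in Lfun m12 2%:E -> v \in Lfun m12 2%:E ->
  ip m12 u v = \int[m2]_y ip m1 (fun x => u (x, y)) (fun x => v (x, y)).
Proof. by move=> uL vL; rewrite /ip (Rfubini2 (integrable_ip uL vL)). Qed.

Lemma integrable_ip1 u v : u \in Lfun m12 2%:E -> v \in Lfun m12 2%:E ->
  m1.-integrable setT (EFin \o (fun x => ip m2 (fun y => u (x, y)) (fun y => v (x, y)))).
Proof. by move=> uL vL; exact: integrable_Rintegral1 (integrable_ip uL vL). Qed.

Lemma integrable_ip2 u v : u \in Lfun m12 2%:E -> v \in Lfun m12 2%:E ->
  m2.-integrable setT (EFin \o (fun y => ip m1 (fun x => u (x, y)) (fun x => v (x, y)))).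
Proof. by move=> uL vL; exact: integrable_Rintegral2 (integrable_ip uL vL). Qed.

Definition tensor a b : T1 * T2 -> R := fun z => a z.1 * b z.2.

Lemma tensor_Lfun2 a b : a \in Lfun m1 2%:E -> b \in Lfun m2 2%:E ->
  tensor a b \in Lfun m12 2%:E.
Proof.
move=> aL bL; have [ma ia] := (Lfun2P _ _).1 aL; have [mb ib] := (Lfun2P _ _).1 bL.
have mt : measurable_fun setT (tensor a b).
  apply: measurable_funM; first exact: (measurableT_comp ma measurable_fst).
  exact: (measurableT_comp mb measurable_snd).
apply/Lfun2P; split => //.
have mt2 : measurable_fun setT (EFin \o (fun z => tensor a b z ^+ 2)).
  by apply/measurable_EFinP; exact: measurable_funX.
apply/(integrable12ltyP m1 m2 mt2).
have E x : (\int[m2]_y `|(EFin \o (fun z => (tensor a b z ^+ 2)%R)) (x, y)| =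
    (a x ^+ 2)%:E * \int[m2]_y (b y ^+ 2)%:E)%E.
  rewrite -ge0_integralZl//.
  - by apply: eq_integral => y _; rewrite -EFinM /= ger0_norm ?sqr_ge0// /tensor/= exprMn.
  - by apply/measurable_EFinP; exact: measurable_funX.
  - by move=> y _; rewrite lee_fin sqr_ge0.
  - by rewrite lee_fin sqr_ge0.
under eq_integral do rewrite E.
rewrite ge0_integralZr//.
- rewrite lte_mul_pinfty ?integral_ge0//.
  + by move=> x _; rewrite lee_fin sqr_ge0.
  + exact: (integrable_fin_num measurableT ia).
  + by rewrite -ge0_fin_numE ?integral_ge0//;
      [exact: (integrable_fin_num measurableT ib)|move=> x _; rewrite lee_fin sqr_ge0].
- by apply/measurable_EFinP; exact: measurable_funX.
- by move=> y _; rewrite lee_fin sqr_ge0.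
- by apply: integral_ge0 => y _; rewrite lee_fin sqr_ge0.
Qed.

Hypothesis m2fin : (m2 setT < +oo)%E.

Lemma cst_Lfun2 c : (fun=> c) \in Lfun m2 2%:E.
Proof.
apply/Lfun2P; split => //.
by apply: (@integrable_bounded _ _ _ _ (`|c| ^+ 2) _ m2fin) => // x; rewrite normrX.
Qed.

Lemma fst_Lfun2 a : a \in Lfun m1 2%:E -> (fun z => a z.1) \in Lfun m12 2%:E.
Proof.
move=> aL; have := tensor_Lfun2 aL (cst_Lfun2 1).
by rewrite (_ : tensor _ _ = (fun z => a z.1))//; apply/funext => z; rewrite /tensor mulr1.
Qed.

(** The Bochner integral of u(t) a(t) over time, as a function on the second factor. *)
Definition timeint u a : T2 -> R := fun y => \int[m1]_x (u (x, y) * a x).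

Lemma measurable_timeint u a : u \in Lfun m12 2%:E -> a \in Lfun m1 2%:E ->
  measurable_fun setT (timeint u a).
Proof.
by move=> uL aL; exact: measurable_Rintegral2 (integrable_ip uL (fst_Lfun2 aL)).
Qed.

Lemma ae_timeint_sqr u a : u \in Lfun m12 2%:E -> a \in Lfun m1 2%:E ->
  {ae m2, forall y, timeint u a y ^+ 2 <=
    ip m1 a a * ip m1 (fun x => u (x, y)) (fun x => u (x, y))}.
Proof.
move=> uL aL; apply: filterS (ae_slice2_Lfun2 uL) => y uyL.
have h := ip_CS uyL aL.
rewrite /timeint -[X in X ^+ 2]/(ip m1 (fun x => u (x, y)) a).
rewrite -real_normK ?num_real// mulrC.
rewrite -[X in _ <= X * _]sqr_sqrtr ?ip_ge0// -[X in _ <= _ * X]sqr_sqrtr ?ip_ge0//.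
by rewrite -exprMn lerXn2r// ?nnegrE ?mulr_ge0 ?sqrtr_ge0.
Qed.

Let timeint_bound u a : u \in Lfun m12 2%:E -> a \in Lfun m1 2%:E ->
  (\int[m2]_y (timeint u a y ^+ 2)%:E <= (ip m1 a a * ip m12 u u)%:E)%E.
Proof.
move=> uL aL.
have i2 := integrable_ip2 uL uL.
rewrite (ip_fubini2 uL uL) -(RintegralZl _ measurableT i2).
have iZ := integrableZl measurableT (ip m1 a a) i2.
rewrite /Rintegral fineK; last exact: (integrable_fin_num measurableT iZ).
apply: ae_ge0_le_integral => //.
- by move=> y _; rewrite lee_fin sqr_ge0.
- by apply/measurable_EFinP; apply: measurable_funX; exact: measurable_timeint.
- by move=> y _; rewrite lee_fin mulr_ge0 ?ip_ge0.
- exact: measurable_int iZ.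
- by apply: filterS (ae_timeint_sqr uL aL) => y h _; rewrite lee_fin.
Qed.

Lemma timeint_Lfun2 u a : u \in Lfun m12 2%:E -> a \in Lfun m1 2%:E ->
  timeint u a \in Lfun m2 2%:E.
Proof.
move=> uL aL; apply/Lfun2P; split; first exact: measurable_timeint.
apply/integrableP; split.
  by apply/measurable_EFinP; apply: measurable_funX; exact: measurable_timeint.
under eq_integral do rewrite /= ger0_norm ?sqr_ge0//.
by apply: le_lt_trans (timeint_bound uL aL) _; rewrite ltry.
Qed.

Lemma timeint_sqr_le u a : u \in Lfun m12 2%:E -> a \in Lfun m1 2%:E ->
  ip m2 (timeint u a) (timeint u a) <= ip m1 a a * ip m12 u u.
Proof.
move=> uL aL; have tL := timeint_Lfun2 uL aL.
rewrite -lee_fin -(EFin_ip tL tL); apply: le_trans (timeint_bound uL aL).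
by under eq_integral do rewrite -expr2.
Qed.

Lemma ip_tensor u a b : u \in Lfun m12 2%:E -> a \in Lfun m1 2%:E ->
  b \in Lfun m2 2%:E -> ip m12 u (tensor a b) = ip m2 (timeint u a) b.
Proof.
move=> uL aL bL; rewrite (ip_fubini2 uL (tensor_Lfun2 aL bL)).
have iT := integrable_ip2 uL (tensor_Lfun2 aL bL).
apply: ae_eq_Rintegral.
- by have /measurable_EFinP := measurable_int _ iT.
- apply: measurable_funM; first exact: measurable_timeint.
  exact: Lfun2_measurable bL.
- apply: filterS (ae_slice2_Lfun2 uL) => y uyL.
  rewrite /timeint -RintegralZr//; last exact: (integrable_ip uyL aL).
  by apply: eq_Rintegral => x _; rewrite /tensor/= mulrA.
Qed.

End product_L2.

(** * Representatives of H^1(0,T;L^2) *)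

Section representation.
Context (R : realType) (N : nat) (Omega : polyhedral_domain R N) (T : R).
Hypothesis T0 : 0 < T.
Local Notation TX := (measurableTypeR R * 'rV[R]_N)%type.
Local Notation muI := (@muI R T).
Local Notation muO := (muO Omega).
Local Notation muQ := (muQ Omega T).
Implicit Types v : TX -> R.

Let I_fin : (muI setT < +oo)%E := muI_fin T0.
Let O_fin : (muO setT < +oo)%E := muO_fin Omega.

(** Each test function has its own null set in Omega. The rational parameters are enumerated through
    [unpickle], so one null set serves all of them, and [scalar_dbr] applies at every remaining
    x. *)
Lemma is_dt_rep v v' : is_dt Omega T v v' ->
  {ae muO, forall x, exists c,
    {ae muI, forall t, v (t, x) = c + prim T (fun t => v' (t, x)) t}}.
Proof.
move=> [vL v'L H].
pose cond (i : rat * rat * rat * rat * nat) : bool :=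
  let: (s, t, p, q, n) := i in
  [&& 0 < ratr s :> R, ratr s < ratr t :> R, ratr t < T,
      0 < ratr p :> R, ratr p < ratr q :> R & ratr q < T].
pose P (i : rat * rat * rat * rat * nat) (x : 'rV[R]_N) : Prop :=
  let: (s, t, p, q, n) := i in
  \int[muI]_y (v (y, x) * bump0 (ratr s) (ratr t) (ratr p) (ratr q) n y) =
  - \int[muI]_y (v' (y, x) * test_fun (ratr s) (ratr t) (ratr p) (ratr q) n y).
have aeP k : {ae muO, forall x,
    if unpickle k is Some i then cond i -> P i x else True}.
  case: (unpickle k) => [[[[[s t] p] q] n]|]; last exact: aeW.
  have [/and5P[s0 st tT p0 /andP[pq qT]]|nc] := boolP (cond (s, t, p, q, n)); last first.
    exact: aeW.
  have := H _ (testfun_Cc n s0 st tT p0 pq qT).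
  by rewrite derive1_testfun//; apply: filterS => x /(_ Logic.I) + _.
have := ae_foralln aeP.
apply: filterS3 (ae_slice2_Lfun2 vL) (ae_slice2_Lfun2 v'L) => x vxL v'xL Hx.
apply: (scalar_dbr T0).
- exact: Lfun2_integrable.
- exact: Lfun2_integrable.
- move=> s t p q n s0 st tT p0 pq qT.
  have := Hx (pickle (s, t, p, q, n)); rewrite pickleK; apply.
  by rewrite /cond s0 st tT p0 pq qT.
Qed.

Lemma prim_bound (w : measurableTypeR R -> R) t : 0 <= t -> w \in Lfun muI 2%:E ->
  prim T w t ^+ 2 <= t * ip muI w w.
Proof.
move=> t0 wL; have := @prim_sqr_le _ _ T0 w 0 t 0 true (lexx 0) isT t0 wL.
rewrite (prim_le0 (Lfun2_integrable T0 wL)) !subr0 => /le_trans; apply.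
apply: ler_wpM2l => //; apply: le_Rintegral => //.
- exact: integrable_ind_sqr.
- exact: integrable_ip.
- move=> s _; rewrite -expr2 ler_piMl ?sqr_ge0//.
  exact: le_trans (ler_norm _) (ind_norm _ _).
Qed.

Let avg (h : R) (t : measurableTypeR R) : R := h^-1 * ind `]0, h[%classic t.

Let Rint_ind h : 0 < h -> h <= T -> \int[muI]_t ind `]0, h[%classic t = h.
Proof.
move=> h0 hT; rewrite Rintegral_muI_supp//; last 2 first.
- exact: measurable_ind.
- move=> x xT; rewrite indF//= in_itv/= => /andP[x0 xh].
  by move: xT; rewrite x0 (lt_le_trans xh hT).
by rewrite /Rintegral/ind integral_indic//= setIT lebesgue_measure_itv/= lte_fin h0 sube0.
Qed.

Let avgL h : avg h \in Lfun muI 2%:E.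
Proof. by apply: Lfun2Z; exact: ind_Lfun2. Qed.

Let ip_avg h : 0 < h -> h <= T -> ip muI (avg h) (avg h) = h^-1.
Proof.
move=> h0 hT; have iL := ind_Lfun2 T0 (measurable_itv `]0, h[).
rewrite /avg ipZl ?ipZr//; last exact: Lfun2Z.
rewrite {1}/ip; under eq_Rintegral do rewrite indM.
by rewrite Rint_ind// mulVf ?mulr1// gt_eqF.
Qed.

Lemma snd_Lfun2 (b : 'rV[R]_N -> R) : b \in Lfun muO 2%:E ->
  (fun z : TX => b z.2) \in Lfun muQ 2%:E.
Proof.
move=> bL; have := tensor_Lfun2 (cst_Lfun2 I_fin 1) bL.
by rewrite (_ : tensor _ _ = (fun z => b z.2))//; apply/funext => z; rewrite /tensor mul1r.
Qed.

Lemma tind_Lfun2 (A : set (measurableTypeR R)) v : measurable A ->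
  v \in Lfun muQ 2%:E -> (fun z => ind A z.1 * v z) \in Lfun muQ 2%:E.
Proof.
move=> mA; apply: (@Lfun2_mulbounded _ _ _ _ 1).
  exact: (measurableT_comp (measurable_ind mA) measurable_fst).
by move=> z; exact: ind_norm.
Qed.

(** [is_dt_rep] leaves the constant c(x) free. The means of v - v0 over ]0, h_n[ tend to 0 in
    L^2(Omega) by the continuous representative [D], and to c(x) - v0(x) at almost every x; so c =
    v0. *)
Lemma initial_rep v v' (v0 : 'rV[R]_N -> R) : is_dt Omega T v v' ->
  v0 \in Lfun muO 2%:E -> initial_value Omega T v v0 ->
  {ae muO, forall x,
    {ae muI, forall t, v (t, x) = v0 x + prim T (fun t => v' (t, x)) t}}.
Proof.
move=> dv v0L [D [DL Dc Dv D0]].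
have [vL v'L _] := dv.
pose u : TX -> R := v \- (fun z => v0 z.2).
have uL : u \in Lfun muQ 2%:E by apply: Lfun2B => //; exact: snd_Lfun2.
pose h n : R := T / n.+1%:R.
have h0 n : 0 < h n by rewrite divr_gt0.
have hT n : h n <= T by rewrite ler_pdivrMr// ler_peMr ?ler1n// ltW.
pose Z n := timeint muI u (avg (h n)).
have ZL n : Z n \in Lfun muO 2%:E by apply: timeint_Lfun2 => //; exact: avgL.
have Zto0 e : 0 < e -> exists n0, forall n, (n0 <= n)%N -> ip muO (Z n) (Z n) <= e.
  move=> e0.
  have se0 : 0 < Num.sqrt e by rewrite sqrtr_gt0.
  have T0T : (0 : R) <= 0 <= T by rewrite lexx ltW.
  have /cvgr0_norm_le/(_ _ se0) := Dc 0 T0T.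
  rewrite near_withinE => /nbhs_ballP[eta/= eta0 etaP].
  have [n0 n0P] : exists n0, forall n, (n0 <= n)%N -> h n < eta.
    exists (Num.trunc (T / eta)).+1 => n nn; rewrite /h ltr_pdivrMr// mulrC.
    rewrite -ltr_pdivrMr//; apply: lt_le_trans (truncnS_gt _) _.
    by rewrite ler_nat (leq_trans nn).
  exists n0 => n n0n; have hneta := n0P _ n0n.
  (* Cutting off at h_n leaves the mean unchanged but lets Cauchy-Schwarz see only times below h_n,
     where D t is close to D 0. *)
  pose uh : TX -> R := fun z => ind `]0, h n[%classic z.1 * u z.
  have uhL : uh \in Lfun muQ 2%:E by exact: tind_Lfun2.
  have -> : Z n = timeint muI uh (avg (h n)).
    apply/funext => x; apply: eq_Rintegral => t _.
    rewrite /uh/avg/= -{1}[ind _ t]indM; ring.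
  apply: le_trans (timeint_sqr_le O_fin uhL (avgL (h n))) _.
  rewrite ip_avg// mulrC ler_pdivrMr// (ip_fubini1 uhL uhL).
  apply: (@le_trans _ _ (\int[muI]_t (e * ind `]0, h n[%classic t))); last first.
    rewrite RintegralZl//; last exact: (Lfun2_integrable T0 (ind_Lfun2 T0 _)).
    by rewrite Rint_ind.
  rewrite /Rintegral fine_le//.
  - exact: (integrable_fin_num measurableT (integrable_ip1 uhL uhL)).
  - have indi := Lfun2_integrable T0 (ind_Lfun2 T0 (measurable_itv `]0, h n[)).
    exact: (integrable_fin_num measurableT (integrableZl measurableT e indi)).
  - apply: ae_ge0_le_integral => //.
    + by move=> t _; rewrite lee_fin ip_ge0.
    + exact: measurable_int (integrable_ip1 uhL uhL).
    + by move=> t _; rewrite lee_fin mulr_ge0 ?ind_ge0// ltW.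
    + by apply/measurable_EFinP; apply: measurable_funM => //; exact: measurable_ind.
    + apply: (@filterS2 _ _ (ae_filter_ringOfSetsType muI)) Dv (ae_slice1_Lfun2 uL).
      move=> t Dt utL _; rewrite lee_fin.
      have [th|th] := pselect (`]0, h n[%classic t); last first.
        rewrite /uh/= indF// mulr0.
        under eq_fun do rewrite mul0r.
        by rewrite -[X in ip _ X _]/(cst 0) ip0l.
      rewrite /uh/= indT// mulr1; under eq_fun do rewrite mul1r.
      have t_h : 0 < t < h n by move: th; rewrite /= in_itv.
      have t0T : 0 <= t <= T.
        by move: t_h => /andP[t0 tn]; rewrite !ltW// (lt_le_trans tn (hT n)).
      have DtL : D t \- D 0 \in Lfun muO 2%:E by apply: Lfun2B; exact: DL.
      have -> : ip muO (fun y => u (t, y)) (fun y => u (t, y)) =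
          ip muO (D t \- D 0) (D t \- D 0).
        rewrite (@ae_eq_ip _ _ _ _ _ (D t \- D 0))//.
          rewrite ipC (@ae_eq_ip _ _ _ _ _ (D t \- D 0))//.
          by apply: filterS2 Dt D0 => x /(_ Logic.I) + /(_ Logic.I); rewrite /u/= => -> ->.
        by apply: filterS2 Dt D0 => x /(_ Logic.I) + /(_ Logic.I); rewrite /u/= => -> ->.
      have := etaP t; rewrite -ball_normE/= sub0r normrN.
      move: (t_h) => /andP[t0 tn].
      rewrite gtr0_norm// => /(_ (lt_trans tn hneta)).
      rewrite in_itv/= => /(_ t0T).
      rewrite L2normE// ger0_norm ?sqrtr_ge0// ler_sqrt//.
      exact: ltW.
(* Fatou on the squares replaces the extraction of an almost everywhere convergent subsequence. *)
have Zlim : {ae muO, forall x, (limn_einf (fun n => (Z n x ^+ 2)%:E) = 0)%E}.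
  have mZ n : measurable_fun setT (fun x => (Z n x ^+ 2)%:E).
    by apply/measurable_EFinP; apply: measurable_funX; exact: Lfun2_measurable (ZL n).
  have lim0 x : (0 <= limn_einf (fun n => (Z n x ^+ 2)%:E))%E.
    rewrite limn_einf_lim; apply: lime_ge; first exact: is_cvg_einfs.
    apply: nearW => m; apply: le_ereal_inf_tmp => _ [j _ <-].
    by rewrite lee_fin sqr_ge0.
  have mlim : measurable_fun setT (fun x => limn_einf (fun n => (Z n x ^+ 2)%:E)).
    under eq_fun do rewrite -[limn_einf _]oppeK -limn_esupN.
    apply: measurableT_comp => //; apply: measurable_fun_limn_esup => m.
    by apply: measurableT_comp.
  have : (\int[muO]_x `|limn_einf (fun n => (Z n x ^+ 2)%:E)| = 0)%E.
    under eq_integral do rewrite gee0_abs//.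
    apply/eqP; rewrite eq_le integral_ge0// andbT.
    apply: le_trans (fatou muO measurableT mZ _) _.
      by move=> n x _; rewrite lee_fin sqr_ge0.
    apply/lee_addgt0Pr => e e0; rewrite add0e.
    have [n0 n0P] := Zto0 _ e0.
    apply: (@limn_einf_le _ _ _ n0) => n nn.
    rewrite (eq_integral (fun x => (Z n x * Z n x)%:E)); last first.
      by move=> x _; rewrite expr2.
    by rewrite (EFin_ip (ZL n) (ZL n)) lee_fin n0P.
  move=> /(ae_eq_integral_abs _ measurableT mlim).1.
  by apply: filterS => x /(_ Logic.I).
apply: filterS3 Zlim (ae_slice2_Lfun2 v'L) (is_dt_rep dv) => x Zx v'xL [c cP].
suff -> : v0 x = c by [].
set w := (fun t => v' (t, x)) in v'xL cP *.
have h_to0 : h n @[n --> \oo] --> (0 : R).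
  rewrite -(mulr0 T); apply: cvgM; first exact: cvg_cst.
  exact: cvg_harmonic.
pose K := ip muI w w.
have K0 : 0 <= K by exact: ip_ge0.
have wi := Lfun2_integrable T0 v'xL.
have avgi n := Lfun2_integrable T0 (avgL (h n)).
have pi_ n : muI.-integrable setT (EFin \o (fun t => prim T w t * avg (h n) t)).
  apply: (@integrable_mulb _ _ _ _ `|(h n)^-1|) (integrable_prim T0 wi).
    by have /measurable_EFinP := measurable_int _ (avgi n).
  by move=> t; rewrite /avg normrM ler_piMr// ind_norm.
(* The mean of v(., x) - v0(x) is the constant c - v0(x) plus the mean of the primitive, which is of
   order sqrt(h_n). *)
have ZE n : Z n x = c - v0 x + timeint muI (fun z => prim T w z.1) (avg (h n)) x.
  rewrite /timeint/=.
  have -> : c - v0 x = \int[muI]_t ((c - v0 x) * avg (h n) t).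
    rewrite RintegralZl// /avg RintegralZl//; last exact: (Lfun2_integrable T0 (ind_Lfun2 T0 _)).
    by rewrite Rint_ind// mulVf ?mulr1// gt_eqF.
  rewrite -(RintegralD measurableT (integrableZl measurableT (c - v0 x) (avgi n)) (pi_ n)).
  apply: ae_eq_Rintegral.
  - apply: measurable_funM; last by have /measurable_EFinP := measurable_int _ (avgi n).
    exact: (measurable_slice2 x (Lfun2_measurable uL)).
  - apply: measurable_funD.
      apply: measurable_funM => //.
      by have /measurable_EFinP := measurable_int _ (avgi n).
    by have /measurable_EFinP := measurable_int _ (pi_ n).
  - by apply: filterS cP => t vt; rewrite /u/= vt; ring.
have r_small n : `|timeint muI (fun z : TX => prim T w z.1) (avg (h n)) x| <=
    Num.sqrt (h n * K).
  have pL t : `|prim T w t * avg (h n) t| <= Num.sqrt (h n * K) * avg (h n) t.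
    rewrite normrM [X in _ * X]ger0_norm; last first.
      by rewrite /avg mulr_ge0 ?invr_ge0 ?ind_ge0// ltW.
    have [th|th] := pselect (`]0, h n[%classic t); last by rewrite /avg indF// !mulr0.
    apply: ler_wpM2r; first by rewrite /avg mulr_ge0 ?invr_ge0 ?ind_ge0// ltW.
    move: th; rewrite /= in_itv/= => /andP[t0 tn].
    rewrite -sqrtr_sqr ler_wsqrtr//; apply: le_trans (prim_bound (ltW t0) v'xL) _.
    by rewrite ler_wpM2r// ltW.
  apply: le_trans (le_normr_Rintegral measurableT (pi_ n)) _.
  apply: (@le_trans _ _ (\int[muI]_t (Num.sqrt (h n * K) * avg (h n) t))).
    apply: le_Rintegral => //.
    - exact: (integrable_norm (pi_ n)).
    - exact: (integrableZl measurableT (Num.sqrt (h n * K)) (avgi n)).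
  rewrite RintegralZl// /avg RintegralZl//; last exact: (Lfun2_integrable T0 (ind_Lfun2 T0 _)).
  by rewrite Rint_ind// mulVf ?mulr1// gt_eqF.
have Zc : Z n x @[n --> \oo] --> c - v0 x.
  pose r n := timeint muI (fun z : TX => prim T w z.1) (avg (h n)) x.
  have rc : r n @[n --> \oo] --> (0 : R).
    apply: norm_cvg0.
    apply: (@squeeze_cvgr _ _ _ _ (cst 0) (fun n => Num.sqrt (h n * K))).
    - by apply: nearW => n; rewrite normr_ge0 r_small.
    - exact: cvg_cst.
    - have hK : h n * K @[n --> \oo] --> 0 * K by apply: cvgM => //; exact: cvg_cst.
      have : Num.sqrt (h n * K) @[n --> \oo] --> Num.sqrt (0 * K).
        by apply: (continuous_cvg _ (@sqrt_continuous R (0 * K)) hK).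
      by rewrite mul0r sqrtr0.
  have : (cst (c - v0 x) \+ r) n @[n --> \oo] --> c - v0 x + 0.
    by apply: cvgD => //; exact: cvg_cst.
  rewrite addr0.
  have -> : (fun n => Z n x) = cst (c - v0 x) \+ r.
    by apply/funext => n; rewrite ZE.
  exact.
have : (Z n x ^+ 2)%:E @[n --> \oo] --> ((c - v0 x) ^+ 2)%:E.
  apply: cvg_EFin; first exact: nearW.
  under eq_fun do rewrite /= expr2; rewrite expr2.
  exact: cvgM.
move=> /cvg_limn_einf_sup[+ _]; rewrite Zx => -[] /esym/eqP.
by rewrite sqrf_eq0 subr_eq0 => /eqP ->.
Qed.

End representation.

(** * The elliptic equation *)

Section Rintegral_sum.
Context d (X : measurableType d) (R : realType) (mu : {measure set X -> \bar R}).
Context (I : Type) (s : seq I) (f : I -> X -> R).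
Hypothesis fi : forall i, mu.-integrable setT (EFin \o f i).

Lemma integrable_Rsum : mu.-integrable setT (EFin \o (fun x => \sum_(i <- s) f i x)).
Proof.
rewrite (_ : _ \o _ = (fun x => \sum_(i <- s) (f i x)%:E)%E).
  by apply: integrable_sum => // i _; exact: fi.
by apply/funext => x /=; rewrite sumEFin.
Qed.

Lemma Rintegral_sum : \int[mu]_x (\sum_(i <- s) f i x) = \sum_(i <- s) \int[mu]_x f i x.
Proof.
rewrite /Rintegral sum_fine => [|i _]; last exact: (integrable_fin_num measurableT (fi i)).
rewrite -integral_sum//; congr fine; apply: eq_integral => x _.
by rewrite sumEFin.
Qed.

End Rintegral_sum.

Lemma ae_le_Rintegral d (X : measurableType d) (R : realType)
    (mu : {measure set X -> \bar R}) (f g : X -> R) :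
  mu.-integrable setT (EFin \o f) -> mu.-integrable setT (EFin \o g) ->
  (forall x, 0 <= f x) -> {ae mu, forall x, f x <= g x} ->
  \int[mu]_x f x <= \int[mu]_x g x.
Proof.
move=> fi gi f0 fg.
have ni := integrable_norm gi.
apply: (@le_trans _ _ (\int[mu]_x `|g x|)).
  apply: fine_le; try exact: (integrable_fin_num measurableT).
  apply: ae_ge0_le_integral => //.
  - by move=> x _; rewrite lee_fin.
  - exact: (measurable_int _ fi).
  - exact: (measurable_int _ ni).
  - apply: filterS fg => x fgx _; rewrite lee_fin.
    exact: le_trans fgx (ler_norm _).
have /measurable_EFinP mg := measurable_int _ gi.
rewrite (@ae_eq_Rintegral _ _ _ _ (fun x => `|g x|) g)//.
  exact: measurableT_comp.
by apply: filterS fg => x fgx; rewrite ger0_norm// (le_trans (f0 x)).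
Qed.

Section aform.
Context d (X : measurableType d) (R : realType) (mu : {measure set X -> \bar R}).
Context (N : nat) (alpha beta : R).
Hypotheses (alpha0 : 0 < alpha) (beta0 : 0 < beta).
Implicit Types (v : X -> R) (G : 'I_N -> X -> R).

(** The energy form of -alpha Delta + beta. Gradients are separate arguments because the weak
    gradient is a relation. *)
Definition aform G G' v v' : R :=
  alpha * (\sum_i ip mu (G i) (G' i)) + beta * ip mu v v'.

Definition allL2 G v := v \in Lfun mu 2%:E /\ forall i, G i \in Lfun mu 2%:E.

Lemma aformC G G' v v' : aform G G' v v' = aform G' G v' v.
Proof.
by rewrite /aform ipC; congr (_ * _ + _); apply: eq_bigr => i _; rewrite ipC.
Qed.

Lemma aform_lin s G1 v1 G2 v2 G v : allL2 G1 v1 -> allL2 G2 v2 -> allL2 G v ->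
  aform (fun i x => G1 i x + s * G2 i x) G (fun x => v1 x + s * v2 x) v =
  aform G1 G v1 v + s * aform G2 G v2 v.
Proof.
move=> [v1L G1L] [v2L G2L] [vL GL]; rewrite /aform ip_lin//.
under eq_bigr do rewrite ip_lin//.
by rewrite big_split/= -mulr_sumr; ring.
Qed.

Lemma aform_ge_ip G v : beta * ip mu v v <= aform G G v v.
Proof.
rewrite /aform lerDr mulr_ge0 ?(ltW alpha0)//.
by apply: sumr_ge0 => i _; exact: ip_ge0.
Qed.

Lemma aform_ge0 G v : 0 <= aform G G v v.
Proof. by apply: le_trans (aform_ge_ip G v); rewrite mulr_ge0 ?ip_ge0// ltW. Qed.

End aform.

Section elliptic.
Context (R : realType) (N : nat) (Omega : polyhedral_domain R N).
Variables (alpha beta : R).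
Hypotheses (alpha0 : 0 < alpha) (beta0 : 0 < beta).
Local Notation muO := (muO Omega).
Local Notation aO := (aform muO alpha beta).
Implicit Types (v : 'rV[R]_N -> R) (g : 'I_N -> 'rV[R]_N -> R).

Lemma H10_grad_allL2 v g : H10_grad Omega v g -> allL2 muO g v.
Proof. by move=> [[vL gL _] _]. Qed.

(* An approximate solution operator of [-alpha Delta p + beta p = chi]. *)
Lemma stationary_approx chi e : chi \in Lfun muO 2%:E -> 0 < e ->
  exists p gp, [/\ H10_grad Omega p gp,
    Num.sqrt (ip muO p p) <= Num.sqrt (ip muO chi chi) / beta + e &
    forall q gq, H10_grad Omega q gq ->
      `|aO gp gq p q - ip muO chi q| <= e * Num.sqrt (aO gq gq q q)].
Proof.
move=> chiL e0.
pose E := (('rV[R]_N -> R) * ('I_N -> 'rV[R]_N -> R))%type.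
pose lin (a : R) (x y : E) : E :=
  (fun z => x.1 z + a * y.1 z, fun i z => x.2 i z + a * y.2 i z).
pose S := [set x : E | H10_grad Omega x.1 x.2].
pose B (x y : E) := aO x.2 y.2 x.1 y.1.
pose F (x : E) := ip muO chi x.1.
have SL x : S x -> allL2 muO x.2 x.1 by exact: H10_grad_allL2.
have sb0 : 0 < Num.sqrt beta by rewrite sqrtr_gt0.
have sqrt_aform g v : Num.sqrt beta * Num.sqrt (ip muO v v) <= Num.sqrt (aO g g v v).
  by rewrite -sqrtrM ?(ltW beta0)// ler_wsqrtr//; exact: aform_ge_ip.
(* The tolerance is used twice: directly for the residual, and divided by sqrt(beta) for the norm of
   p. *)
pose e' := Num.min e (e * Num.sqrt beta).
have e'0 : 0 < e' by rewrite lt_min e0 mulr_gt0.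
have [|||||||[p gp] Sp H] := @approximate_riesz R E lin S B F
    (Num.sqrt (ip muO chi chi) / Num.sqrt beta) (cst 0, fun=> cst 0) _ _ _ _ _ _ _ _ e'0.
- exact: H10_grad0.
- by move=> a x y Sx Sy; exact: H10_grad_lin.
- by move=> x y _ _; exact: aformC.
- by move=> a x y z Sx Sy Sz; apply: aform_lin; exact: SL.
- by move=> x Sx; exact: aform_ge0.
- move=> a x y /SL[xL _] /SL[yL _].
  by rewrite /F ipC ip_lin// ![ip _ _ chi]ipC.
- move=> x Sx; have [xL _] := SL _ Sx.
  apply: le_trans (ip_CS chiL xL) _.
  rewrite -mulrA ler_wpM2l ?sqrtr_ge0// ler_pdivlMl//.
  exact: sqrt_aform.
exists p, gp; split => //.
- have [pL _] := SL _ Sp.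
  set x := Num.sqrt (ip muO p p); set c := Num.sqrt (ip muO chi chi).
  have := H _ Sp; rewrite /B/F/=; set s := Num.sqrt (aO gp gp p p) => h.
  have xs : Num.sqrt beta * x <= s by exact: sqrt_aform.
  have ss : aO gp gp p p = s ^+ 2 by rewrite sqr_sqrtr// aform_ge0.
  have cp := le_trans (ler_norm _) (ip_CS chiL pL).
  have x0 : 0 <= x by exact: sqrtr_ge0.
  have c0 : 0 <= c by exact: sqrtr_ge0.
  have s0 : 0 <= s by exact: sqrtr_ge0.
  have bb : beta = Num.sqrt beta ^+ 2 by rewrite sqr_sqrtr// ltW.
  have e'le : e' <= e * Num.sqrt beta by rewrite ge_min lexx orbT.
  have {}h := le_trans (ler_norm _) h; rewrite ss in h.
  rewrite -/x -/c in cp.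
  (* Testing the almost-equation with p itself: s^2 <= c x + e' s, and x <= s / sqrt(beta). *)
  have sle : s <= c / Num.sqrt beta + e'.
    apply: (sqr_le_mul s0); first by rewrite addr_ge0 ?divr_ge0 ?(ltW sb0) ?(ltW e'0).
    rewrite mulrDl.
    have : c * x <= c / Num.sqrt beta * s.
      by rewrite -mulrA ler_wpM2l// ler_pdivlMl.
    by lra.
  rewrite -(ler_pM2l sb0); apply: le_trans xs _; apply: le_trans sle _.
  rewrite mulrDr; apply: lerD; last by rewrite mulrC.
  move: sb0 bb; move: (Num.sqrt beta) => sb sb0' ->.
  rewrite le_eqVlt; apply/orP; left; apply/eqP; field.
  by rewrite gt_eqF.
- move=> q gq Hq; apply: le_trans (H (q, gq) Hq) _.
  by apply: ler_wpM2r; [exact: sqrtr_ge0|rewrite ge_min lexx].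
Qed.

End elliptic.

(** * The space V and tensor-product tests *)

Section V_space.
Context (R : realType) (N : nat) (Omega : polyhedral_domain R N).
Variables (T alpha beta : R).
Hypotheses (T0 : 0 < T) (alpha0 : 0 < alpha) (beta0 : 0 < beta).
Local Notation TX := (measurableTypeR R * 'rV[R]_N)%type.
Local Notation muI := (@muI R T).
Local Notation muO := (muO Omega).
Local Notation muQ := (muQ Omega T).
Local Notation aO := (aform muO alpha beta).
Local Notation aQ := (aform muQ alpha beta).
Implicit Types (v : TX -> R) (G : 'I_N -> TX -> R).

Lemma V_grad_allL2 v G : V_grad Omega T v G -> allL2 muQ G v.
Proof. by move=> [vL GL _]. Qed.

Lemma V_grad_lin s v G v' G' : V_grad Omega T v G -> V_grad Omega T v' G' ->
  V_grad Omega T (fun z => v z + s * v' z) (fun i z => G i z + s * G' i z).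
Proof.
move=> [vL GL vH] [vL' GL' vH']; split.
- exact: Lfun2_lin.
- by move=> i; exact: Lfun2_lin.
- apply: (@filterS2 _ _ (ae_filter_ringOfSetsType muI)) vH vH' => t h h'.
  exact: H10_grad_lin.
Qed.

Lemma V_grad_tensor a p gp : a \in Lfun muI 2%:E -> H10_grad Omega p gp ->
  V_grad Omega T (tensor a p) (fun i => tensor a (gp i)).
Proof.
move=> aL Hp; have [pL gpL] := H10_grad_allL2 Hp; split.
- exact: tensor_Lfun2.
- by move=> i; exact: tensor_Lfun2.
- by apply: aeW => t; exact: (H10_gradZ (a t) Hp).
Qed.

Lemma V_grad0 : V_grad Omega T (cst 0) (fun=> cst 0).
Proof.
split; [exact: Lfun2_cst0|by move=> i; exact: Lfun2_cst0|].
by apply: aeW => t; exact: H10_grad0.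
Qed.

Lemma integrable_aform G G' v v' : allL2 muQ G v -> allL2 muQ G' v' ->
  muI.-integrable setT (EFin \o (fun t : measurableTypeR R =>
    aO (fun i => at_time (G i) t) (fun i => at_time (G' i) t)
      (at_time v t) (at_time v' t))).
Proof.
move=> [vL GL] [v'L G'L]; rewrite /aform.
apply: (@integrableD _ _ _ _ _ measurableT (EFin \o _) (EFin \o _)).
  apply: (@integrableZl _ _ _ _ _ measurableT alpha (EFin \o _)).
  by apply: integrable_Rsum => i; exact: integrable_ip1.
apply: (@integrableZl _ _ _ _ _ measurableT beta (EFin \o _)).
exact: integrable_ip1.
Qed.

Lemma aform_fubini G G' v v' : allL2 muQ G v -> allL2 muQ G' v' ->
  aQ G G' v v' = \int[muI]_t aO (fun i => at_time (G i) t) (fun i => at_time (G' i) t)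
    (at_time v t) (at_time v' t).
Proof.
move=> [vL GL] [v'L G'L].
have iv := integrable_ip1 vL v'L.
have iG i := integrable_ip1 (GL i) (G'L i).
have iS := integrable_Rsum (index_enum 'I_N) iG.
rewrite /aform RintegralD//; last 2 first.
- exact: (integrableZl measurableT alpha iS).
- exact: (integrableZl measurableT beta iv).
rewrite RintegralZl// RintegralZl// (ip_fubini1 vL v'L); congr (_ * _ + _).
under eq_bigr do rewrite (ip_fubini1 (GL _) (G'L _)).
exact: esym (Rintegral_sum _ iG).
Qed.

(** The stationary p is multiplied by a(t), and its residual is applied to q(t) at almost every t.
    The bound e |a| sqrt(s), with s the energy of q(t), is relaxed to e (a^2 + s), which integrates
    in time. *)
Lemma V_approx chi e : chi \in Lfun muO 2%:E -> 0 < e ->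
  exists p gp, [/\ H10_grad Omega p gp,
    Num.sqrt (ip muO p p) <= Num.sqrt (ip muO chi chi) / beta + e &
    forall a q Gq, a \in Lfun muI 2%:E -> V_grad Omega T q Gq ->
      `|aQ (fun i => tensor a (gp i)) Gq (tensor a p) q - ip muQ (tensor a chi) q|
      <= e * (ip muI a a + aQ Gq Gq q q)].
Proof.
move=> chiL e0; have [p [gp [Hp pn H]]] := stationary_approx alpha0 beta0 chiL e0.
exists p, gp; split => // a q Gq aL Hq.
have [[pL gpL] qA] := (H10_grad_allL2 Hp, V_grad_allL2 Hq).
have PA := V_grad_allL2 (V_grad_tensor aL Hp).
have tL := tensor_Lfun2 aL chiL.
have [qL _] := qA.
have i1 := integrable_aform PA qA.
have i2 := integrable_ip1 tL qL.
have i3 := integrable_aform qA qA.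
have i4 := integrable_ip aL aL.
rewrite (aform_fubini PA qA) (ip_fubini1 tL qL) -RintegralB//.
apply: le_trans (le_normr_Rintegral measurableT (integrableB measurableT i1 i2)) _.
rewrite (aform_fubini qA qA) [ip muI a a]/ip -RintegralD// -RintegralZl//; last first.
  exact: (integrableD measurableT i4 i3).
apply: ae_le_Rintegral => //.
- exact: (integrable_norm (integrableB measurableT i1 i2)).
- exact: (integrableZl measurableT e (integrableD measurableT i4 i3)).
have [_ _ qH] := Hq.
apply: (@filterS2 _ _ (ae_filter_ringOfSetsType muI)) qH (ae_slice1_Lfun2 qL) => t qt qtL.
have [qtL' gqt] := H10_grad_allL2 qt.
have -> : aO (fun i => at_time (tensor a (gp i)) t) (fun i => at_time (Gq i) t)
    (at_time (tensor a p) t) (at_time q t) =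
    a t * aO gp (fun i => at_time (Gq i) t) p (at_time q t).
  rewrite /aform /at_time/tensor/= ipZl//.
  under eq_bigr do rewrite (ipZl (a t) (gpL _) (gqt _)).
  by rewrite -mulr_sumr; ring.
have -> : ip muO (fun y => tensor a chi (t, y)) (fun y => q (t, y)) =
    a t * ip muO chi (at_time q t) by rewrite /tensor/= ipZl.
rewrite -mulrBr normrM.
apply: le_trans (ler_wpM2l (normr_ge0 _) (H _ _ qt)) _.
have := aform_ge0 muO alpha0 beta0 (fun i => at_time (Gq i) t) (at_time q t).
move: (aO _ _ _ _) => s s0.
rewrite mulrCA ler_pM2l// -expr2 -[X in _ <= X + _]real_normK ?num_real//.
rewrite -[X in _ <= _ + X](sqr_sqrtr s0).
have := sqrtr_ge0 s; have := normr_ge0 (a t).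
by move: (Num.sqrt s) `|a t| => x y y0 x0; nra.
Qed.

End V_space.

(** * Time regularity of the elliptic solution *)

Section is_dt_lin.
Context (R : realType) (N : nat) (Omega : polyhedral_domain R N) (T : R).
Hypothesis T0 : 0 < T.
Local Notation TX := (measurableTypeR R * 'rV[R]_N)%type.
Local Notation muI := (@muI R T).
Local Notation muO := (muO Omega).
Local Notation muQ := (muQ Omega T).
Implicit Types (v : TX -> R) (eta : R -> R).

Lemma Cc_infty_time_cont eta n : Cc_infty_time T eta -> continuous (derive1n n eta).
Proof. by move=> [de _] x; apply: differentiable_continuous; exact/derivable1_diffP/de. Qed.

Lemma Cc_infty_time_bounded eta n : Cc_infty_time T eta ->
  exists M, forall x, `|derive1n n eta x| <= M.
Proof.
move=> Ce; have [de [cK _]] := Ce; apply: (supported_bounded _ cK).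
  exact: Cc_infty_time_cont.
elim: n => [|n IH] x nx.
  by apply: contrapT => /eqP ex; apply: nx; exact: subset_closure.
rewrite -[derive1n n.+1 eta]/(derive1 (derive1n n eta)) derive1E.
rewrite -(derive_cst (0 : R) x (1 : R)); apply: near_eq_derive.
have : nbhs x (~` closure [set x | eta x != 0]).
  by apply: open_nbhs_nbhs; split => //; apply: closed_openC; exact: closed_closure.
by apply: filterS => y; exact: IH.
Qed.

Lemma Cc_infty_time_Lfun2 eta n : Cc_infty_time T eta ->
  (derive1n n eta : measurableTypeR R -> R) \in Lfun muI 2%:E.
Proof.
move=> Ce; have [M eM] := Cc_infty_time_bounded n Ce.
apply: (bounded_Lfun2 (muI_fin T0) _ eM).
apply: continuous_measurable_fun; exact: Cc_infty_time_cont.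
Qed.

Lemma timeint_lin s v v' a : v \in Lfun muQ 2%:E -> v' \in Lfun muQ 2%:E ->
  a \in Lfun muI 2%:E ->
  {ae muO, forall x, timeint muI (fun z => v z + s * v' z) a x =
    timeint muI v a x + s * timeint muI v' a x}.
Proof.
move=> vL v'L aL; apply: filterS2 (ae_slice2_Lfun2 vL) (ae_slice2_Lfun2 v'L).
move=> x vx v'x.
exact: (ip_lin s vx v'x aL).
Qed.

Lemma is_dt_lin s v v' w w' : is_dt Omega T v v' -> is_dt Omega T w w' ->
  is_dt Omega T (fun z => v z + s * w z) (fun z => v' z + s * w' z).
Proof.
move=> [vL vL' vH] [wL wL' wH]; split; [exact: Lfun2_lin|exact: Lfun2_lin|].
move=> eta Ce.
have eL := @Cc_infty_time_Lfun2 _ 0 Ce; have eL' := @Cc_infty_time_Lfun2 _ 1 Ce.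
apply: filterS2 (filterI (vH _ Ce) (wH _ Ce))
  (filterI (timeint_lin s vL wL eL') (timeint_lin s vL' wL' eL)).
move=> x [/(_ Logic.I) v1 /(_ Logic.I) w1] [t1 t2] _.
rewrite -[LHS]/(timeint muI (fun z => v z + s * w z) (derive1n 1 eta) x).
rewrite -[X in - X]/(timeint muI (fun z => v' z + s * w' z) (derive1n 0 eta) x).
by rewrite t1 t2 {1}/timeint v1 {1}/timeint w1 /timeint mulrN opprD.
Qed.

End is_dt_lin.

Section elliptic_in_X.
Context (R : realType) (N : nat) (Omega : polyhedral_domain R N).
Variables (T alpha beta : R).
Hypotheses (T0 : 0 < T) (alpha0 : 0 < alpha) (beta0 : 0 < beta).
Local Notation TX := (measurableTypeR R * 'rV[R]_N)%type.
Local Notation muI := (@muI R T).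
Local Notation muO := (muO Omega).
Local Notation muQ := (muQ Omega T).
Local Notation aQ := (aform muQ alpha beta).
Variables (phi g g' : TX -> R) (Gphi : 'I_N -> TX -> R).
Hypotheses (phiV : V_grad Omega T phi Gphi) (gX : is_dt Omega T g g').
Hypothesis phi_eq : forall psi Gpsi, V_grad Omega T psi Gpsi ->
  aQ Gphi Gpsi phi psi = ip muQ g psi.

Let E := ((TX -> R) * (TX -> R))%type.

Let lin (a : R) (x y : E) : E :=
  (fun z => x.1 z + a * y.1 z, fun z => x.2 z + a * y.2 z).

(** For x = (theta, theta'), P nearly solves the elliptic problem with right-hand side theta, and
    -(g', P) nearly equals (phi, theta'). *)
Let approx (x : E) (K e : R) := exists P GP, [/\ V_grad Omega T P GP,
  forall q Gq, V_grad Omega T q Gq ->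
    `|aQ GP Gq P q - ip muQ x.1 q| <= e * (K + aQ Gq Gq q q) &
  `|ip muQ phi x.2 + ip muQ g' P| <= e * K].

(** K may depend on x but not on e, so that e can tend to 0 for each x separately. In this form the
    condition is stable under linear combinations, as [riesz_L2] requires. *)
Let S : set E := [set x | [/\ x.1 \in Lfun muQ 2%:E, x.2 \in Lfun muQ 2%:E &
  exists2 K, 0 <= K & forall e, 0 < e -> approx x K e]].

Let S0 : S (cst 0, cst 0).
Proof.
split; [exact: Lfun2_cst0|exact: Lfun2_cst0|].
exists 0 => // e e0; exists (cst 0), (fun=> cst 0); split.
- exact: V_grad0.
- move=> q Gq Hq; rewrite /aform ip0l subr0 big1 ?mulr0 ?addr0 ?normr0.
    by rewrite add0r mulr_ge0 ?(ltW e0)// aform_ge0.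
  by move=> i _; rewrite ip0l.
- by rewrite !ip0r addr0 normr0 mulr0.
Qed.

Let Slin a x y : S x -> S y -> S (lin a x y).
Proof.
move=> [x1 x2 [K1 K10 H1]] [y1 y2 [K2 K20 H2]].
have [phiL _] := V_grad_allL2 phiV; have [gL gL' _] := gX.
split; [exact: Lfun2_lin|exact: Lfun2_lin|].
exists (K1 + `|a| * K2); first by rewrite addr_ge0// mulr_ge0.
move=> e e0.
have a1 : 0 < 1 + `|a| by rewrite ltr_pwDl.
have e'0 : 0 < e / (1 + `|a|) by rewrite divr_gt0.
have e'E : e = e / (1 + `|a|) * (1 + `|a|) by rewrite divfK// gt_eqF.
move: (e / (1 + `|a|)) e'0 e'E (H1 _ e'0) (H2 _ e'0) => e' {}e'0 e'E.
move=> [P1 [G1 [V1 A1 B1]]] [P2 [G2 [V2 A2 B2]]].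
have [P1L _] := V_grad_allL2 V1; have [P2L _] := V_grad_allL2 V2.
exists (fun z => P1 z + a * P2 z), (fun i z => G1 i z + a * G2 i z); split.
- exact: V_grad_lin.
- move=> q Gq Hq; have [qL _] := V_grad_allL2 Hq.
  have := A1 _ _ Hq; have := A2 _ _ Hq.
  rewrite (aform_lin _ _ a (V_grad_allL2 V1) (V_grad_allL2 V2) (V_grad_allL2 Hq)).
  rewrite ip_lin//.
  have -> : aQ G1 Gq P1 q + a * aQ G2 Gq P2 q - (ip muQ x.1 q + a * ip muQ y.1 q) =
      (aQ G1 Gq P1 q - ip muQ x.1 q) + a * (aQ G2 Gq P2 q - ip muQ y.1 q) by ring.
  move=> h2 h1; apply: le_trans (ler_normD _ _) _; rewrite normrM.
  have Q0 := aform_ge0 muQ alpha0 beta0 Gq q.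
  move: h1 h2; move: (aQ Gq Gq q q) Q0 => Q Q0 h1 h2.
  have h3 := ler_wpM2l (normr_ge0 a) h2.
  apply: le_trans (lerD h1 h3) _; rewrite e'E.
  have : 0 <= e' * (`|a| * K1 + `|a| * (`|a| * K2)).
    by rewrite mulr_ge0 ?(ltW e'0)// addr_ge0// !mulr_ge0.
  by lra.
- rewrite [X in X + _]ipC ip_lin// ipC [X in _ + a * X + _]ipC.
  rewrite [X in _ + X]ipC ip_lin// [X in _ + (X + _)]ipC [X in _ + (_ + a * X)]ipC.
  have -> : ip muQ phi x.2 + a * ip muQ phi y.2 + (ip muQ g' P1 + a * ip muQ g' P2) =
      (ip muQ phi x.2 + ip muQ g' P1) + a * (ip muQ phi y.2 + ip muQ g' P2) by ring.
  apply: le_trans (ler_normD _ _) _; rewrite normrM.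
  apply: le_trans (lerD B1 (ler_wpM2l (normr_ge0 a) B2)) _.
  rewrite mulrCA -mulrDr; apply: ler_wpM2r; first by rewrite addr_ge0// mulr_ge0.
  by rewrite e'E ler_peMr ?lerDl// ltW.
Qed.

(** Up to errors that vanish with the tolerance, (phi, x.2) is -(g', P), and testing the
    almost-equation for P with P gives |P| <= 2 |x.1| / beta. The 2 comes from absorbing half of the
    energy of P. *)
Let F_bound x : S x ->
  `|- ip muQ phi x.2| <= 2 * Num.sqrt (ip muQ g' g') / beta * Num.sqrt (ip muQ x.1 x.1).
Proof.
move=> [xL _ [K K0 H]]; have [gL gL' _] := gX; rewrite normrN.
set t := Num.sqrt (ip muQ x.1 x.1); set c := Num.sqrt (ip muQ g' g').
have t0 : 0 <= t by exact: sqrtr_ge0.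
have c0 : 0 <= c by exact: sqrtr_ge0.
pose D := c * Num.sqrt (2 * K / beta) + K.
have D0 : 0 <= D by rewrite addr_ge0// mulr_ge0// sqrtr_ge0.
apply/ler_addgt0Pr => eps eps0.
pose h := Num.min (2^-1) (eps / (D + 1)).
have D1 : 0 < D + 1 by rewrite ltr_wpDl.
have h0 : 0 < h by rewrite lt_min invr_gt0 ltr0n divr_gt0.
have h1 : h <= 2^-1 by rewrite ge_min lexx.
have h2 : h * D <= eps.
  apply: (@le_trans _ _ (eps / (D + 1) * D)).
    by apply: ler_wpM2r => //; rewrite ge_min lexx orbT.
  by rewrite mulrAC ler_pdivrMr// ler_wpM2l ?ltW// ltrDl.
have hh : h ^+ 2 <= h by rewrite expr2 ler_piMr ?ltW//; lra.
(* Tolerance h^2: the quadratic inequality for the norm y of P then leaves an error of order h after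
   taking roots. *)
have [P [GP [VP A B]]] := H _ (exprn_gt0 2 h0).
have [PL _] := V_grad_allL2 VP.
set y := Num.sqrt (ip muQ P P).
have y0 : 0 <= y by exact: sqrtr_ge0.
have yy : ip muQ P P = y ^+ 2 by rewrite sqr_sqrtr// ip_ge0.
have ab := aform_ge_ip muQ beta alpha0 GP P; rewrite yy in ab.
have xP := le_trans (ler_norm _) (ip_CS xL PL); rewrite -/t -/y in xP.
have {A} := le_trans (ler_norm _) (A _ _ VP).
move: (aQ GP GP P P) ab => Q ab A.
have Q0 : 0 <= Q by apply: le_trans ab; rewrite mulr_ge0 ?sqr_ge0// ltW.
have hQ : h ^+ 2 * Q <= 2^-1 * Q by rewrite ler_wpM2r//; lra.
have yle : y <= 2 * t / beta + h * Num.sqrt (2 * K / beta).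
  set s := Num.sqrt (2 * K / beta).
  have s0 : 0 <= s by exact: sqrtr_ge0.
  have ss : beta * s ^+ 2 = 2 * K.
    rewrite sqr_sqrtr; first by field; rewrite gt_eqF.
    by rewrite divr_ge0 ?(ltW beta0)// mulr_ge0.
  rewrite leNgt; apply/negP => yt.
  have q1 : beta * y ^+ 2 <= 2 * (t * y) + h ^+ 2 * (2 * K) by lra.
  rewrite -ss in q1.
  have bt : beta * (2 * t / beta) = 2 * t by field; rewrite gt_eqF.
  move: (2 * t / beta) bt yt => b bt yt.
  have q2 : y ^+ 2 <= b * y + (h * s) ^+ 2.
    rewrite -(ler_pM2l beta0); apply: le_trans q1 _.
    by rewrite mulrDr [beta * (b * y)]mulrA bt exprMn; lra.
  have b0 : 0 <= b by rewrite -(pmulr_rge0 _ beta0) bt mulr_ge0.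
  have hs0 : 0 <= h * s by rewrite mulr_ge0// ltW.
  move: (h * s) hs0 q2 yt => u u0 q2 yt.
  nra.
have gP := ip_CS gL' PL; rewrite -/c -/y in gP.
have -> : ip muQ phi x.2 = (ip muQ phi x.2 + ip muQ g' P) - ip muQ g' P by ring.
apply: le_trans (ler_normB _ _) _.
apply: le_trans (lerD B gP) _.
have cy := ler_wpM2l c0 yle.
have KK := ler_wpM2r K0 hh.
have : 2 * c / beta * t = c * (2 * t / beta) by ring.
move=> ->; rewrite /D mulrDr in h2.
rewrite mulrDr [c * (h * _)]mulrCA in cy.
by lra.
Qed.

Let S_tensor eta chi : Cc_infty_time T eta -> chi \in Lfun muO 2%:E ->
  S (tensor (derive1n 0 eta : measurableTypeR R -> R) chi,
     tensor (derive1n 1 eta : measurableTypeR R -> R) chi).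
Proof.
move=> Ce chiL.
have eL := @Cc_infty_time_Lfun2 _ _ T0 _ 0 Ce.
have eL' := @Cc_infty_time_Lfun2 _ _ T0 _ 1 Ce.
have [phiL _] := V_grad_allL2 phiV; have [gL gL' gH] := gX.
split; [exact: tensor_Lfun2|exact: tensor_Lfun2|].
set e0 := derive1n 0 eta in eL *; set e1 := derive1n 1 eta in eL' *.
(* One K for two uses of [V_approx]: with weight eta against an arbitrary q, and with weight eta'
   against phi. *)
exists (ip muI e0 e0 + (ip muI e1 e1 + aQ Gphi Gphi phi phi)).
  by apply: addr_ge0; [exact: ip_ge0|apply: addr_ge0; [exact: ip_ge0|exact: aform_ge0]].
move=> e e_gt0; have [p [gp [Hp _ A]]] := V_approx T alpha0 beta0 chiL e_gt0.
have [pL _] := H10_grad_allL2 Hp.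
exists (tensor e0 p), (fun i => tensor e0 (gp i)); split.
- exact: V_grad_tensor.
- move=> q Gq Hq; apply: le_trans (A _ _ _ eL Hq) _.
  rewrite ler_pM2l// lerD2r lerDl; apply: addr_ge0; first exact: ip_ge0.
  exact: aform_ge0.
- have HP := V_grad_tensor eL' Hp.
  have := A _ _ _ eL' phiV; rewrite aformC phi_eq// => h.
  have -> : ip muQ phi (tensor e1 chi) + ip muQ g' (tensor e0 p) =
      - (ip muQ g (tensor e1 p) - ip muQ (tensor e1 chi) phi).
    rewrite [ip _ phi _]ipC opprB; congr (_ + _).
    have If := muO_fin Omega.
    rewrite (ip_tensor If gL eL' pL) (ip_tensor If gL' eL pL).
    have tL := timeint_Lfun2 If gL eL'; have tL' := timeint_Lfun2 If gL' eL.
    have -> : ip muO (timeint muI g e1) p = ip muO (fun x => -1 * timeint muI g' e0 x) p.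
      apply: ae_eq_ip => //; first exact: Lfun2Z.
      by apply: filterS (gH _ Ce) => x /(_ Logic.I); rewrite mulN1r.
    by rewrite ipZl// mulN1r opprK.
  rewrite normrN; apply: le_trans h _.
  by rewrite ler_pM2l// lerDr ip_ge0.
Qed.

Lemma elliptic_in_X : in_X Omega T phi.
Proof.
have [phiL _] := V_grad_allL2 phiV.
have [|||w wL H] := @riesz_L2 _ _ _ muQ E lin S fst (fun x => - ip muQ phi x.2)
  (2 * Num.sqrt (ip muQ g' g') / beta) (cst 0, cst 0) S0 Slin _ _ _ F_bound.
- by move=> x [].
- by [].
- by move=> a x y [_ xL _] [_ yL _]; rewrite ipC ip_lin// opprD ipC [ip _ _ phi]ipC mulrN.
exists w; split => // eta Ce.
have eL := @Cc_infty_time_Lfun2 _ _ T0 _ 0 Ce.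
have eL' := @Cc_infty_time_Lfun2 _ _ T0 _ 1 Ce.
have If := muO_fin Omega.
set e0 := derive1n 0 eta in eL; set e1 := derive1n 1 eta in eL'.
have tL := timeint_Lfun2 If wL eL; have tL' := timeint_Lfun2 If phiL eL'.
(* The defect of the weak derivative identity; taking chi = u in [S_tensor] shows that its norm is
   0. *)
pose u : 'rV[R]_N -> R := timeint muI phi e1 \+ timeint muI w e0.
have uL : u \in Lfun muO 2%:E by exact: Lfun2D.
have : ip muO u u = 0.
  rewrite {1}/u ipDl//.
  have := H _ (S_tensor Ce uL); rewrite /= -/e0 -/e1.
  by rewrite (ip_tensor If phiL eL' uL) (ip_tensor If wL eL uL) => <-; rewrite subrr.
move=> /(ip_eq0_ae uL); apply: filterS => x ux _.
by apply/eqP; rewrite -subr_eq0 opprK; apply/eqP.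
Qed.

End elliptic_in_X.

(** * The evolution equation *)

Section test_functions.
Context (R : realType) (N : nat) (Omega : polyhedral_domain R N) (T : R).
Hypothesis T0 : 0 < T.
Local Notation TX := (measurableTypeR R * 'rV[R]_N)%type.
Local Notation leb := (@lebesgue_measure R).
Local Notation muI := (@muI R T).
Local Notation muO := (muO Omega).
Local Notation muQ := (muQ Omega T).
Implicit Types (eta zeta : R -> R).

Let Rintegral_muI_cont (f : R -> R) : continuous f ->
  \int[muI]_t f t = \int[leb]_(t in `[0, T]) f t.
Proof.
move=> cf; have mf : measurable_fun setT f by exact: continuous_measurable_fun.
have iT : leb.-integrable `[0, T] (EFin \o f).
  apply: continuous_compact_integrable; first exact: segment_compact.
  exact: continuous_subspaceT.
rewrite Rintegral_restr// Rintegral_itv_obnd_cbnd.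
  rewrite Rintegral_itv_bndo_bndc//; apply: integrableS iT => //.
  by move=> x; rewrite /= !in_itv/= => /andP[-> /ltW].
by apply: integrableS iT => // x; rewrite /= !in_itv/= => /andP[/ltW -> /ltW].
Qed.

Let Cc_infty_time_out eta t : Cc_infty_time T eta -> ~ `]0, T[%classic t -> eta t = 0.
Proof.
move=> [_ [_ sub]] nt; apply: contrapT => /eqP et; apply: nt; apply: sub.
exact: subset_closure.
Qed.

Lemma Cc_infty_time_parts eta zeta : Cc_infty_time T eta -> Cc_infty_time T zeta ->
  \int[muI]_t (eta t * derive1 zeta t) = - \int[muI]_t (derive1 eta t * zeta t).
Proof.
move=> Ce Cz.
have ce n := @Cc_infty_time_cont _ _ _ n Ce; have cz n := @Cc_infty_time_cont _ _ _ n Cz.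
have LR xi : Cc_infty_time T xi -> derivable_oo_LRcontinuous xi 0 T.
  move=> Cx; have := @Cc_infty_time_cont _ _ _ 0 Cx => cx; split.
  - by move=> x _; exact: (Cx.1 0%N x).
  - exact/cvg_at_right_filter/cx.
  - exact/cvg_at_left_filter/cx.
rewrite !Rintegral_muI_cont; last 2 first.
- by move=> t; apply: cvgM; [exact: (ce 1%N)|exact: (cz 0%N)].
- by move=> t; apply: cvgM; [exact: (ce 0%N)|exact: (cz 1%N)].
rewrite (@Rintegration_by_parts _ eta zeta (derive1 eta) (derive1 zeta))//.
- rewrite (Cc_infty_time_out Cz); last by rewrite /= in_itv/= ltxx andbF.
  rewrite (Cc_infty_time_out (t := 0) Ce); last by rewrite /= in_itv/= ltxx.
  by rewrite mulr0 mul0r subrr add0r.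
- exact/continuous_subspaceT/(ce 1%N).
- exact: LR.
- exact/continuous_subspaceT/(cz 1%N).
- exact: LR.
Qed.

Lemma is_dt_tensor eta chi : Cc_infty_time T eta -> chi \in Lfun muO 2%:E ->
  is_dt Omega T (tensor (eta : measurableTypeR R -> R) chi)
    (tensor (derive1 eta : measurableTypeR R -> R) chi).
Proof.
move=> Ce chiL.
have eL n := @Cc_infty_time_Lfun2 _ _ T0 _ n Ce.
split; [exact: (tensor_Lfun2 (eL 0%N))|exact: (tensor_Lfun2 (eL 1%N))|].
move=> zeta Cz; have zL n := @Cc_infty_time_Lfun2 _ _ T0 _ n Cz.
apply: aeW => x _; rewrite /tensor/=.
under eq_Rintegral do rewrite mulrAC.
under [in RHS]eq_Rintegral do rewrite mulrAC.
rewrite RintegralZr//; last exact: (integrable_ip (eL 0%N) (zL 1%N)).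
rewrite RintegralZr//; last exact: (integrable_ip (eL 1%N) (zL 0%N)).
by rewrite Cc_infty_time_parts// mulNr.
Qed.

(** Testing with eta tensor chi, where chi is the time integral of (d' - f) eta, shows that this
    integral vanishes almost everywhere in Omega; so the defining identity passes from d' to f for
    each eta. *)
Lemma is_dt_of_test d d' f : is_dt Omega T d d' -> f \in Lfun muQ 2%:E ->
  (forall lam, in_X Omega T lam -> ip muQ d' lam = ip muQ f lam) ->
  is_dt Omega T d f.
Proof.
move=> [dL dL' dH] fL H; split => // eta Ce.
have eL := @Cc_infty_time_Lfun2 _ _ T0 _ 0 Ce.
have Of := muO_fin Omega.
pose u : TX -> R := d' \- f.
have uL : u \in Lfun muQ 2%:E by exact: Lfun2B.
have tL := timeint_Lfun2 Of uL eL.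
have : ip muO (timeint muI u (derive1n 0 eta)) (timeint muI u (derive1n 0 eta)) = 0.
  rewrite -(ip_tensor Of uL eL tL) ipBl//; last exact: tensor_Lfun2.
  rewrite H ?subrr//; exists (tensor (derive1 eta : measurableTypeR R -> R)
    (timeint muI u (derive1n 0 eta))).
  exact: is_dt_tensor.
move=> /(ip_eq0_ae tL) u0.
apply: filterS3 (dH _ Ce) u0 (filterI (ae_slice2_Lfun2 dL') (ae_slice2_Lfun2 fL)).
move=> x /(_ Logic.I) -> ux [d'x fx] _; congr (- _).
apply/eqP; rewrite -subr_eq0; apply/eqP; rewrite -[RHS]ux.
exact/esym/(ipBl d'x fx eL).
Qed.

End test_functions.

(** * The driving force *)

Section driving_force.
Context (R : realType) (N : nat) (Omega : polyhedral_domain R N) (T beta r : R).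
Hypotheses (beta0 : 0 < beta) (r0 : 0 < r).
Local Notation TX := (measurableTypeR R * 'rV[R]_N)%type.
Local Notation muQ := (muQ Omega T).
Implicit Types phi d : TX -> R.

Lemma driving_force_lipschitz phi1 d1 phi2 d2 z :
  `|driving_force beta r phi1 d1 z - driving_force beta r phi2 d2 z| <=
  beta * (`|d1 z - d2 z| + `|phi1 z - phi2 z|).
Proof.
rewrite /driving_force.
have h : `|d1 z - phi1 z - (d2 z - phi2 z)| <= `|d1 z - d2 z| + `|phi1 z - phi2 z|.
  apply: le_trans (ler_normB _ _); rewrite le_eqVlt; apply/orP; left.
  by apply/eqP; congr `| _ |; ring.
apply: le_trans (ler_wpM2l (ltW beta0) h).
move: (d1 z - phi1 z) (d2 z - phi2 z) => a b.
have -> : beta * `|a - b| = `|beta * a - beta * b|.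
  by rewrite -mulrBr normrM (gtr0_norm beta0).
rewrite !mulNr; move: (beta * a) (beta * b) => x y.
rewrite ler_norml; have := ler_norm (x - y); have := ler_norm (y - x).
rewrite distrC; move: (`|x - y|) => n h1 h2.
rewrite /Num.max; case: ltP => h3; case: ltP => h4; apply/andP; split; lra.
Qed.

Lemma driving_force_Lfun2 phi d : phi \in Lfun muQ 2%:E -> d \in Lfun muQ 2%:E ->
  driving_force beta r phi d \in Lfun muQ 2%:E.
Proof.
move=> phiL dL; apply: (@Lfun2_dom _ _ _ _ _ (fun z => beta * (d \- phi) z)).
- apply: measurable_maxr => //; apply: measurable_funB => //.
  apply: measurable_funM => //; apply: measurable_funB.
    exact: Lfun2_measurable dL.
  exact: Lfun2_measurable phiL.
- by apply: Lfun2Z; exact: Lfun2B.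
(* Since r > 0, max(-x - r, 0) is at most |x|. *)
- move=> z; rewrite /driving_force/= mulNr; move: (beta * _) => x.
  rewrite /Num.max; case: ltP => h; rewrite ?normr0//.
  rewrite (ger0_norm h) -normrN; apply: le_trans (ler_norm _).
  by rewrite gerBl ltW.
Qed.

End driving_force.

(** * Consequences of the continuous state equation *)

Section state_facts.
Context (R : realType) (N : nat) (Omega : polyhedral_domain R N).
Variables (T alpha beta delta r : R).
Hypotheses (T0 : 0 < T) (alpha0 : 0 < alpha) (beta0 : 0 < beta) (delta0 : 0 < delta)
  (r0 : 0 < r).
Local Notation TX := (measurableTypeR R * 'rV[R]_N)%type.
Local Notation muQ := (muQ Omega T).
Variables (l : TX -> R) (d0 : 'rV[R]_N -> R) (phi d : TX -> R).
Hypothesis lX : in_X Omega T l.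
Hypothesis sol : state_solution Omega T alpha beta delta r l d0 phi d.
Local Notation aQ := (aform muQ alpha beta).

Lemma state_elliptic : exists Gphi, V_grad Omega T phi Gphi /\
  forall psi Gpsi, V_grad Omega T psi Gpsi ->
    aQ Gphi Gpsi phi psi = ip muQ (fun z => l z + beta * d z) psi.
Proof.
have [Gphi [d' [Hphi Hd _ H]]] := sol; exists Gphi; split => // psi Gpsi Hpsi.
have [phiL _] := V_grad_allL2 Hphi; have [psiL _] := V_grad_allL2 Hpsi.
have [dL _ _] := Hd; have [l' [lL _ _]] := lX.
(* The test lam = 0 isolates the elliptic equation. *)
have /(H _ _ _ Hpsi) : in_X Omega T (cst 0).
  exists (cst 0); split; [exact: Lfun2_cst0|exact: Lfun2_cst0|].
  move=> eta _; apply: aeW => x _.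
  by rewrite -[LHS]/(ip _ (cst 0) _) -[X in - X]/(ip _ (cst 0) _) !ip0l oppr0.
rewrite !ip0r mulr0 !addr0 ipBl// ip_lin// => <-.
by rewrite /aform /ip_grad; ring.
Qed.

Lemma state_phi_in_X : in_X Omega T phi.
Proof.
have [Gphi [Hphi H]] := state_elliptic.
have [_ [d' [_ Hd _ _]]] := sol; have [l' Hl] := lX.
exact: (elliptic_in_X T0 alpha0 beta0 Hphi (is_dt_lin T0 beta Hl Hd) H).
Qed.

Lemma state_dt_d : is_dt Omega T d (fun z => delta^-1 * driving_force beta r phi d z).
Proof.
have [Gphi [d' [Hphi Hd _ H]]] := sol.
have [phiL _] := V_grad_allL2 Hphi; have [dL _ _] := Hd.
have fL := driving_force_Lfun2 beta r0 phiL dL.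
apply: (is_dt_of_test T0 Hd); first exact: Lfun2Z.
move=> lam lamX; have [lam' [lamL _ _]] := lamX.
(* The test psi = 0 isolates the evolution equation. *)
have := H _ _ _ (@V_grad0 _ _ Omega T) lamX.
rewrite !ip0r mulr0 addr0 add0r ipZl// => <-.
by rewrite /ip_grad big1 ?mulr0 ?add0r// => i _; rewrite ip0r.
Qed.

End state_facts.

(** * One time interval *)

Section interval.
Context (R : realType) (N : nat) (Omega : polyhedral_domain R N).
Variables (T a b : R).
Hypotheses (T0 : 0 < T) (a0 : 0 <= a) (ab : a < b) (bT : b <= T).
Local Notation TX := (measurableTypeR R * 'rV[R]_N)%type.
Local Notation leb := (@lebesgue_measure R).
Local Notation muI := (@muI R T).
Local Notation muO := (muO Omega).
Local Notation muQ := (muQ Omega T).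
Implicit Types (u v : TX -> R) (w chi : 'rV[R]_N -> R).

Definition slab (t : measurableTypeR R) : R := ind `]a, b]%classic t.

Definition cut u : TX -> R := fun z => slab z.1 * u z.

Let Of : (muO setT < +oo)%E := muO_fin Omega.

Lemma slab_Lfun2 : slab \in Lfun muI 2%:E.
Proof. exact: ind_Lfun2. Qed.

Lemma cut_Lfun2 u : u \in Lfun muQ 2%:E -> cut u \in Lfun muQ 2%:E.
Proof. exact: tind_Lfun2. Qed.

Lemma ip_cut u v : ip muQ (cut u) (cut v) = ip muQ u (cut v).
Proof.
by apply: eq_Rintegral => z _; rewrite /cut mulrACA indM mulrCA.
Qed.

Let ae_neq (c : R) : {ae muI, forall t, t != c}.
Proof.
apply: ae_restr; exists [set c]; split; [exact: measurable_set1|exact: lebesgue_measure_set1|].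
by move=> t /= /not_implyP[_ /negP]; rewrite negbK => /eqP.
Qed.

(** The discretisation uses ]a, b], differences of [prim] use [a,
    b[, and the length is computed on ]a, b[; the three indicators differ only at a and b. *)
Let ae_slab : {ae muI, forall t, slab t = ind `]a, b[%classic t /\
  slab t = ind `[a, b[%classic t}.
Proof.
apply: (@filterS2 _ _ (ae_filter_ringOfSetsType muI)) (ae_neq a) (ae_neq b) => t ta tb.
have E : (t < b) = (t <= b) by rewrite lt_neqAle tb.
have E' : (a < t) = (a <= t) by rewrite lt_neqAle eq_sym ta.
rewrite /slab/ind !indicE; split; congr (nat_of_bool _)%:R; apply/idP/idP;
  by rewrite !inE/= !in_itv/= E ?E'.
Qed.

Lemma Rintegral_slab : \int[muI]_t slab t = b - a.
Proof.
rewrite (@ae_eq_Rintegral _ _ _ _ _ (ind `]a, b[%classic)); last 3 first.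
- exact: measurable_ind.
- exact: measurable_ind.
- by apply: filterS ae_slab => t [].
rewrite Rintegral_muI_supp//; last 2 first.
- exact: measurable_ind.
- move=> x xT; rewrite indF//= in_itv/= => /andP[ax xb].
  by move: xT; rewrite (le_lt_trans a0 ax) (lt_le_trans xb bT).
by rewrite /Rintegral/ind integral_indic//= setIT lebesgue_measure_itv/= lte_fin ab -EFinB.
Qed.

Lemma prim_slab (w : measurableTypeR R -> R) : muI.-integrable setT (EFin \o w) ->
  prim T w b - prim T w a = \int[muI]_t (w t * slab t).
Proof.
move=> wi; rewrite (prim_diff (ltW ab) wi).
have /measurable_EFinP mw := measurable_int _ wi.
apply: ae_eq_Rintegral.
- by apply: measurable_funM => //; exact: measurable_ind.
- by apply: measurable_funM => //; exact: measurable_ind.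
- by apply: filterS ae_slab => t [_ ->]; rewrite mulrC.
Qed.

Lemma ip_slab : ip muI slab slab = b - a.
Proof. by rewrite /ip; under eq_Rintegral do rewrite indM; exact: Rintegral_slab. Qed.

Lemma cut_tensor chi : cut (tensor slab chi) = tensor slab chi.
Proof. by apply/funext => z; rewrite /cut/tensor mulrA indM. Qed.

Lemma slab_tensor_Lfun2 chi : chi \in Lfun muO 2%:E -> tensor slab chi \in Lfun muQ 2%:E.
Proof. by move=> cL; exact: tensor_Lfun2 slab_Lfun2 cL. Qed.

Lemma ip_tensor_slab chi : chi \in Lfun muO 2%:E ->
  ip muQ (tensor slab chi) (tensor slab chi) = (b - a) * ip muO chi chi.
Proof.
move=> cL; have tL := slab_tensor_Lfun2 cL.
have sL := slab_Lfun2.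
rewrite (ip_tensor Of tL sL cL).
rewrite (_ : timeint _ _ _ = (fun x => (b - a) * chi x)) ?ipZl//.
apply/funext => x; rewrite -ip_slab -RintegralZr//; last exact: integrable_ip.
by apply: eq_Rintegral => t _; rewrite /tensor/=; ring.
Qed.

Definition offset v w : TX -> R := v \- (fun z => w z.2).

Lemma offset_Lfun2 v w : v \in Lfun muQ 2%:E -> w \in Lfun muO 2%:E ->
  offset v w \in Lfun muQ 2%:E.
Proof. by move=> vL wL; apply: Lfun2B => //; exact: (snd_Lfun2 T0). Qed.

(** A discrete function equals its value w on I_m only up to a null set of Omega at each time; this
    lets it be replaced by w in L^2 norms over the interval. *)
Lemma cut_const_norm0 v w : v \in Lfun muQ 2%:E -> w \in Lfun muO 2%:E ->
  (forall s, a < s <= b -> at_time v s = w %[ae muO]) ->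
  ip muQ (cut (offset v w)) (cut (offset v w)) = 0.
Proof.
move=> vL wL H; set h := cut _.
have hL : h \in Lfun muQ 2%:E.
  by apply: cut_Lfun2; exact: offset_Lfun2.
rewrite (ip_fubini1 hL hL) (@ae_eq_Rintegral _ _ _ _ _ (cst 0)).
- by rewrite Rintegral_cst// mul0r.
- have /measurable_EFinP := measurable_int _ (integrable_ip1 hL hL); exact.
- exact: measurable_cst.
apply: filterS (ae_slice1_Lfun2 hL) => t htL.
rewrite (@ae_eq_ip _ _ _ _ _ (cst 0))// ?ip0l ?Lfun2_cst0//.
have [th|th] := pselect (`]a, b]%classic t); last first.
  by apply: aeW => x; rewrite /h/cut/slab/= indF// mul0r.
have {}H : at_time v t = w %[ae muO] by apply: H; move: th; rewrite /= in_itv.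
apply: filterS H => x /(_ Logic.I); rewrite /at_time /h/cut/offset/= => ->.
by rewrite subrr mulr0.
Qed.

(** The value at b of the representative w + int v'. Written with [timeint], it lies in L^2(Omega)
    at once. *)
Definition end_value v' w x := w x + timeint muI v' (ind `]-oo, b[%classic) x.

Lemma end_valueE v' w x :
  end_value v' w x = w x + prim T (fun t => v' (t, x)) b.
Proof. by congr (_ + _); apply: eq_Rintegral => t _; rewrite mulrC. Qed.

Lemma end_value_Lfun2 v' w : v' \in Lfun muQ 2%:E -> w \in Lfun muO 2%:E ->
  end_value v' w \in Lfun muO 2%:E.
Proof.
move=> v'L wL; apply: Lfun2D => //; apply: timeint_Lfun2 => //.
exact: ind_Lfun2.
Qed.

Lemma cut_initial v v' w : v \in Lfun muQ 2%:E -> v' \in Lfun muQ 2%:E ->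
  w \in Lfun muO 2%:E ->
  {ae muO, forall x,
    {ae muI, forall t, v (t, x) = w x + prim T (fun t => v' (t, x)) t}} ->
  ip muQ (cut (offset v (end_value v' w))) (cut (offset v (end_value v' w)))
  <= (b - a) ^+ 2 * ip muQ (cut v') (cut v').
Proof.
move=> vL v'L wL H; have eL := end_value_Lfun2 v'L wL.
set h := cut (offset _ _).
have hL : h \in Lfun muQ 2%:E.
  by apply: cut_Lfun2; exact: offset_Lfun2.
have cL := cut_Lfun2 v'L.
rewrite (ip_fubini2 hL hL) (ip_fubini2 cL cL) -RintegralZl//; last exact: integrable_ip2.
apply: ae_le_Rintegral => //.
- exact: integrable_ip2.
- exact: (integrableZl measurableT ((b - a) ^+ 2) (integrable_ip2 cL cL)).
- by move=> x; exact: ip_ge0.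
apply: filterS3 H (ae_slice2_Lfun2 vL) (ae_slice2_Lfun2 v'L) => x vx vxL v'xL.
have := prim_anchored T0 a0 (ltW ab) bT vxL v'xL vx.
rewrite -end_valueE; congr (_ <= _ * _); apply: eq_Rintegral => t _.
- by rewrite /h/cut/offset/= mulrACA indM expr2.
- by rewrite /cut/= mulrACA indM expr2.
Qed.

(** At fixed x the function q = v - w is shifted by k so that q + k = v - c' is anchored at b.
    Passing back to q costs at most the squared time integral of q divided by b - a, whatever the
    unknown k is. *)
Lemma cut_mean v v' w : is_dt Omega T v v' -> w \in Lfun muO 2%:E ->
  ip muQ (cut (offset v w)) (cut (offset v w)) <= (b - a) ^+ 2 * ip muQ (cut v') (cut v') +
    (b - a)^-1 * ip muO (timeint muI (offset v w) slab) (timeint muI (offset v w) slab).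
Proof.
move=> Hv wL; set q := offset v w; have [vL v'L _] := Hv.
have qL : q \in Lfun muQ 2%:E by exact: offset_Lfun2.
have zL := timeint_Lfun2 Of qL slab_Lfun2.
have hL := cut_Lfun2 qL; have cL := cut_Lfun2 v'L.
have tau0 : 0 < b - a by rewrite subr_gt0.
have i1 := integrable_ip2 cL cL; have i2 := integrable_ip zL zL.
rewrite (ip_fubini2 hL hL) (ip_fubini2 cL cL) [X in _ + _ * X]/ip.
rewrite -RintegralZl// -RintegralZl//.
rewrite -RintegralD//; last 2 first.
- exact: (integrableZl measurableT ((b - a) ^+ 2) i1).
- exact: (integrableZl measurableT (b - a)^-1 i2).
apply: ae_le_Rintegral => //.
- exact: integrable_ip2.
- exact: (integrableD measurableT (integrableZl measurableT ((b - a) ^+ 2) i1)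
    (integrableZl measurableT (b - a)^-1 i2)).
- by move=> x; exact: ip_ge0.
apply: filterS3 (is_dt_rep T0 Hv) (filterI (ae_slice2_Lfun2 vL) (ae_slice2_Lfun2 qL))
  (ae_slice2_Lfun2 v'L).
move=> x [c vx] [vxL qxL] v'xL.
have h := prim_anchored T0 a0 (ltW ab) bT vxL v'xL vx.
have -> : ip muI (fun t => cut v' (t, x)) (fun t => cut v' (t, x)) =
    \int[muI]_t (ind `]a, b]%classic t * v' (t, x) ^+ 2).
  by apply: eq_Rintegral => t _; rewrite /cut/= mulrACA indM expr2.
apply: le_trans (lerD h (lexx _)).
set c' := c + prim T _ b; pose k := w x - c'.
have JqL : (fun t => slab t * q (t, x)) \in Lfun muI 2%:E by exact: Lfun2_ind.
have -> : \int[muI]_t (ind `]a, b]%classic t * (v (t, x) - c') ^+ 2) =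
    ip muI ((fun t => slab t * q (t, x)) \+ (fun t => k * slab t))
      ((fun t => slab t * q (t, x)) \+ (fun t => k * slab t)).
  apply: eq_Rintegral => t _; rewrite /q/offset/k/= -{1}[ind _ t]indM -/slab -/(slab t); ring.
have sL := slab_Lfun2.
rewrite ip_sqDl//; last exact: Lfun2Z.
rewrite (ipZr k sL JqL) (ipZl k sL (Lfun2Z k sL)) (ipZr k sL sL).
rewrite ip_slab [ip _ _ slab](_ : _ = timeint muI q slab x); last first.
  by apply: eq_Rintegral => t _; rewrite mulrAC indM mulrC.
rewrite -[X in X <= _]/(ip muI (fun t => slab t * q (t, x)) (fun t => slab t * q (t, x))).
move: (ip _ _ _) (timeint _ _ _ _) (b - a) tau0 => y z tau tau0.
rewrite -!addrA lerDl.
(* Completing the square in k, with z the time integral of q at x. *)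
have -> : 2 * (k * z) + (k * (k * tau) + tau^-1 * (z * z)) = tau^-1 * (k * tau + z) ^+ 2.
  by field; rewrite gt_eqF.
by rewrite mulr_ge0 ?sqr_ge0 ?invr_ge0 ?ltW.
Qed.

End interval.

(** * The discrete equations *)

Section partition.
Context (R : realType) (T : R) (M : nat) (t : nat -> R).
Hypothesis Ht : is_partition T M t.

Lemma partition_le j k : (j <= k)%N -> (k <= M)%N -> t j <= t k.
Proof.
have [_ _ inc] := Ht.
elim: k => [|k IH]; first by rewrite leqn0 => /eqP ->.
rewrite leq_eqVlt => /orP[/eqP->//|]; rewrite ltnS => jk kM.
by apply: le_trans (IH jk (ltnW kM)) _; exact/ltW/inc.
Qed.

Lemma partition_bound j : (j <= M)%N -> 0 <= t j <= T.
Proof.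
have [<- <- _] := Ht => jM.
by rewrite !partition_le.
Qed.

Lemma partition_step m : (0 < m <= M)%N ->
  [/\ 0 <= t m.-1, t m.-1 < t m & t m <= T].
Proof.
have [_ _ inc] := Ht; case: m => // m /= mM.
have /andP[t0 _] := partition_bound (ltnW mM).
by have /andP[_ tT] := partition_bound mM; rewrite inc.
Qed.

Lemma slab_partition m j (s : R) : (0 < m <= M)%N -> (0 < j <= M)%N ->
  t j.-1 < s <= t j -> slab (t m.-1) (t m) s = (j == m)%:R.
Proof.
case: m => // m /= mM; case: j => // j /= jM /andP[js sj].
rewrite eqSS; have [<-|jm] := eqVneq j m; first by rewrite /slab indT//= in_itv/= js.
rewrite /slab indF//= in_itv/= => /andP[ms sm].
move: jm; rewrite neq_ltn => /orP[jm|mj].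
  have := lt_le_trans ms sj; rewrite ltNge partition_le//.
  exact: ltnW.
have := lt_le_trans js sm; rewrite ltNge partition_le//.
exact: ltnW.
Qed.

Lemma slab_node m j : (0 < m <= M)%N -> (0 < j <= M)%N ->
  slab (t m.-1) (t m) (t j) = (j == m)%:R.
Proof.
move=> mM jM; apply: slab_partition => //.
by have [_ -> _] := partition_step jM; rewrite lexx.
Qed.

End partition.

Section discrete_tests.
Context (R : realType) (N : nat) (Omega : polyhedral_domain R N).
Variables (T : R) (M : nat) (t : nat -> R).
Hypotheses (T0 : 0 < T) (Ht : is_partition T M t).
Local Notation TX := (measurableTypeR R * 'rV[R]_N)%type.
Local Notation muI := (@muI R T).
Local Notation muO := (muO Omega).
Local Notation muQ := (muQ Omega T).
Implicit Types (p chi : 'rV[R]_N -> R).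

Local Notation J m := (slab (t m.-1) (t m)).

Let at_tensor m chi s : at_time (tensor (J m) chi) s = (fun x => J m s * chi x).
Proof. by []. Qed.

Let P0_tensor (Y : set ('rV[R]_N -> R)) m chi : (0 < m <= M)%N ->
  (forall c : R, Y (fun x => c * chi x)) ->
  piecewise_P0 Omega M t Y (tensor (J m) chi).
Proof.
move=> mM YZ j jM; split; first exact: (YZ (J m (t j))).
move=> s sj; rewrite /value !at_tensor (slab_partition Ht mM jM sj).
rewrite (slab_node Ht mM jM); exact: aeW.
Qed.

Lemma Vtau_tensor m p gp : (0 < m <= M)%N -> H10_grad Omega p gp ->
  Vtau_grad Omega T M t (tensor (J m) p) (fun i => tensor (J m) (gp i)).
Proof.
move=> mM Hp; split; first exact: (V_grad_tensor (slab_Lfun2 _ _ T0) Hp).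
apply: P0_tensor => // c; exists (fun i x => c * gp i x).
exact: H10_gradZ.
Qed.

Lemma Xtau_tensor m chi : (0 < m <= M)%N -> chi \in Lfun muO 2%:E ->
  in_Xtau Omega T M t (tensor (J m) chi).
Proof.
move=> mM cL; split; first exact: (tensor_Lfun2 (slab_Lfun2 _ _ T0) cL).
by apply: P0_tensor => // c; exact: Lfun2Z.
Qed.

Lemma Vtau_grad0 : Vtau_grad Omega T M t (cst 0) (fun=> cst 0).
Proof.
split; first exact: V_grad0.
move=> j jM; split; last by move=> s _; exact: aeW.
by exists (fun=> cst 0); exact: H10_grad0.
Qed.

Lemma Xtau0 : in_Xtau Omega T M t (cst 0).
Proof.
split; first exact: Lfun2_cst0.
move=> j jM; split; last by move=> s _; exact: aeW.
exact: Lfun2_cst0.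
Qed.

Lemma value_tensor m j chi : (0 < m <= M)%N -> (0 < j <= M)%N ->
  value t (tensor (J m) chi) j = (fun x => (j == m)%:R * chi x).
Proof. by move=> mM jM; rewrite /value at_tensor (slab_node Ht mM jM). Qed.

End discrete_tests.

Section discrete_equations.
Context (R : realType) (N : nat) (Omega : polyhedral_domain R N).
Variables (T alpha beta delta r : R).
Hypotheses (T0 : 0 < T) (alpha0 : 0 < alpha) (beta0 : 0 < beta) (delta0 : 0 < delta)
  (r0 : 0 < r).
Variables (M : nat) (t : nat -> R).
Hypothesis Ht : is_partition T M t.
Local Notation TX := (measurableTypeR R * 'rV[R]_N)%type.
Local Notation muI := (@muI R T).
Local Notation muO := (muO Omega).
Local Notation muQ := (muQ Omega T).
Local Notation aQ := (aform muQ alpha beta).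
Local Notation J m := (slab (t m.-1) (t m)).
Variables (l : TX -> R) (d0 : 'rV[R]_N -> R) (phitau dtau : TX -> R).
Hypotheses (lL : l \in Lfun muQ 2%:E) (d0L : d0 \in Lfun muO 2%:E).
Hypothesis sol : semidiscrete_solution Omega T alpha beta delta r l d0 M t phitau dtau.

Lemma discrete_elliptic : exists Gphi, V_grad Omega T phitau Gphi /\
  forall m p gp, (0 < m <= M)%N -> H10_grad Omega p gp ->
    aQ Gphi (fun i => tensor (J m) (gp i)) phitau (tensor (J m) p) =
    ip muQ (fun z => l z + beta * dtau z) (tensor (J m) p).
Proof.
have [Gphi [[Hphi _] [dL _] H]] := sol; exists Gphi; split => // m p gp mM Hp.
have [phiL _] := V_grad_allL2 Hphi; have [pL _] := H10_grad_allL2 Hp.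
have tL := tensor_Lfun2 (slab_Lfun2 (t m.-1) (t m) T0) pL.
have := H _ _ _ (Vtau_tensor T0 Ht mM Hp) (@Xtau0 _ _ Omega T M t).
have v0 j : value t (cst 0 : TX -> R) j = cst 0 by [].
rewrite big1; last by move=> j _; rewrite v0 ip0r.
rewrite v0 !ip0r mulr0 !addr0 (ipBl phiL dL tL) (ip_lin beta lL dL tL) => <-.
by rewrite /aform /ip_grad; ring.
Qed.

(** Setting the value at 0 to d0 gives the first step the same form as the later jumps. *)
Definition nodal m : 'rV[R]_N -> R := if m is 0%N then d0 else value t dtau m.

Lemma nodal_Lfun2 m : (m <= M)%N -> nodal m \in Lfun muO 2%:E.
Proof.
have [Gphi [_ [_ dP] _]] := sol.
by case: m => // m mM; have [] := dP m.+1 mM.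
Qed.

(** The test is supported on I_m, so only one jump survives. *)
Lemma discrete_d m chi : (0 < m <= M)%N -> chi \in Lfun muO 2%:E ->
  ip muO (nodal m \- nodal m.-1) chi =
  delta^-1 * ip muQ (driving_force beta r phitau dtau) (tensor (J m) chi).
Proof.
move=> mM cL.
have [Gphi [_ _ H]] := sol.
have := H _ _ _ (@Vtau_grad0 _ _ Omega T M t) (Xtau_tensor T0 Ht mM cL).
rewrite /ip_grad big1; last by move=> i _; rewrite ip0r.
rewrite !ip0r !mulr0 !add0r.
have M1 : (0 < 1 <= M)%N by case/andP: mM => m0 /(leq_trans m0).
rewrite (value_tensor Ht chi mM M1).
rewrite (eq_big_nat _ _ (F2 := fun j =>
  if j == m then ip muO (nodal m \- nodal m.-1) chi else 0)); last first.
  move=> j /andP[j2 jM]; rewrite (value_tensor Ht chi mM); last by rewrite (ltn_trans _ j2).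
  have [jm|_] := eqVneq j m.
    rewrite jm in j2 *.
    rewrite (_ : (fun x => 1%:R * chi x) = chi); last by apply/funext => x; rewrite mul1r.
    by case: (m) j2 => [|[|k]].
  by rewrite (_ : (fun x => _) = cst 0) ?ip0r//; apply/funext => x; rewrite mul0r.
rewrite -big_mkcond big_nat1_eq.
(* The sum of jumps starts at 2: for m = 1 it contributes nothing, and the jump from d0 comes from
   the two initial terms instead. *)
have [m1|m1] := eqVneq m 1%N.
  rewrite m1 /= add0r (_ : (fun x => 1%:R * chi x) = chi); last first.
    by apply/funext => x; rewrite mul1r.
  have vL : value t dtau 1 \in Lfun muO 2%:E by case/andP: M1 => _ /nodal_Lfun2.
  by move=> h; rewrite (ipBl vL d0L cL) h addrK.
rewrite (_ : (fun x => _) = cst 0); last by apply/funext => x; rewrite mul0r.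
rewrite !ip0r !addr0; case/andP: mM => m0 mM'.
by rewrite ltnS mM' andbT ltn_neqAle eq_sym m1 m0.
Qed.

End discrete_equations.

(** * Error recursion *)

Section L2_sqrt_norm.
Context d (X : measurableType d) (R : realType) (mu : {measure set X -> \bar R}).
Local Notation nrm u := (Num.sqrt (ip mu u u)).

Lemma sqr_nrm u : nrm u ^+ 2 = ip mu u u.
Proof. by rewrite sqr_sqrtr// ip_ge0. Qed.

Lemma ae_eq_nrm u v : u \in Lfun mu 2%:E -> v \in Lfun mu 2%:E ->
  {ae mu, forall x, u x = v x} -> nrm u = nrm v.
Proof.
by move=> uL vL uv; rewrite (ae_eq_ip uL vL uv uL) ipC (ae_eq_ip uL vL uv vL).
Qed.

End L2_sqrt_norm.

Section local_estimates.
Context (R : realType) (N : nat) (Omega : polyhedral_domain R N).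
Variables (T alpha beta delta r : R).
Hypotheses (T0 : 0 < T) (alpha0 : 0 < alpha) (beta0 : 0 < beta) (delta0 : 0 < delta)
  (r0 : 0 < r).
Variables (M : nat) (t : nat -> R).
Hypothesis Ht : is_partition T M t.
Local Notation TX := (measurableTypeR R * 'rV[R]_N)%type.
Local Notation muI := (@muI R T).
Local Notation muO := (muO Omega).
Local Notation muQ := (muQ Omega T).
Local Notation aQ := (aform muQ alpha beta).
Local Notation nQ u := (Num.sqrt (ip muQ u u)).
Local Notation nO w := (Num.sqrt (ip muO w w)).
Variables (l : TX -> R) (d0 : 'rV[R]_N -> R).
Variables (phi d phitau dtau dt_phi dt_d : TX -> R).
Hypotheses (lX : in_X Omega T l) (d0L : d0 \in Lfun muO 2%:E).
Hypothesis sol : state_solution Omega T alpha beta delta r l d0 phi d.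
Hypothesis sold : semidiscrete_solution Omega T alpha beta delta r l d0 M t phitau dtau.
Hypotheses (Hphi : is_dt Omega T phi dt_phi) (Hd : is_dt Omega T d dt_d).

Let f := driving_force beta r phi d.
Let ftau := driving_force beta r phitau dtau.

Let phiL : phi \in Lfun muQ 2%:E. Proof. by have [] := Hphi. Qed.
Let dL : d \in Lfun muQ 2%:E. Proof. by have [] := Hd. Qed.
Let dphiL : dt_phi \in Lfun muQ 2%:E. Proof. by have [] := Hphi. Qed.
Let ddL : dt_d \in Lfun muQ 2%:E. Proof. by have [] := Hd. Qed.
Let lL : l \in Lfun muQ 2%:E. Proof. by have [l' []] := lX. Qed.
Let dtauL : dtau \in Lfun muQ 2%:E. Proof. by have [? [_ []]] := sold. Qed.
Let phitauL : phitau \in Lfun muQ 2%:E.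
Proof. by have [? [[/V_grad_allL2[]]]] := sold. Qed.
Let fL : f \in Lfun muQ 2%:E. Proof. exact: driving_force_Lfun2. Qed.
Let ftauL : ftau \in Lfun muQ 2%:E. Proof. exact: driving_force_Lfun2. Qed.
Let Of : (muO setT < +oo)%E := muO_fin Omega.

Let initial : initial_value Omega T d d0.
Proof. by have [? [? []]] := sol. Qed.

Definition nodal_error (m : nat) : 'rV[R]_N -> R :=
  end_value T (t m) dt_d d0 \- nodal t d0 dtau m.

Local Notation E := nodal_error.

Lemma nodal_error_Lfun2 m : (m <= M)%N -> E m \in Lfun muO 2%:E.
Proof.
move=> mM; apply: Lfun2B; last exact: (nodal_Lfun2 d0L sold mM).
exact: end_value_Lfun2.
Qed.

Lemma nodal_error0 : nO (E 0%N) = 0.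
Proof.
have [t0 _ _] := Ht.
rewrite (@ae_eq_nrm _ _ _ _ _ (cst 0)) ?ip0l ?sqrtr0 ?nodal_error_Lfun2 ?Lfun2_cst0//.
apply: filterS (ae_slice2_Lfun2 ddL) => x dx.
rewrite /nodal_error/= end_valueE t0 prim_le0 ?addr0 ?subrr//.
exact: Lfun2_integrable.
Qed.

Section one_interval.
Variable m : nat.
Hypothesis mM : (m < M)%N.
Local Notation a := (t m).
Local Notation b := (t m.+1).
Local Notation tau := (b - a).
Local Notation J := (slab a b).
Local Notation cut := (cut a b).

Let m1M : (0 < m.+1 <= M)%N := mM.
Let a0 : 0 <= a. Proof. by have [] := partition_step Ht m1M. Qed.
Let ab : a < b. Proof. by have [] := partition_step Ht m1M. Qed.
Let bT : b <= T. Proof. by have [] := partition_step Ht m1M. Qed.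
Let tau0 : 0 < tau. Proof. by rewrite subr_gt0. Qed.
Let JL : J \in Lfun muI 2%:E. Proof. exact: slab_Lfun2. Qed.

Let nQ_tensor chi : chi \in Lfun muO 2%:E ->
  nQ (tensor J chi) = Num.sqrt tau * nO chi.
Proof. by move=> cL; rewrite ip_tensor_slab// sqrtrM// ltW. Qed.

Let nQ_cut_le u v : cut u \in Lfun muQ 2%:E -> v \in Lfun muQ 2%:E ->
  (forall z, `|u z| <= v z) -> nQ (cut u) <= nQ (cut v).
Proof.
move=> cuL vL uv; have cvL : cut v \in Lfun muQ 2%:E by exact: cut_Lfun2.
rewrite ler_wsqrtr//; apply: le_Rintegral => //; try exact: integrable_ip.
move=> z _; rewrite /cut mulrACA [X in _ <= X]mulrACA indM.
apply: ler_wpM2l; first exact: ind_ge0.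
by rewrite -!expr2 -real_normK ?num_real// lerXn2r ?nnegrE// (le_trans _ (uv z)).
Qed.

Let abs_cut u : u \in Lfun muQ 2%:E ->
  (fun z => `|u z|) \in Lfun muQ 2%:E /\ nQ (cut (fun z => `|u z|)) = nQ (cut u).
Proof.
move=> uL; split.
  apply: (Lfun2_dom _ uL) => [|z]; last by rewrite normr_id.
  by apply: measurableT_comp => //; exact: Lfun2_measurable uL.
rewrite (_ : ip muQ (cut _) _ = ip muQ (cut u) (cut u))//.
rewrite /ip; apply: eq_Rintegral => z _; rewrite /cut mulrACA [RHS]mulrACA.
by rewrite -(normrM (u z)) -expr2 ger0_norm ?sqr_ge0// expr2.
Qed.

(** [dt_d] and delta^-1 f are both weak derivatives of d with initial value d0, so their primitives
    agree at the nodes, and the increment of d can be read off from the driving force. *)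
Let ae_increment : {ae muO, forall x,
  end_value T b dt_d d0 x - end_value T a dt_d d0 x =
  timeint muI (fun z => delta^-1 * f z) J x}.
Proof.
have Hf : is_dt Omega T d (fun z => delta^-1 * f z) := state_dt_d T0 r0 sol.
have [_ FL _] := Hf.
apply: filterS3 (initial_rep T0 Hd d0L initial) (initial_rep T0 Hf d0L initial)
  (filterI (ae_slice2_Lfun2 ddL) (ae_slice2_Lfun2 FL)) => x h1 h2 [dx Fx].
have U := @prim_rep_unique _ _ T0 _ _ (d0 x) (d0 x) dx Fx
  (@filterS2 _ _ (ae_filter_ringOfSetsType muI) _ _ _
    (fun s (e1 : d (s, x) = _) (e2 : d (s, x) = _) => etrans (esym e1) e2) h1 h2).
have aT : 0 <= a <= T by rewrite a0 (le_trans (ltW ab)).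
have bT' : 0 <= b <= T by rewrite bT (le_trans a0) ?ltW.
rewrite !end_valueE (U _ aT) (U _ bT') opprD addrACA subrr add0r.
rewrite (prim_slab ab)//.
exact: Lfun2_integrable.
Qed.

(* The evolution equation integrated over the interval, minus the discrete one. *)
Let increment_eq chi : chi \in Lfun muO 2%:E ->
  ip muO (E m.+1 \- E m) chi =
  delta^-1 * ip muQ (cut (f \- ftau)) (tensor J chi).
Proof.
move=> cL.
have FL : (fun z => delta^-1 * f z) \in Lfun muQ 2%:E by exact: Lfun2Z.
have bL : end_value T b dt_d d0 \in Lfun muO 2%:E by exact: end_value_Lfun2.
have aL : end_value T a dt_d d0 \in Lfun muO 2%:E by exact: end_value_Lfun2.
have nbL : nodal t d0 dtau m.+1 \in Lfun muO 2%:E by exact: (nodal_Lfun2 d0L sold).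
have naL : nodal t d0 dtau m \in Lfun muO 2%:E by exact: (nodal_Lfun2 d0L sold (ltnW mM)).
have tL := slab_tensor_Lfun2 a b T0 cL.
rewrite -(cut_tensor a b) ip_cut cut_tensor (ipBl fL ftauL tL) mulrBr.
rewrite -(discrete_d T0 Ht d0L sold m1M cL)/= -ipZl// (ip_tensor Of FL JL cL).
have -> : ip muO (timeint muI (fun z => delta^-1 * f z) J) chi =
    ip muO (end_value T b dt_d d0 \- end_value T a dt_d d0) chi.
  apply: ae_eq_ip => //; first exact: timeint_Lfun2.
    exact: Lfun2B.
  by apply: filterS ae_increment => x hx; exact: esym hx.
rewrite -(ipBl (Lfun2B bL aL) (Lfun2B nbL naL) cL).
by congr (ip _ _ _); apply/funext => x; rewrite /nodal_error/=; ring.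
Qed.

Let x_ := nQ (cut (d \- dtau)).
Let y_ := nQ (cut (phi \- phitau)).

(** The difference of the integrated equations is tested with the new error itself. The norm of
    [tensor J (E m.+1)] supplies sqrt(tau), the Lipschitz constant supplies beta, and one factor of
    the error is divided out. *)
Lemma nodal_step : nO (E m.+1) <= nO (E m) + beta / delta * Num.sqrt tau * (x_ + y_).
Proof.
have EL : E m.+1 \in Lfun muO 2%:E by exact: nodal_error_Lfun2.
have EL' : E m \in Lfun muO 2%:E by exact: (nodal_error_Lfun2 (ltnW mM)).
have tL := slab_tensor_Lfun2 a b T0 EL.
have uL : cut (f \- ftau) \in Lfun muQ 2%:E by apply: cut_Lfun2 => //; exact: Lfun2B.
have ddL' : d \- dtau \in Lfun muQ 2%:E by exact: Lfun2B.
have ppL' : phi \- phitau \in Lfun muQ 2%:E by exact: Lfun2B.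
have eq := increment_eq EL; rewrite ipBl// in eq.
have c1 := le_trans (ler_norm _) (ip_CS EL' EL).
have c2 := le_trans (ler_norm _) (ip_CS uL tL).
rewrite nQ_tensor// in c2.
have c3 : nQ (cut (f \- ftau)) <= beta * (x_ + y_).
  have [dA dE] := abs_cut ddL'; have [pA pE] := abs_cut ppL'.
  have cdA : cut (fun z => `|(d \- dtau) z|) \in Lfun muQ 2%:E by exact: cut_Lfun2.
  have cpA : cut (fun z => `|(phi \- phitau) z|) \in Lfun muQ 2%:E by exact: cut_Lfun2.
  pose g z := beta * (`|(d \- dtau) z| + `|(phi \- phitau) z|).
  have gL : g \in Lfun muQ 2%:E by apply: Lfun2Z; exact: Lfun2D.
  apply: (@le_trans _ _ (nQ (cut g))).
    by apply: nQ_cut_le => // z; exact: driving_force_lipschitz.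
  have -> : cut g = fun z => beta * (cut (fun z => `|(d \- dtau) z|) \+
      cut (fun z => `|(phi \- phitau) z|)) z.
    by apply/funext => z; rewrite /cut/g/=; ring.
  have sL := Lfun2D cdA cpA.
  rewrite (ipZl beta sL (Lfun2Z beta sL)) (ipZr beta sL sL) mulrA -expr2.
  rewrite sqrtrM ?sqr_ge0// sqrtr_sqr gtr0_norm// ler_pM2l//.
  by rewrite /x_ /y_ -dE -pE; exact: ip_triangle.
rewrite -sqr_nrm in eq.
have s0 : 0 <= Num.sqrt tau := sqrtr_ge0 _.
have e0 : 0 <= nO (E m.+1) := sqrtr_ge0 _.
have dd0 : 0 < delta^-1 by rewrite invr_gt0.
have xy0 : 0 <= x_ + y_ by rewrite addr_ge0 ?sqrtr_ge0.
have c4 : ip muQ (cut (f \- ftau)) (tensor J (E m.+1)) <=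
    beta * (x_ + y_) * (Num.sqrt tau * nO (E m.+1)).
  by apply: le_trans c2 _; apply: ler_wpM2r => //; rewrite mulr_ge0.
have c5 : nO (E m.+1) ^+ 2 <=
    (nO (E m) + beta / delta * Num.sqrt tau * (x_ + y_)) * nO (E m.+1).
  rewrite -(subrK (ip muO (E m) (E m.+1)) (_ ^+ 2)) eq addrC mulrDl; apply: lerD => //.
  have := ler_wpM2l (ltW dd0) c4; congr (_ <= _); ring.
apply: (sqr_le_mul e0 _ c5).
by rewrite addr_ge0 ?sqrtr_ge0// !mulr_ge0 ?(ltW beta0) ?(ltW dd0).
Qed.

Lemma x_bound : x_ <= tau * nQ (cut dt_d) + Num.sqrt tau * nO (E m.+1).
Proof.
pose D := end_value T b dt_d d0; pose w := nodal t d0 dtau m.+1.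
have DL : D \in Lfun muO 2%:E by exact: end_value_Lfun2.
have wL : w \in Lfun muO 2%:E by exact: (nodal_Lfun2 d0L sold).
have EL : E m.+1 \in Lfun muO 2%:E by exact: nodal_error_Lfun2.
have g1L : cut (offset d D) \in Lfun muQ 2%:E by apply: cut_Lfun2 => //; exact: offset_Lfun2.
have g2L := slab_tensor_Lfun2 a b T0 EL.
have hL : cut (offset dtau w) \in Lfun muQ 2%:E by apply: cut_Lfun2 => //; exact: offset_Lfun2.
have h0 : ip muQ (cut (offset dtau w)) (cut (offset dtau w)) = 0.
  apply: cut_const_norm0 => // s sm.
  have [_ [_ [_ P] _]] := sold; have [_] := P m.+1 m1M.
  exact.
(* On I_m, d - d_tau splits into the oscillation d - d(t_m) and the nodal error, constant in
   time. *)
have -> : x_ = nQ (cut (offset d D) \+ tensor J (E m.+1)).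
  apply: ae_eq_nrm; [|exact: Lfun2D|].
    by apply: cut_Lfun2 => //; exact: Lfun2B.
  apply: filterS (ip_eq0_ae hL h0) => z.
  rewrite /cut/offset/tensor/nodal_error/= -/D -[value _ _ _]/w => hz.
  rewrite -[LHS]addr0 -hz; ring.
apply: le_trans (ip_triangle g1L g2L) _; rewrite nQ_tensor// lerD2r.
apply: sqrtr_le; first by rewrite mulr_ge0 ?sqrtr_ge0 ?ltW.
rewrite exprMn sqr_nrm; apply: cut_initial => //.
exact: initial_rep.
Qed.

(* Duality: [z] is tested against the solution [p] of the stationary problem
   with right-hand side [z]. *)
Lemma y_bound : y_ <= tau * nQ (cut dt_phi) + x_.
Proof.
have [G1 [V1 H1]] := state_elliptic lX sol.
have [G2 [V2 H2]] := discrete_elliptic T0 Ht lL sold.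
pose w := value t phitau m.+1.
have [_ [[_ phitauP] _ _]] := sold.
have [[gw /H10_grad_allL2[wL _]] wP] := phitauP m.+1 m1M.
have q'L : offset phi w \in Lfun muQ 2%:E by exact: offset_Lfun2.
pose q z := phi z + -1 * phitau z; pose Gq i z := G1 i z + -1 * G2 i z.
have Vq : V_grad Omega T q Gq by exact: V_grad_lin.
have [qL _] := V_grad_allL2 Vq.
have hL : cut (offset phitau w) \in Lfun muQ 2%:E.
  by apply: cut_Lfun2 => //; exact: offset_Lfun2.
have h0 : ip muQ (cut (offset phitau w)) (cut (offset phitau w)) = 0.
  by apply: cut_const_norm0.
have cqL : cut q \in Lfun muQ 2%:E by exact: cut_Lfun2.
have cq'L : cut (offset phi w) \in Lfun muQ 2%:E by exact: cut_Lfun2.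
have cqq' : {ae muQ, forall z, cut q z = cut (offset phi w) z}.
  apply: filterS (ip_eq0_ae hL h0) => z.
  rewrite /cut/offset/q/= => hz; rewrite -[LHS]addr0 -hz; ring.
(* tau times the mean of phi - phi_tau over the interval, as a function of x. *)
pose z := timeint muI (offset phi w) J.
have zL : z \in Lfun muO 2%:E by exact: timeint_Lfun2.
have tzL := slab_tensor_Lfun2 a b T0 zL.
have zz : ip muQ (tensor J z) q = ip muO z z.
  rewrite ipC -(cut_tensor a b) -ip_cut cut_tensor (ae_eq_ip cqL cq'L cqq' tzL).
  by rewrite -(cut_tensor a b) ip_cut cut_tensor (ip_tensor Of q'L JL zL).
have x0 : 0 <= x_ := sqrtr_ge0 _.
have s0 : 0 <= Num.sqrt tau := sqrtr_ge0 _.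
have dual e : 0 < e -> ip muO z z <=
    x_ * Num.sqrt tau * nO z + e * (beta * x_ * Num.sqrt tau + (ip muI J J + aQ Gq Gq q q)).
  move=> e0; have [p [gp [Hp pn A]]] := V_approx T alpha0 beta0 zL e0.
  have [pL _] := H10_grad_allL2 Hp.
  have VP := V_grad_tensor JL Hp.
  have tpL := slab_tensor_Lfun2 a b T0 pL.
  have := A _ _ _ JL Vq; rewrite zz aformC.
  rewrite (aform_lin _ _ (-1) (V_grad_allL2 V1) (V_grad_allL2 V2) (V_grad_allL2 VP)).
  rewrite (H1 _ _ VP) (H2 m.+1 _ _ m1M Hp) (ip_lin beta lL dL tpL) (ip_lin beta lL dtauL tpL).
  have -> : ip muQ l (tensor J p) + beta * ip muQ d (tensor J p) +
      -1 * (ip muQ l (tensor J p) + beta * ip muQ dtau (tensor J p)) =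
      beta * ip muQ (cut (d \- dtau)) (tensor J p).
    rewrite -[X in ip _ (cut _) X](cut_tensor a b) ip_cut cut_tensor ipBl//.
    by ring.
  have cdL : cut (d \- dtau) \in Lfun muQ 2%:E by apply: cut_Lfun2 => //; exact: Lfun2B.
  have := le_trans (ler_norm _) (ip_CS cdL tpL).
  rewrite nQ_tensor// -/x_ distrC => c1 /(le_trans (ler_norm _)).
  have c2 : x_ * (Num.sqrt tau * nO p) <= x_ * (Num.sqrt tau * (nO z / beta + e)).
    by rewrite ler_wpM2l// ler_wpM2l.
  have := ler_wpM2l (ltW beta0) (le_trans c1 c2).
  (* The coupling factor beta cancels the 1/beta from the bound on p, so x enters with constant
     one. *)
  have -> : beta * (x_ * (Num.sqrt tau * (nO z / beta + e))) =
      x_ * Num.sqrt tau * nO z + e * (beta * x_ * Num.sqrt tau).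
    by field; rewrite gt_eqF.
  set K := ip muI J J + _; rewrite [e * (_ + K)]mulrDr.
  move: (e * K) (e * (beta * x_ * _)) (x_ * Num.sqrt tau * nO z)
    (beta * ip muQ (cut _) _) (ip muO z z) => A1 A2 A3 A4 A5; lra.
have zle : ip muO z z <= x_ * Num.sqrt tau * nO z.
  set K := beta * x_ * Num.sqrt tau + (ip muI J J + aQ Gq Gq q q) in dual.
  have K0 : 0 <= K.
    apply: addr_ge0; first by rewrite !mulr_ge0// ltW.
    by apply: addr_ge0; [exact: ip_ge0|exact: aform_ge0].
  apply/ler_addgt0Pr => e e0.
  have K1 : 0 < K + 1 by rewrite ltr_wpDl.
  apply: le_trans (dual (e / (K + 1)) (divr_gt0 e0 K1)) _.
  by rewrite lerD2l mulrAC ler_pdivrMr// ler_wpM2l ?lerDl// ltW.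
have zn : ip muO z z <= tau * x_ ^+ 2.
  have n0 : 0 <= nO z := sqrtr_ge0 _.
  have nz : nO z <= x_ * Num.sqrt tau.
    by apply: (sqr_le_mul n0); rewrite ?mulr_ge0// sqr_nrm.
  rewrite -sqr_nrm -[X in X * _](sqr_sqrtr (ltW tau0)) -exprMn.
  by rewrite lerXn2r ?nnegrE ?mulr_ge0// mulrC.
have -> : y_ = nQ (cut (offset phi w)).
  rewrite /y_ -(ae_eq_nrm cqL cq'L cqq').
  by congr (Num.sqrt (ip _ (cut _) (cut _))); apply/funext => u; rewrite /q/= mulN1r.
apply: sqrtr_le; first by rewrite addr_ge0// mulr_ge0 ?sqrtr_ge0 ?ltW.
(* The square of y is at most (tau B)^2 + |z|^2 / tau <= (tau B)^2 + x^2 <= (tau B + x)^2. *)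
apply: le_trans (cut_mean T0 a0 ab bT Hphi wL) _.
have B0 : 0 <= nQ (cut dt_phi) := sqrtr_ge0 _.
rewrite -/z.
have -> : tau ^+ 2 * ip muQ (cut dt_phi) (cut dt_phi) = (tau * nQ (cut dt_phi)) ^+ 2.
  by rewrite exprMn sqr_nrm.
have -> : (tau * nQ (cut dt_phi) + x_) ^+ 2 = (tau * nQ (cut dt_phi)) ^+ 2 + x_ ^+ 2
    + 2 * (tau * nQ (cut dt_phi) * x_) by ring.
rewrite -addrA lerD2l; apply: (@le_trans _ _ (x_ ^+ 2)).
  by rewrite ler_pdivrMl.
by rewrite lerDl !mulr_ge0// ltW.
Qed.

End one_interval.
End local_estimates.

(** * Discrete Gronwall argument *)

Section error_recursion.
Context (R : realType) (kappa h T : R) (M : nat) (t x y e A B : nat -> R).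
Hypotheses (kappa0 : 0 < kappa) (kh : 4 * kappa * h <= 1).
Hypotheses (t0 : t 0%N = 0) (tT : forall m, (m <= M)%N -> t m <= T).
Hypothesis step_gt0 : forall m, (m < M)%N -> 0 < t m.+1 - t m.
Hypothesis step_le : forall m, (m < M)%N -> t m.+1 - t m <= h.
Hypotheses (x0 : forall m, 0 <= x m) (y0 : forall m, 0 <= y m)
  (e_ge0 : forall m, 0 <= e m) (A0 : forall m, 0 <= A m) (B0 : forall m, 0 <= B m).
Hypothesis e0 : e 0%N = 0.
Hypothesis e_step : forall m, (m < M)%N ->
  e m.+1 <= e m + kappa * Num.sqrt (t m.+1 - t m) * (x m + y m).
Hypothesis x_le : forall m, (m < M)%N ->
  x m <= (t m.+1 - t m) * A m + Num.sqrt (t m.+1 - t m) * e m.+1.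
Hypothesis y_le : forall m, (m < M)%N -> y m <= (t m.+1 - t m) * B m + x m.

Let tau m := t m.+1 - t m.
Let s m := Num.sqrt (tau m).
(** From x + y <= 2 x + tau B and the bound on x: x + y <= tau (2 A + B) + 2 sqrt(tau) e. *)
Let G m := 2 * A m + B m.
Let S m := \sum_(j < m) s j * G j.
Let Q m := \sum_(j < m) G j ^+ 2.

Let G0 m : 0 <= G m. Proof. by rewrite addr_ge0// mulr_ge0. Qed.
Let s0 m : 0 <= s m. Proof. exact: sqrtr_ge0. Qed.
Let S0 m : 0 <= S m. Proof. by apply: sumr_ge0 => j _; rewrite mulr_ge0. Qed.
Let Q0 m : 0 <= Q m. Proof. by apply: sumr_ge0 => j _; rewrite sqr_ge0. Qed.
Let ss m : (m < M)%N -> s m ^+ 2 = tau m.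
Proof. by move=> mM; rewrite sqr_sqrtr// ltW// step_gt0. Qed.

Let h0 m : (m < M)%N -> 0 < h.
Proof. by move=> mM; exact: lt_le_trans (step_gt0 mM) (step_le mM). Qed.

Let t_ge0 m : (m <= M)%N -> 0 <= t m.
Proof.
elim: m => [|m IH mM]; first by rewrite t0.
have := step_gt0 mM; have := IH (ltnW mM); lra.
Qed.

(** Cauchy-Schwarz for sqrt(tau_j) against G_j, by induction on m; the step lengths add up to
    t_m. *)
Let sum_cauchy m : (m <= M)%N -> S m ^+ 2 <= t m * Q m.
Proof.
elim: m => [|m IH mM]; first by rewrite /S big_ord0 t0 mul0r expr0n.
have {IH} := IH (ltnW mM).
rewrite /S/Q !big_ord_recr/= -/(S m) -/(Q m).
have tE : t m.+1 = t m + s m ^+ 2 by rewrite ss// /tau; ring.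
rewrite tE; have := t_ge0 (ltnW mM).
have := S0 m; have := Q0 m; have := s0 m; have := G0 m.
move: (S m) (Q m) (s m) (G m) (t m) => a b c g u g0 c0 b0 a0 u0 h1.
have -> : (u + c ^+ 2) * (b + g ^+ 2) =
    u * b + c ^+ 2 * g ^+ 2 + (u * g ^+ 2 + c ^+ 2 * b) by ring.
have -> : (a + c * g) ^+ 2 = a ^+ 2 + c ^+ 2 * g ^+ 2 + 2 * (a * (c * g)) by ring.
suff : 2 * (a * (c * g)) <= u * g ^+ 2 + c ^+ 2 * b by lra.
have k1 : a <= Num.sqrt u * Num.sqrt b.
  by rewrite -sqrtrM// -(ger0_norm a0) -sqrtr_sqr ler_wsqrtr.
rewrite -[X in X * _ + _](sqr_sqrtr u0) -[X in _ + _ * X](sqr_sqrtr b0).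
have : a * (c * g) <= Num.sqrt u * Num.sqrt b * (c * g) by rewrite ler_wpM2r// mulr_ge0.
move: (Num.sqrt u) (Num.sqrt b) => p q k2.
have := sqr_ge0 (p * g - c * q); nra.
Qed.

(** The step reads e_(m+1) (1 - 2 kappa tau) <= e_m + kappa h s_m G_m. The factor on the left is
    inverted by exp(4 kappa tau), and the product of these exponentials is exp(4 kappa t_m). *)
Let gronwall m : (m <= M)%N -> e m <= expR (4 * kappa * t m) * (kappa * h * S m).
Proof.
elim: m => [_|m IH mM]; first by rewrite e0 /S big_ord0 !mulr0.
have {IH} := IH (ltnW mM).
have st := ss mM; have h_gt0 := h0 mM; have th : tau m <= h := step_le mM.
have tp : 0 < tau m := step_gt0 mM.
have := e_step mM; rewrite -/(tau m) -/(s m) => es.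
have := x_le mM; rewrite -/(tau m) -/(s m) => xs.
have := y_le mM; rewrite -/(tau m) => ys.
have -> : t m.+1 = t m + tau m by rewrite /tau; ring.
rewrite [4 * kappa * (_ + _)]mulrDr expRD.
rewrite /S big_ord_recr/= -/(S m).
(* With u = kappa tau, (1 - 2u)(1 + 4u) = 1 + 2u (1 - 4u) is at least 1 because u <= 1/4; this fixes
   the bound on the mesh. *)
have c1 : 1 <= (1 - 2 * kappa * tau m) * expR (4 * kappa * tau m).
  have k1 : kappa * tau m <= kappa * h by rewrite ler_pM2l.
  have k0 : 0 < kappa * tau m by rewrite mulr_gt0.
  have := expR_ge1Dx (4 * kappa * tau m); rewrite -!mulrA.
  move: k0 k1; move: (kappa * tau m) => u u0 u1 ex.
  apply: (@le_trans _ _ ((1 - 2 * u) * (1 + 4 * u))); last first.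
    by apply: ler_wpM2l => //; move: kh; lra.
  by move: kh; nra.
have c2 : 1 <= expR (4 * kappa * t m).
  by rewrite -expR0 ler_expR mulr_ge0 ?(t_ge0 (ltnW mM))// mulr_ge0 ?(ltW kappa0).
have := expR_ge0 (4 * kappa * tau m).
move: (expR _) (expR _) c1 c2 => F E c1 c2 E0 em.
have es' : e m.+1 * (1 - 2 * kappa * tau m) <= e m + kappa * h * (s m * G m).
  have k1 : x m + y m <= tau m * G m + 2 * (s m * e m.+1) by rewrite /G; lra.
  have k2 := ler_wpM2l (mulr_ge0 (ltW kappa0) (s0 m)) k1.
  have k3 : kappa * s m * (tau m * G m + 2 * (s m * e m.+1)) =
    kappa * tau m * (s m * G m) + 2 * kappa * tau m * e m.+1.
    by rewrite -st; ring.
  have k4 : kappa * tau m * (s m * G m) <= kappa * h * (s m * G m).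
    by rewrite ler_wpM2r ?mulr_ge0// ler_pM2l.
  lra.
have Z0 : 0 <= kappa * h * (s m * G m) by rewrite !mulr_ge0// ltW.
pose Z := F * (kappa * h * (S m + s m * G m)).
have eZ : e m.+1 * (1 - 2 * kappa * tau m) <= Z.
  apply: le_trans es' _; have -> : Z = F * (kappa * h * S m) + F * (kappa * h * (s m * G m)).
    by rewrite /Z; ring.
  by rewrite lerD// ler_peMl.
have Z_ge0 : 0 <= Z.
  by rewrite !mulr_ge0 ?addr_ge0 ?mulr_ge0 ?(ltW kappa0) ?(ltW h_gt0)//; lra.
have -> : F * E * (kappa * h * (S m + s m * G m)) = Z * E by rewrite /Z; ring.
apply: le_trans (_ : e m.+1 * ((1 - 2 * kappa * tau m) * E) <= _).
  by rewrite ler_peMr.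
by rewrite mulrA ler_wpM2r.
Qed.

Let K := expR (4 * kappa * T) * kappa.
Let SA := \sum_(j < M) A j ^+ 2.
Let SB := \sum_(j < M) B j ^+ 2.

Let nodal_bound m : (m <= M)%N -> e m ^+ 2 <= (K * h) ^+ 2 * (T * (8 * SA + 2 * SB)).
Proof.
move=> mM.
have T0 : 0 <= T by apply: le_trans (tT mM); exact: t_ge0.
have S8 : 0 <= 8 * SA + 2 * SB.
  by rewrite addr_ge0// mulr_ge0// sumr_ge0// => j _; rewrite sqr_ge0.
case: m mM => [|m] mM; first by rewrite e0 expr0n/= mulr_ge0 ?sqr_ge0// mulr_ge0.
have h_gt0 := h0 mM.
have K0 : 0 <= K by rewrite mulr_ge0 ?expR_ge0 ?ltW.
have Q_le : Q m.+1 <= 8 * SA + 2 * SB.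
  rewrite /SA /SB !mulr_sumr -big_split/=.
  rewrite /Q (big_ord_widen M (fun j => G j ^+ 2) mM) big_mkcond/=.
  (* The gap 8 A^2 + 2 B^2 - (2 A + B)^2 is (2 A - B)^2. *)
  apply: ler_sum => j _; have : G j ^+ 2 <= 8 * A j ^+ 2 + 2 * B j ^+ 2.
    by rewrite /G; have := sqr_ge0 (2 * A j - B j); nra.
  case: ifP => // _; apply: le_trans; exact: sqr_ge0.
have e_le : e m.+1 <= K * h * S m.+1.
  apply: le_trans (gronwall mM) _; rewrite /K mulrA mulrA -!mulrA.
  rewrite ler_wpM2r ?mulr_ge0 ?(ltW kappa0) ?(ltW h_gt0)//.
  by rewrite ler_expR !mulrA ler_wpM2l ?tT// mulr_ge0// ltW.
apply: (@le_trans _ _ ((K * h * S m.+1) ^+ 2)).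
  by rewrite lerXn2r ?nnegrE// !mulr_ge0// ltW.
rewrite exprMn ler_wpM2l ?sqr_ge0//; apply: le_trans (sum_cauchy mM) _.
apply: ler_pM => //; [exact: t_ge0|exact: tT].
Qed.

Let step_sum : \sum_(j < M) tau j = t M.
Proof.
rewrite -(big_mkord xpredT tau) telescope_sumr ?t0 ?subr0//.
Qed.

(** The 2 is the factor from squaring a sum of two terms; 16 is that factor times the 8 of the nodal
    bound. One T comes from the nodal bound, the other from summing the steps. *)
Definition recursion_const := 2 + 16 * (T * (expR (4 * kappa * T) * kappa)) ^+ 2.

Local Notation C1 := recursion_const.

Lemma x_sum : \sum_(j < M) x j ^+ 2 <= h ^+ 2 * (C1 * (SA + SB)).
Proof.
have SA0 : 0 <= SA by rewrite sumr_ge0// => j _; rewrite sqr_ge0.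
have SB0 : 0 <= SB by rewrite sumr_ge0// => j _; rewrite sqr_ge0.
pose Em := (K * h) ^+ 2 * (T * (8 * SA + 2 * SB)).
have T0 : 0 <= T by rewrite -t0 tT.
have Em0 : 0 <= Em by rewrite mulr_ge0 ?sqr_ge0// mulr_ge0// addr_ge0 ?mulr_ge0.
apply: (@le_trans _ _ (\sum_(j < M) (2 * h ^+ 2 * A j ^+ 2 + 2 * Em * tau j))).
  apply: ler_sum => j _; have jM := ltn_ord j.
  have := x_le jM; rewrite -/(tau j) -/(s j) => xj.
  have th : tau j <= h := step_le jM; have tp : 0 < tau j := step_gt0 jM.
  have Ej := nodal_bound jM; rewrite -/Em in Ej.
  apply: (@le_trans _ _ ((tau j * A j + s j * e j.+1) ^+ 2)).
    by rewrite lerXn2r ?nnegrE ?addr_ge0 ?mulr_ge0// ltW.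
  apply: (@le_trans _ _ (2 * (tau j * A j) ^+ 2 + 2 * (s j * e j.+1) ^+ 2)).
    by move: (tau j * A j) (s j * e j.+1) => p q; have := sqr_ge0 (p - q); nra.
  rewrite !exprMn (ss jM).
  have hh : tau j ^+ 2 <= h ^+ 2 by rewrite lerXn2r ?nnegrE ?(ltW tp) ?(le_trans (ltW tp)).
  have k1 := ler_wpM2r (sqr_ge0 (A j)) hh; have k2 := ler_wpM2l (ltW tp) Ej.
  move: k1 k2; move: (tau j ^+ 2 * _) (tau j * _ ^+ 2) => p q k1 k2.
  by apply: lerD; [rewrite -mulrA ler_pM2l|rewrite -mulrA ler_pM2l// [Em * _]mulrC].
rewrite big_split/= -!mulr_sumr step_sum -/SA.
have c1 : 2 * Em * t M <= 2 * Em * T by rewrite ler_wpM2l ?tT// mulr_ge0.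
apply: le_trans (lerD (lexx _) c1) _.
rewrite /Em /recursion_const -/K.
have -> : 2 * ((K * h) ^+ 2 * (T * (8 * SA + 2 * SB))) * T =
  h ^+ 2 * ((T * K) ^+ 2 * (16 * SA + 4 * SB)) by ring.
have -> : 2 * h ^+ 2 * SA = h ^+ 2 * (2 * SA) by ring.
rewrite -mulrDr ler_wpM2l ?sqr_ge0//.
have := sqr_ge0 (T * K); move: ((T * K) ^+ 2) => k k0.
have := mulr_ge0 k0 SA0; have := mulr_ge0 k0 SB0; lra.
Qed.

Lemma y_sum : \sum_(j < M) y j ^+ 2 <= h ^+ 2 * ((2 + 2 * C1) * (SA + SB)).
Proof.
have SA0 : 0 <= SA by rewrite sumr_ge0// => j _; rewrite sqr_ge0.
apply: (@le_trans _ _ (\sum_(j < M) (2 * h ^+ 2 * B j ^+ 2 + 2 * x j ^+ 2))).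
  apply: ler_sum => j _; have jM := ltn_ord j.
  have := y_le jM; rewrite -/(tau j) => yj.
  have th : tau j <= h := step_le jM; have tp : 0 < tau j := step_gt0 jM.
  apply: (@le_trans _ _ ((tau j * B j + x j) ^+ 2)).
    by rewrite lerXn2r ?nnegrE ?addr_ge0 ?mulr_ge0// ltW.
  apply: (@le_trans _ _ (2 * (tau j * B j) ^+ 2 + 2 * x j ^+ 2)).
    by move: (tau j * B j) (x j) => p q; have := sqr_ge0 (p - q); nra.
  rewrite exprMn lerD2r -mulrA ler_pM2l//.
  by rewrite ler_wpM2r ?sqr_ge0// lerXn2r ?nnegrE ?(ltW tp) ?(le_trans (ltW tp)).
rewrite big_split/= -!mulr_sumr -/SB.
have := x_sum; have := mulr_ge0 (sqr_ge0 h) SA0.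
have -> : h ^+ 2 * ((2 + 2 * C1) * (SA + SB)) =
  2 * (h ^+ 2 * SA) + 2 * h ^+ 2 * SB + 2 * (h ^+ 2 * (C1 * (SA + SB))) by ring.
move: (h ^+ 2 * SA) (2 * h ^+ 2 * SB) (h ^+ 2 * (_ * _)) (\sum_(_ < _) _).
by move=> a b c u a0 uc; lra.
Qed.

End error_recursion.

Lemma le_mesh (R : realType) (M : nat) (t : nat -> R) m : (m < M)%N ->
  t m.+1 - t m <= mesh M t.
Proof.
by move=> mM; exact: (@le_bigmax _ _ _ 0 (fun j : 'I_M => t j.+1 - t j) (Ordinal mM)).
Qed.

Lemma mesh_ge0 (R : realType) (M : nat) (t : nat -> R) : 0 <= mesh M t.
Proof. exact: bigmax_ge_id. Qed.

(** * Summation over the time intervals *)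

Section sum_slabs.
Context (R : realType) (N : nat) (Omega : polyhedral_domain R N) (T : R).
Variables (M : nat) (t : nat -> R).
Hypotheses (T0 : 0 < T) (Ht : is_partition T M t).
Local Notation TX := (measurableTypeR R * 'rV[R]_N)%type.
Local Notation muI := (@muI R T).
Local Notation muO := (muO Omega).
Local Notation muQ := (muQ Omega T).

Lemma sum_slab (s : R) k : (k <= M)%N -> 0 < s ->
  \sum_(m < k) slab (t m) (t m.+1) s = (s <= t k)%R%:R.
Proof.
move=> + s0; elim: k => [_|k IH kM].
  by have [-> _ _] := Ht; rewrite big_ord0 leNgt s0.
rewrite big_ord_recr/= IH; last exact: ltnW.
have ab := partition_le Ht (leqnSn k) kM.
have [sk|ks] := leP s (t k).
  by rewrite (le_trans sk ab) /slab indF ?addr0//= in_itv/= ltNge sk.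
by have [sk1|k1s] := leP s (t k.+1); rewrite add0r /slab; [rewrite indT|rewrite indF];
  rewrite //= in_itv/= ks// leNgt k1s.
Qed.

Lemma ip_sum_cut (u : TX -> R) : u \in Lfun muQ 2%:E ->
  ip muQ u u = \sum_(m < M) ip muQ (cut (t m) (t m.+1) u) (cut (t m) (t m.+1) u).
Proof.
move=> uL; pose g s := ip muO (fun y => u (s, y)) (fun y => u (s, y)).
have gi : muI.-integrable setT (EFin \o g) by exact: integrable_ip1.
have /measurable_EFinP mg := measurable_int _ gi.
have sgi (m : 'I_M) : muI.-integrable setT (EFin \o (fun s => g s * slab (t m) (t m.+1) s)).
  by apply: (@integrable_mulb _ _ _ _ 1) gi; [exact: measurable_ind|exact: ind_norm].
have E (m : 'I_M) : ip muQ (cut (t m) (t m.+1) u) (cut (t m) (t m.+1) u) =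
    \int[muI]_s (g s * slab (t m) (t m.+1) s).
  have cL : cut (t m) (t m.+1) u \in Lfun muQ 2%:E by exact: cut_Lfun2.
  rewrite (ip_fubini1 cL cL).
  rewrite (@ae_eq_Rintegral _ _ _ _ _ (fun s => g s * slab (t m) (t m.+1) s))//.
  - have /measurable_EFinP := measurable_int _ (integrable_ip1 cL cL); exact.
  - by have /measurable_EFinP := measurable_int _ (sgi m).
  - apply: filterS (ae_slice1_Lfun2 uL) => s usL.
    have sL := Lfun2Z (slab (t m) (t m.+1) s) usL.
    rewrite /cut/= (ipZl _ usL sL) (ipZr _ usL usL) mulrA indM mulrC.
    by [].
under eq_bigr do rewrite E.
rewrite -Rintegral_sum// (ip_fubini1 uL uL); apply: ae_eq_Rintegral => //.
  by apply: measurable_sum => m; have /measurable_EFinP := measurable_int _ (sgi m).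
apply: ae_restr; apply: aeW => s; rewrite /= in_itv/= => /andP[s0 sT].
by rewrite -mulr_sumr sum_slab//; have [_ -> _] := Ht; rewrite (ltW sT) mulr1.
Qed.

End sum_slabs.

Theorem theorem3p6 (R : realType) (N : nat) (hN : N = 2%N \/ N = 3%N)
    (Omega : polyhedral_domain R N) (T alpha beta delta r : R)
    (hT : 0 < T) (halpha : 0 < alpha) (hbeta : 0 < beta) (hdelta : 0 < delta)
    (hr : 0 < r) :
  exists tau0 C : R, [/\ 0 < tau0, 0 < C &
    forall (M : nat) (t : nat -> R), is_partition T M t -> mesh M t <= tau0 ->
    forall (l : measurableTypeR R * 'rV[R]_N -> R) (d0 : 'rV[R]_N -> R),
      in_X Omega T l -> d0 \in Lfun (muO Omega) 2%:E ->
    forall phi d phitau dtau : measurableTypeR R * 'rV[R]_N -> R,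
      state_solution Omega T alpha beta delta r l d0 phi d ->
      semidiscrete_solution Omega T alpha beta delta r l d0 M t phitau dtau ->
      in_X Omega T phi /\
      forall dt_phi dt_d : measurableTypeR R * 'rV[R]_N -> R,
        is_dt Omega T phi dt_phi -> is_dt Omega T d dt_d ->
        L2norm (muQ Omega T) (phi \- phitau) + L2norm (muQ Omega T) (d \- dtau)
        <= C * mesh M t
           * (L2norm (muQ Omega T) dt_phi + L2norm (muQ Omega T) dt_d)].
Proof.
pose kappa := beta / delta; have kappa0 : 0 < kappa by rewrite divr_gt0.
(* The constant of [y_sum], which also dominates that of [x_sum]. *)
pose C := 2 + 2 * recursion_const kappa T.
have rc2 : 2 <= recursion_const kappa T by rewrite lerDl mulr_ge0 ?sqr_ge0.
have C1 : 1 <= C by rewrite /C; lra.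
exists (4 * kappa)^-1, (2 * C); split.
- by rewrite invr_gt0 mulr_gt0.
- by rewrite mulr_gt0// (lt_le_trans ltr01).
move=> M t Ht mesh_le l d0 lX d0L phi d phitau dtau sol sold.
split; first exact: (state_phi_in_X hT halpha hbeta lX sol).
move=> dt_phi dt_d Hphi Hd; set h := mesh M t in mesh_le *.
have h0 : 0 <= h by exact: mesh_ge0.
have kh : 4 * kappa * h <= 1.
  have k4 : 0 < 4 * kappa by rewrite mulr_gt0.
  apply: le_trans (ler_wpM2l (ltW k4) mesh_le) _.
  by rewrite divff// gt_eqF.
have [phiL dphiL _] := Hphi; have [dL ddL _] := Hd.
have dtauL : dtau \in Lfun (muQ Omega T) 2%:E by have [? [_ []]] := sold.
have phitauL : phitau \in Lfun (muQ Omega T) 2%:E.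
  by have [? [[/V_grad_allL2[]]]] := sold.
have xL := Lfun2B dL dtauL; have yL := Lfun2B phiL phitauL.
pose nc (u : measurableTypeR R * 'rV[R]_N -> R) m :=
  Num.sqrt (ip (muQ Omega T) (cut (t m) (t m.+1) u) (cut (t m) (t m.+1) u)).
pose e m := Num.sqrt (ip (muO Omega)
  (nodal_error T t d0 dtau dt_d m) (nodal_error T t d0 dtau dt_d m)).
have [t0 tM tlt] := Ht.
have nc_sum u : u \in Lfun (muQ Omega T) 2%:E ->
    \sum_(m < M) nc u m ^+ 2 = ip (muQ Omega T) u u.
  by move=> uL; rewrite (ip_sum_cut Ht uL); apply: eq_bigr => m _; exact: sqr_nrm.
have step_gt0 m : (m < M)%N -> 0 < t m.+1 - t m by move=> mM; rewrite subr_gt0 tlt.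
have step_le m : (m < M)%N -> t m.+1 - t m <= h by exact: le_mesh.
have t_le m : (m <= M)%N -> t m <= T by move=> /(partition_bound Ht)/andP[].
have e0 : e 0%N = 0 by exact: (nodal_error0 hT Ht d0L sold Hd).
have nc0 u m : 0 <= nc u m by exact: sqrtr_ge0.
have e_ge0 m : 0 <= e m by exact: sqrtr_ge0.
have e_step m : (m < M)%N -> e m.+1 <=
    e m + kappa * Num.sqrt (t m.+1 - t m) * (nc (d \- dtau) m + nc (phi \- phitau) m).
  by move=> mM; exact: (nodal_step hT hbeta hdelta hr Ht d0L sol sold Hphi Hd mM).
have x_le m : (m < M)%N -> nc (d \- dtau) m <=
    (t m.+1 - t m) * nc dt_d m + Num.sqrt (t m.+1 - t m) * e m.+1.
  by move=> mM; exact: (x_bound hT Ht d0L sol sold Hd mM).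
have y_le m : (m < M)%N -> nc (phi \- phitau) m <=
    (t m.+1 - t m) * nc dt_phi m + nc (d \- dtau) m.
  by move=> mM; exact: (y_bound hT halpha hbeta Ht lX sol sold Hphi Hd mM).
have xs := x_sum kappa0 kh t0 t_le step_gt0 step_le (nc0 _) e_ge0 (nc0 _) (nc0 _)
  e0 e_step x_le y_le.
have ys := y_sum kappa0 kh t0 t_le step_gt0 step_le (nc0 _) (nc0 _) e_ge0 (nc0 _) (nc0 _)
  e0 e_step x_le y_le.
rewrite !nc_sum// in xs ys.
rewrite !L2normE//.
have a0 := sqrtr_ge0 (ip (muQ Omega T) dt_phi dt_phi).
have b0 := sqrtr_ge0 (ip (muQ Omega T) dt_d dt_d).
rewrite -(sqr_nrm _ dt_phi) -(sqr_nrm _ dt_d) in xs ys.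
(* Taking roots: sqrt(C) <= C because C >= 1, and u^2 + v^2 <= (u + v)^2. *)
have E u v : 0 <= u -> 0 <= v -> forall w, 0 <= w ->
    w <= h ^+ 2 * (C * (u ^+ 2 + v ^+ 2)) -> Num.sqrt w <= C * h * (v + u).
  move=> u0 v0 w w0 wle.
  have C0 : 0 <= C by lra.
  apply: sqrtr_le; first by apply: mulr_ge0; [exact: mulr_ge0|exact: addr_ge0].
  apply: le_trans wle _.
  have -> : (C * h * (v + u)) ^+ 2 =
      h ^+ 2 * (C * (C * (u ^+ 2 + v ^+ 2)) + C * (C * (2 * (u * v)))) by ring.
  apply: ler_wpM2l; first exact: sqr_ge0.
  apply: (@le_trans _ _ (C * (C * (u ^+ 2 + v ^+ 2)))).
    by rewrite ler_wpM2l// ler_peMl// addr_ge0 ?sqr_ge0.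
  by rewrite lerDl; do 4 ?[apply: mulr_ge0 => //].
have ye := E _ _ b0 a0 _ (ip_ge0 _ _) ys.
have xe : Num.sqrt (ip (muQ Omega T) (d \- dtau) (d \- dtau)) <=
    C * h * (Num.sqrt (ip (muQ Omega T) dt_phi dt_phi) +
      Num.sqrt (ip (muQ Omega T) dt_d dt_d)).
  apply: E => //; first exact: ip_ge0.
  apply: le_trans xs _; apply: ler_wpM2l; first exact: sqr_ge0.
  apply: ler_wpM2r; first by rewrite addr_ge0 ?sqr_ge0.
  by rewrite /C; lra.
apply: le_trans (lerD ye xe) _.
by rewrite le_eqVlt; apply/orP; left; apply/eqP; ring.
Qed.
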